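(* Let $n\geq 6$ be an integer and let $$\overline{P}(z)=z^{n}+az^{n-1}+bz^{n-2},$$ where $a,b\in\mathbb{C}$, $ab\neq 0$ and $a^{2}=\lambda b$ with $\lambda=4\left(1-\frac{1}{(n-1)^{2}}\right)$. Then $\overline{P}(z)$ is a strong uniqueness polynomial for meromorphic functions.
   Context: A polynomial $P$ is a strong uniqueness polynomial for meromorphic functions if for any two non-constant meromorphic functions $f,g$ on $\mathbb{C}$ and any non-zero constant $A\in\mathbb{C}$, $P(f)\equiv AP(g)$ implies $f\equiv g$. *)

(* Defs.v *)
From HB Require Import structures.
From mathcomp Require Import all_boot all_order all_algebra complex.
From mathcomp Require Import all_classical all_reals all_analysis.
Set Implicit Arguments.
Unset Strict Implicit.
Unset Printing Implicit Defensive.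
Import Order.TTheory GRing.Theory Num.Theory.
Import numFieldNormedType.Exports.

Local Open Scope ring_scope.
Local Open Scope classical_set_scope.

(* Packing R[i] as a structure lets the generic topology and norm of a
   numFieldType apply to it; over this field, [derivable f z 1] is complex
   differentiability. *)
Definition Cplx (R : realType) : numClosedFieldType := R[i]%C.

(* The Riemann sphere; [None] is the point at infinity. *)
Definition sphere (R : realType) : Type := option (Cplx R).

Definition finite_part (R : realType) (f : Cplx R -> sphere R) (z : Cplx R) :
  Cplx R := odflt 0 (f z).

(* The first clause says that every point is a regular point or an isolated
   singularity; the second, that [f z] is finite exactly at the regular points
   and that every singularity is a pole, i.e. |f| tends to infinity there. *)
Definition meromorphic (R : realType) (f : Cplx R -> sphere R) : Prop :=
  forall z : Cplx R,
    (\forall w \near z^', f w <> None /\ derivable (finite_part f) w 1) /\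
    match f z with
    | Some _ => derivable (finite_part f) z 1
    | None => forall M : Cplx R, 0 < M ->
                \forall w \near z^', M < `|finite_part f w|
    end.

Definition nonconstant (R : realType) (f : Cplx R -> sphere R) : Prop :=
  ~ exists c : sphere R, forall z, f z = c.

(* A polynomial as a map of the sphere: infinity is fixed unless the
   polynomial is constant. *)
Definition sphere_horner (R : realType) (P : {poly Cplx R}) (w : sphere R) :
  sphere R :=
  match w with
  | Some u => Some P.[u]
  | None => if (size P <= 1)%N then Some P`_0 else None
  end.

Definition strong_uniqueness_poly (R : realType) (P : {poly Cplx R}) : Prop :=
  forall (f g : Cplx R -> sphere R) (A : Cplx R),
    meromorphic f -> meromorphic g -> nonconstant f -> nonconstant g ->
    A != 0 ->
    (forall z, sphere_horner P (f z) =
               omap (fun u => A * u) (sphere_horner P (g z))) ->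
    forall z, f z = g z.

(* Main.v *)
Require Import Defs.
From HB Require Import structures.
From mathcomp Require Import all_boot all_order all_algebra complex.
From mathcomp Require Import all_classical all_reals all_analysis.
From mathcomp Require Import separable.
From mathcomp Require Import ring lra zify.
Set Implicit Arguments.
Unset Strict Implicit.
Unset Printing Implicit Defensive.
Import Order.TTheory GRing.Theory Num.Theory.
Import numFieldNormedType.Exports.
Import ComplexField.Normc.
Local Open Scope ring_scope.
Local Open Scope classical_set_scope.

(* Let [h] be the meromorphic extension of [f / g]. Dividing P(f) = A P(g) by g^(n - 2) leaves a
   quadratic equation for [g] with coefficients in C[h], so its discriminant Q(h) is the square of
   a meromorphic function. The relation between [a] and [b] makes 1 the only possible multiple
   root of the polynomial Q, with multiplicity at most 4, so Q has q > 4 simple roots when n >= 6,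
   and [h] is ramified over each of them because Q(h) is a square. The metric
   prod_a ((1 + |w - a|)^((q - 4) / q) / |w - a|) |dw|^2, where [a] runs over these roots, has
   curvature bounded above by a negative constant; ramification keeps its pullback by [h] bounded,
   and Ahlfors' form of the Schwarz lemma on larger and larger discs gives h' = 0. Thus f = c g,
   and comparing P(c g) with A P(g) for nonconstant [g] gives c = 1. *)

(** * Complex modulus and topology *)

Section ComplexModulus.
Context {R : realType}.
Local Notation C := (Cplx R).
Local Notation Re := (@complex.Re R).
Local Notation Im := (@complex.Im R).
Implicit Types (z w v : C) (t : R).

Definition of_real t : C := real_complex R t.
HB.instance Definition _ := GRing.RMorphism.copy of_real (real_complex R).
Local Notation "t %:C" := (of_real t).

Lemma ltr_of_real s t : (s%:C < t%:C) = (s < t). Proof. exact: ltcR. Qed.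

Lemma normrE z : `|z| = (normc z)%:C. Proof. by case: z => a b; exact: normc_def. Qed.

Lemma normc_ge0 z : 0 <= normc z.
Proof. exact: (normr_ge0 (z : Rcomplex R)). Qed.

Lemma normc_eq0 z : (normc z == 0) = (z == 0).
Proof. exact: (normr_eq0 (z : Rcomplex R)). Qed.

Lemma normc_gt0 z : (0 < normc z) = (z != 0).
Proof. exact: (normr_gt0 (z : Rcomplex R)). Qed.

Lemma distcC z w : normc (z - w) = normc (w - z).
Proof. exact: (distrC (z : Rcomplex R)). Qed.

Lemma ler_distcD w z v : normc (z - v) <= normc (z - w) + normc (w - v).
Proof. exact: (ler_distD (w : Rcomplex R)). Qed.

Lemma lerB_distc z w : normc z - normc w <= normc (z - w).
Proof. exact: (lerB_dist (z : Rcomplex R)). Qed.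

Lemma normcX z n : normc (z ^+ n) = normc z ^+ n.
Proof. by elim: n => [|n IH]; rewrite ?expr0 ?normc1// !exprS normcM IH. Qed.

Lemma normc_real t : normc t%:C = `|t|.
Proof. by rewrite /= expr0n addr0 sqrtr_sqr. Qed.

Lemma normc_nat n : normc (n%:R : C) = n%:R.
Proof. by rewrite -(rmorph_nat of_real) normc_real normr_nat. Qed.

Lemma sqr_normcE z : normc z ^+ 2 = Re z ^+ 2 + Im z ^+ 2.
Proof. by case: z => a b; rewrite sqr_sqrtr// addr_ge0// sqr_ge0. Qed.

Lemma sqr_normc_lt z t : normc z < t -> 0 < t ^+ 2 - normc z ^+ 2.
Proof.
move=> zt; have t0 : 0 < t := le_lt_trans (normc_ge0 z) zt.
by rewrite subr_gt0 ltr_pXn2r// nnegrE ?normc_ge0// ltW.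
Qed.

Lemma Re_le_normc z : `|Re z| <= normc z.
Proof. by case: z => a b; rewrite -sqrtr_sqr ler_wsqrtr// lerDl sqr_ge0. Qed.

Lemma Im_le_normc z : `|Im z| <= normc z.
Proof. by case: z => a b; rewrite -sqrtr_sqr ler_wsqrtr// lerDr sqr_ge0. Qed.

Lemma normc_le_ReIm z : normc z <= `|Re z| + `|Im z|.
Proof.
rewrite -(@ler_pXn2r _ 2)// ?nnegrE ?normc_ge0 ?addr_ge0//.
rewrite sqr_normcE -[Re z ^+ 2]real_normK ?num_real//.
rewrite -[Im z ^+ 2]real_normK ?num_real//.
have := normr_ge0 (Re z); have := normr_ge0 (Im z); nra.
Qed.

Lemma ReD z w : Re (z + w) = Re z + Re w. Proof. by case: z w => [a b] []. Qed.
Lemma ImD z w : Im (z + w) = Im z + Im w. Proof. by case: z w => [a b] []. Qed.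
Lemma ReN z : Re (- z) = - Re z. Proof. by case: z. Qed.
Lemma ImN z : Im (- z) = - Im z. Proof. by case: z. Qed.
Lemma ReM z w : Re (z * w) = Re z * Re w - Im z * Im w.
Proof. by case: z w => [a b] []. Qed.
Lemma ImM z w : Im (z * w) = Re z * Im w + Im z * Re w.
Proof. by case: z w => [a b] []. Qed.

Definition ReImE := (ReD, ImD, ReN, ImN, ReM, ImM).

Lemma eqc z w : Re z = Re w -> Im z = Im w -> z = w.
Proof. by case: z w => [a b] [c d] /= -> ->. Qed.

End ComplexModulus.
Notation "t %:C" := (of_real t) : ring_scope.

Section ComplexTopology.
Context {R : realType}.
Local Notation C := (Cplx R).
Implicit Types (l x z w : C) (r : R).

Lemma nearcP z (P : set C) :
  (\forall w \near z, P w) <-> exists2 e : R, 0 < e & forall w, normc (w - z) < e -> P w.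
Proof.
split=> [/nbhs_ballP[e /= e0 he]|[e e0 he]].
  have ee : (complex.Re e)%:C = e by apply: RRe_real; exact: gtr0_real.
  exists (complex.Re e); first by rewrite -ltr_of_real ee rmorph0.
  by move=> w wz; apply: he; rewrite -ball_normE /= distrC normrE -ee ltr_of_real.
apply/nbhs_ballP; exists e%:C => /=; first by rewrite -(rmorph0 of_real) ltr_of_real.
by move=> w; rewrite -ball_normE /= distrC normrE ltr_of_real => /he.
Qed.

Lemma dnearcP z (P : set C) : (\forall w \near z^', P w) <->
  exists2 e : R, 0 < e & forall w, w != z -> normc (w - z) < e -> P w.
Proof.
have dnearE : (\forall w \near z^', P w) <-> \forall w \near z, w != z -> P w by [].
split=> [/dnearE/nearcP[e e0 he]|[e e0 he]]; first by exists e => // w wz /he; exact.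
by apply/dnearE/nearcP; exists e => // w we wz; exact: he.
Qed.

Lemma dnear_join z (P : set C) : (\forall w \near z^', P w) ->
  \forall w \near z^', \forall v \near w, P v.
Proof.
move=> /dnearcP[e e0 he]; apply/dnearcP; exists e => // w wz we.
have wz0 : 0 < normc (w - z) by rewrite normc_gt0 subr_eq0.
apply/nearcP; exists (Order.min (normc (w - z)) (e - normc (w - z))) => [|v].
  by rewrite lt_min wz0 subr_gt0.
rewrite lt_min => /andP[vw ve]; apply: he; last by have := ler_distcD w v z; lra.
by apply: contraTneq vw => ->; rewrite distcC ltxx.
Qed.

Lemma near_dnear z (P : set C) : (\forall w \near z, P w) -> \forall w \near z^', P w.
Proof. exact: nbhs_dnbhs. Qed.

Lemma dnear_near z (P : set C) : P z -> (\forall w \near z^', P w) -> \forall w \near z, P w.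
Proof.
move=> Pz /dnearcP[e e0 he]; apply/nearcP; exists e => // w we.
by have [->//|wz] := eqVneq w z; exact: he.
Qed.

Lemma cvgcP (T : Type) (F : set_system T) (FF : Filter F) (f : T -> C) (l : C) :
  f @ F --> l <-> forall e : R, 0 < e -> \forall t \near F, normc (f t - l) < e.
Proof.
split=> [fl e e0|fl P /nearcP[e e0 he]]; last by apply: filterS (fl e e0) => t /he.
have ball : \forall w \near l, normc (w - l) < e by apply/nearcP; exists e.
exact: fl _ ball.
Qed.

Lemma continuous_dnear_lim (f : C -> C) z l : {for z, continuous f} -> f @ z^' --> l -> f z = l.
Proof.
move=> /continuous_withinNx cf fl.
exact: (@cvg_unique _ (@norm_hausdorff _ C) (f @ z^') _ _ _ cf fl).
Qed.

Lemma near_neq z w : z != w -> \forall v \near z, v != w.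
Proof.
rewrite -subr_eq0 -normc_gt0 => zw; apply/nearcP; exists (normc (z - w)) => // v.
by apply: contraTneq => ->; rewrite distcC ltxx.
Qed.

Lemma near_neq0 (f : C -> C) z : {for z, continuous f} -> f z != 0 ->
  \forall w \near z, f w != 0.
Proof. by move=> cf /near_neq; exact: cf. Qed.

Lemma continuous_normc : continuous (@normc R : C -> R).
Proof.
move=> z; apply/(@cvgrPdist_lt _ _ _ (nbhs z)) => e e0; apply/nearcP; exists e => // w.
apply: le_lt_trans; rewrite ler_norml.
by have := lerB_distc z w; have := lerB_distc w z; rewrite [normc (z - w)]distcC; lra.
Qed.

Lemma continuous_Re : continuous (@complex.Re R : C -> R).
Proof.
move=> z; apply/(@cvgrPdist_lt _ _ _ (nbhs z)) => e e0; apply/nearcP; exists e => // w.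
by apply: le_lt_trans; rewrite distcC -ReN -ReD Re_le_normc.
Qed.

Lemma continuous_Im : continuous (@complex.Im R : C -> R).
Proof.
move=> z; apply/(@cvgrPdist_lt _ _ _ (nbhs z)) => e e0; apply/nearcP; exists e => // w.
by apply: le_lt_trans; rewrite distcC -ImN -ImD Im_le_normc.
Qed.

Lemma cvg_complex (T : Type) (F : set_system T) (FF : Filter F) (f g : T -> R) (a b : R) :
  f @ F --> a -> g @ F --> b -> (fun t => Complex (f t) (g t) : C) @ F --> (Complex a b : C).
Proof.
move=> /cvgrPdist_lt fa /cvgrPdist_lt gb; apply/cvgcP => e e0.
have e2 : 0 < e / 2 by lra.
apply: filterS2 (fa _ e2) (gb _ e2) => t; rewrite [`|a - _|]distrC [`|b - _|]distrC => fat gbt.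
by apply: le_lt_trans (normc_le_ReIm _) _; rewrite !ReImE /=; lra.
Qed.

Lemma continuous_of_real : continuous (@of_real R).
Proof. by move=> t; apply: cvg_complex; [exact: cvg_id|exact: cvg_cst]. Qed.

Definition disc x r : set C := [set z | normc (z - x) < r].
Definition cdisc x r : set C := [set z | normc (z - x) <= r].

Lemma disc_center x r : 0 < r -> disc x r x.
Proof. by rewrite /disc /= subrr normc0. Qed.

Lemma near_disc x r z : disc x r z -> \forall w \near z, disc x r w.
Proof.
rewrite /disc /= => zr; apply/nearcP; exists (r - normc (z - x)); first by rewrite subr_gt0.
by move=> w wz; rewrite /disc /=; have := ler_distcD z w x; lra.
Qed.

Lemma closed_cdisc x r : closed (cdisc x r).
Proof.
move=> z clz; rewrite /cdisc /=; apply/ler_addgt0Pr => e e0.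
have [|w [wx wz]] := clz (disc z e); first by apply: near_disc; exact: disc_center.
by apply: le_trans (ler_distcD w _ _) _; rewrite distcC; move: wx wz; rewrite /cdisc /disc /=; lra.
Qed.

Lemma compact_cdisc x r : compact (cdisc x r).
Proof.
pose Q : set (R * R) :=
  `[complex.Re x - r, complex.Re x + r] `*` `[complex.Im x - r, complex.Im x + r].
pose cplx (p : R * R) : C := Complex p.1 p.2.
have cQ : compact Q by apply: compact_setX; exact: segment_compact.
have ccplx : continuous cplx.
  by move=> p; apply: cvg_complex; [exact: cvg_fst|exact: cvg_snd].
apply: (subclosed_compact (@closed_cdisc x r) (continuous_compact _ cQ)).
  exact: continuous_subspaceT ccplx.
move=> z zr; exists (complex.Re z, complex.Im z); last by case: z {zr}.
have := le_trans (Re_le_normc _) zr; have := le_trans (Im_le_normc _) zr.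
rewrite ReD ImD ReN ImN !ler_norml => /andP[? ?] /andP[? ?].
by split; rewrite /= in_itv /=; apply/andP; split; lra.
Qed.

Lemma cdisc_EVT_max (V : C -> R) x r : 0 <= r ->
  (forall z, cdisc x r z -> {for z, continuous V}) ->
  exists2 z, cdisc x r z & forall w, cdisc x r w -> V w <= V z.
Proof.
move=> r0 cV; have [||z] := @compact_EVT_max _ R V (cdisc x r) _ (@compact_cdisc x r).
- by exists x; rewrite /cdisc /= subrr normc0.
- by apply: continuous_in_subspaceT => z /set_mem; exact: cV.
- by move=> /set_mem zr zmax; exists z => // w wr; apply: zmax; exact/mem_set.
Qed.

End ComplexTopology.

Lemma le0_geometric (R : realType) (a b q : R) : 0 <= q < 1 ->
  (forall n, a <= b * q ^+ n) -> a <= 0.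
Proof.
move=> /andP[q0 q1] le_geo.
have cv : b * q ^+ n @[n --> \oo] --> b * 0.
  by apply: cvgM; [exact: cvg_cst|apply: cvg_expr; rewrite ger0_norm].
rewrite -(mulr0 b) -(cvg_lim _ cv)//; apply: limr_ge; first by apply/cvg_ex; exists (b * 0).
exact: nearW.
Qed.

(** * Holomorphic functions and curves *)

Section Continuity.
Context {K : numFieldType} {T : topologicalType}.
Implicit Types (f : T -> K) (x : T).

Lemma continuousX f n x : {for x, continuous f} -> {for x, continuous (fun y => f y ^+ n)}.
Proof.
move=> cf; elim: n => [|n IH]; first exact: cst_continuous.
suff -> : (fun y => f y ^+ n.+1) = f \* (fun y => f y ^+ n) by exact: continuousM.
by apply: funext => y; rewrite exprS.
Qed.

Lemma continuous_prod (I : eqType) (s : seq I) (F : I -> T -> K) x :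
  (forall i, i \in s -> {for x, continuous (F i)}) ->
  {for x, continuous (fun y => \prod_(i <- s) F i y)}.
Proof.
elim: s => [|i s IH] cF.
  suff -> : (fun y => \prod_(i <- [::]) F i y) = cst 1 by exact: cst_continuous.
  by apply: funext => y; rewrite big_nil.
suff -> : (fun y => \prod_(j <- i :: s) F j y) = F i \* (fun y => \prod_(j <- s) F j y).
  by apply: continuousM (cF i (mem_head i s)) (IH _) => j js; apply: cF; rewrite inE js orbT.
by apply: funext => y; rewrite big_cons.
Qed.

End Continuity.

Section DerivativeNumField.
Context {K : numFieldType}.
Implicit Types (f g : K -> K) (x l m : K).

Lemma is_derive_caratheodory f x l : is_derive x 1 f l <->
  exists phi : K -> K,
    [/\ forall y, f y - f x = phi y * (y - x), {for x, continuous phi} & phi x = l].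
Proof.
pose slope phi := forall y, f y - f x = phi y * (y - x).
have slopeE phi : slope phi ->
    \forall h \near 0^', h^-1 *: (f (h *: 1 + x) - f x) = (phi \o shift x) h.
  move=> fphi; near=> h; have h0 : h != 0 by near: h; exact: nbhs_dnbhs_neq.
  by rewrite fphi /= addrK [h *: 1]mulr1 [phi _ * h]mulrC [LHS]mulKf.
split=> [[/cvg_ex[l' fl'] <-]|[phi [fphi cphi <-]]].
  exists (fun y => if y == x then l' else (f y - f x) / (y - x)); split.
  - move=> y; have [->|yx] := eqVneq y x; first by rewrite !subrr mulr0.
    by rewrite divfK// subr_eq0.
  - apply/continuous_withinNshiftx; rewrite eqxx; apply: cvg_trans fl'; apply: near_eq_cvg.
    near=> h; have h0 : h != 0 by near: h; exact: nbhs_dnbhs_neq.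
    by rewrite /= -subr_eq0 addrK (negbTE h0) [h *: 1]mulr1 [LHS]mulrC.
  - by rewrite eqxx; apply/esym; exact: cvg_lim fl'.
have cv : h^-1 *: (f (h *: 1 + x) - f x) @[h --> 0^'] --> phi x.
  move/continuous_withinNshiftx : cphi; apply: cvg_trans; apply: near_eq_cvg.
  by apply: filterS (slopeE _ fphi) => h ->.
by apply: DeriveDef; [apply/cvg_ex; exists (phi x)|exact: cvg_lim cv].
Unshelve. all: by end_near.
Qed.

Lemma derivable_is_derive f x : derivable f x 1 -> is_derive x 1 f (f^`() x).
Proof. by move=> /derivableP; rewrite derive1E. Qed.

Lemma derive1_val f x l : is_derive x 1 f l -> f^`() x = l.
Proof. by move=> fl; rewrite derive1E derive_val. Qed.

Lemma derivable_continuous f x : derivable f x 1 -> {for x, continuous f}.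
Proof. by move=> /derivable1_diffP /differentiable_continuous. Qed.

Lemma is_derive_mul f g x l m : is_derive x 1 f l -> is_derive x 1 g m ->
  is_derive x 1 (fun y => f y * g y) (l * g x + f x * m).
Proof.
move=> fl gm; apply: is_derive_eq (is_deriveM fl gm) _.
by rewrite /GRing.scale /=; ring.
Qed.

Lemma is_derive_scale c f x l : is_derive x 1 f l ->
  is_derive x 1 (fun y => c * f y) (c * l).
Proof. by move=> fl; exact: is_deriveZ. Qed.

Lemma is_derive_subr c x : is_derive x 1 (fun y => y - c) 1.
Proof.
apply: is_derive_eq (is_deriveB (is_derive_id x 1) (is_derive_cst c x 1)) _.
by rewrite subr0.
Qed.

Lemma derive1_subr f c x : derivable f x 1 -> derive1 (fun y => f y - c) x = derive1 f x.
Proof.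
move=> /derivable_is_derive df.
by rewrite (derive1_val (is_deriveB df (is_derive_cst c x 1))) subr0.
Qed.

Lemma is_derive_inv f x l : f x != 0 -> is_derive x 1 f l ->
  is_derive x 1 (fun y => (f y)^-1) (- l / f x ^+ 2).
Proof.
move=> fx fl; have [df <-] := fl; apply: DeriveDef; first exact: derivableV.
by rewrite deriveV// mulrC mulrN -[_ *: _]/(_ * _) mulNr.
Qed.

Lemma is_derive_exp f x l n : is_derive x 1 f l ->
  is_derive x 1 (fun y => f y ^+ n) (n%:R * f x ^+ n.-1 * l).
Proof.
move=> fl; elim: n => [|n IH].
  by rewrite !mul0r; apply: is_derive_eq (is_derive_cst _ _ _) _.
have := is_derive_mul fl IH.
rewrite (_ : (fun y => _) = (fun y => f y ^+ n.+1)); last by apply: funext => y; rewrite exprS.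
move=> h; apply: is_derive_eq h _; case: n {IH} => [|n] /=; first by rewrite !expr0; ring.
by rewrite -[n.+2%:R]natr1 exprS; ring.
Qed.

Lemma is_derive_comp f g x l m : is_derive (g x) 1 f l -> is_derive x 1 g m ->
  is_derive x 1 (f \o g) (l * m).
Proof.
move=> /is_derive_caratheodory[p [fp cp <-]] gm; have cg : {for x, continuous g}.
  by case: gm => /derivable_continuous.
case/is_derive_caratheodory: gm => q [gq cq <-]; apply/is_derive_caratheodory.
exists (fun y => p (g y) * q y); split=> //; first by move=> y; rewrite /= fp gq mulrA.
exact: continuousM (continuous_comp cg cp) cq.
Qed.

Lemma is_derive_horner (P : {poly K}) x : is_derive x 1 (horner P) P^`().[x].
Proof.
elim/poly_ind: P => [|P c IH].
  rewrite deriv0 horner0 (_ : horner 0 = cst 0); first exact: is_derive_cst.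
  by apply: funext => y; rewrite horner0.
have := is_deriveD (is_derive_mul IH (is_derive_id x 1)) (is_derive_cst c x 1).
rewrite (_ : (fun y => _) + _ = horner (P * 'X + c%:P)); last first.
  by apply: funext => y; rewrite !hornerE.
by move=> h; apply: is_derive_eq h _; rewrite derivD derivM derivX derivC !hornerE.
Qed.

End DerivativeNumField.

Section Holomorphic.
Context {R : realType}.
Local Notation C := (Cplx R).
Implicit Types (z w : C) (f g : C -> C).

Definition holo f z := \forall w \near z, derivable f w 1.

Lemma holo_derivable f z : holo f z -> derivable f z 1.
Proof. exact: nbhs_singleton. Qed.

Lemma holo_continuous f z : holo f z -> {for z, continuous f}.
Proof. by move=> /holo_derivable /derivable_continuous. Qed.

Lemma near_holo f z : holo f z -> \forall w \near z, holo f w.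
Proof. exact: near_join. Qed.

Lemma near_eq_holo f g z : (\forall w \near z, f w = g w) -> holo f z -> holo g z.
Proof. by move=> /near_join; apply: filterS2 => w; exact: near_eq_derivable. Qed.

Lemma holo_cst (c : C) z : holo (fun=> c) z.
Proof. by apply/nearcP; exists 1 => // w _; exact: derivable_cst. Qed.

Lemma holo_id z : holo id z.
Proof. by apply/nearcP; exists 1 => // w _; exact: derivable_id. Qed.

Lemma holoD f g z : holo f z -> holo g z -> holo (fun w => f w + g w) z.
Proof. by apply: filterS2 => w; exact: derivableD. Qed.

Lemma holoB f g z : holo f z -> holo g z -> holo (fun w => f w - g w) z.
Proof. by apply: filterS2 => w; exact: derivableB. Qed.

Lemma holoM f g z : holo f z -> holo g z -> holo (fun w => f w * g w) z.
Proof. by apply: filterS2 => w; exact: derivableM. Qed.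

Lemma holoX f n z : holo f z -> holo (fun w => f w ^+ n) z.
Proof.
by apply: filterS => w /derivable_is_derive dfw; case: (is_derive_exp n dfw).
Qed.

Lemma holoV f z : f z != 0 -> holo f z -> holo (fun w => (f w)^-1) z.
Proof.
move=> fz hf; apply: filterS2 (near_neq0 (holo_continuous hf) fz) hf => w; exact: derivableV.
Qed.

Lemma holo_horner (P : {poly C}) f z : holo f z -> holo (fun w => P.[f w]) z.
Proof.
apply: filterS => w /derivable_is_derive dfw.
by case: (is_derive_comp (is_derive_horner P (f w)) dfw).
Qed.

End Holomorphic.

Section Curves.
Context {R : realType}.
Local Notation C := (Cplx R).
Local Notation Re := (@complex.Re R).
Local Notation Im := (@complex.Im R).
Implicit Types (l m : C) (f : C -> C) (t : R) (Phi Psi : R -> C).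

Definition curve_der Phi t l := exists phi : R -> C,
  [/\ forall s, Phi s - Phi t = phi s * (s - t)%:C, {for t, continuous phi} & phi t = l].

Lemma curve_der_continuous Phi t l : curve_der Phi t l -> {for t, continuous Phi}.
Proof.
move=> [phi [Phiphi cphi _]].
have csub : {for t, continuous (fun s : R => s - t)}.
  exact: continuousB (@cvg_id _ _) (@cst_continuous _ _ t t).
have cstep : {for t, continuous (fun s => (s - t)%:C : C)}.
  exact: continuous_comp csub (@continuous_of_real R _).
suff -> : Phi = (fun=> Phi t) \+ phi \* (fun s => (s - t)%:C).
  exact: (continuousD (@cst_continuous _ _ (Phi t) t) (continuousM cphi cstep)).
by apply: funext => s; rewrite /= -Phiphi addrC subrK.
Qed.

Lemma curve_der_comp f Phi t l m : is_derive (Phi t) 1 f l -> curve_der Phi t m ->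
  curve_der (f \o Phi) t (l * m).
Proof.
move=> /is_derive_caratheodory[p [fp cp <-]] Pm; have cP := curve_der_continuous Pm.
case: Pm => q [Pq cq <-]; exists (fun s => p (Phi s) * q s).
split; [by move=> s; rewrite /= fp Pq mulrA| |by []].
exact: (continuousM (continuous_comp cP cp) cq).
Qed.

Lemma curve_derD Phi Psi t l m : curve_der Phi t l -> curve_der Psi t m ->
  curve_der (fun s => Phi s + Psi s) t (l + m).
Proof.
move=> [p [Pp cp <-]] [q [Qq cq <-]]; exists (fun s => p s + q s).
split; [by move=> s; rewrite mulrDl -Pp -Qq; ring|exact: (continuousD cp cq)|by []].
Qed.

Lemma curve_derZ Phi t l (c : C) : curve_der Phi t l ->
  curve_der (fun s => c * Phi s) t (c * l).
Proof.
move=> Pl; have := curve_der_comp (is_derive_scale c (is_derive_id (Phi t) 1)) Pl.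
by rewrite mulr1.
Qed.

Lemma curve_der_reparam Phi (u : R -> R) t l (v : R) :
  curve_der Phi (u t) l -> is_derive t 1 u v -> curve_der (Phi \o u) t (l * v%:C).
Proof.
move=> [p [Pp cp <-]] uv; have cu : {for t, continuous u}.
  by case: uv => /derivable_continuous.
case/is_derive_caratheodory: uv => q [uq cq <-]; exists (fun s => p (u s) * (q s)%:C).
split=> [s| |//]; first by rewrite /= Pp uq rmorphM mulrA.
apply: continuousM; first exact: continuous_comp cu cp.
exact: continuous_comp cq (@continuous_of_real R _).
Qed.

Lemma curve_der_line (a b : C) t : curve_der (fun s => a + s%:C * b) t b.
Proof.
exists (fun=> b); split=> [s| |//]; first by rewrite rmorphB /=; ring.
exact: cst_continuous.
Qed.

Lemma curve_der_complex (p q : R -> R) t (l m : R) :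
  is_derive t 1 p l -> is_derive t 1 q m ->
  curve_der (fun s => Complex (p s) (q s) : C) t (Complex l m).
Proof.
move=> /is_derive_caratheodory[f [pf cf <-]] /is_derive_caratheodory[g [qg cg <-]].
exists (fun s => Complex (f s) (g s) : C); split=> // [s|]; last exact: cvg_complex.
by apply: eqc; rewrite !ReImE /= ?pf ?qg; ring.
Qed.

Lemma curve_der_Re Phi t l : curve_der Phi t l -> is_derive t 1 (Re \o Phi) (Re l).
Proof.
move=> [p [Pp cp <-]]; apply/is_derive_caratheodory; exists (Re \o p); split=> // [s|].
  by rewrite /= -ReN -ReD Pp ReM /= mulr0 subr0.
exact: continuous_comp cp (@continuous_Re R _).
Qed.

Lemma curve_der_Im Phi t l : curve_der Phi t l -> is_derive t 1 (Im \o Phi) (Im l).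
Proof.
move=> [p [Pp cp <-]]; apply/is_derive_caratheodory; exists (Im \o p); split=> // [s|].
  by rewrite /= -ImN -ImD Pp ImM /= mulr0 add0r.
exact: continuous_comp cp (@continuous_Im R _).
Qed.

Lemma curve_mean_value Phi (phi : R -> C) (M : R) :
  (forall t, 0 <= t <= 1 -> curve_der Phi t (phi t)) ->
  (forall t, 0 <= t <= 1 -> normc (phi t) <= M) -> normc (Phi 1 - Phi 0) <= M.
Proof.
move=> dPhi phiM; set d := Phi 1 - Phi 0.
(* the increment of [Phi] in its own direction *)
pose u : C := Complex (Re d) (- Im d); pose f t := Re (u * Phi t).
have ud : normc u = normc d by rewrite /u; case: (d) => x y; rewrite /= sqrrN.
have df t : 0 <= t <= 1 -> is_derive t 1 f (Re (u * phi t)).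
  by move=> t01; exact: curve_der_Re (curve_derZ _ (dPhi t t01)).
have cf : {within `[0, 1], continuous f}.
  by apply: derivable_within_continuous => t; rewrite in_itv /= => /df[].
have [t|t] := @MVT_segment R f (fun t => Re (u * phi t)) 0 1 ler01 _ cf.
  by rewrite in_itv /= => /andP[t0 t1]; apply: df; rewrite !ltW.
rewrite in_itv /= subr0 mulr1 => t01.
have -> : f 1 - f 0 = normc d ^+ 2.
  by rewrite /f -ReN -ReD -mulrBr -/d sqr_normcE /u !ReImE /=; ring.
move=> dE; have := le_trans (ler_norm _) (Re_le_normc (u * phi t)).
rewrite -dE normcM ud => dle; have [->|d0] := eqVneq (normc d) 0.
  exact: le_trans (normc_ge0 _) (phiM t t01).
have dpos : 0 < normc d by rewrite lt_def d0 normc_ge0.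
by move: dle; rewrite expr2 ler_pM2l// => /le_trans; apply; exact: phiM.
Qed.

End Curves.

(** * Integrals along segments *)

Section NewtonIntegral.
Context {R : realType}.
Local Notation C := (Cplx R).
Implicit Types (phi psi : R -> C) (t : R) (v : C).

Definition continuous01 phi := forall t, 0 <= t <= 1 -> {for t, continuous phi}.

Definition is_cint phi v := exists2 Phi : R -> C,
  (forall t, 0 <= t <= 1 -> curve_der Phi t (phi t)) & v = Phi 1 - Phi 0.

(* The value is 0 when [phi] has no primitive on the unit interval. *)
Definition cint phi : C := xget 0 [set v | is_cint phi v].

Lemma le_is_cint phi v (M : R) : is_cint phi v ->
  (forall t, 0 <= t <= 1 -> normc (phi t) <= M) -> normc v <= M.
Proof. by move=> [Phi dPhi ->]; exact: curve_mean_value. Qed.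

Lemma is_cint_lin phi psi v w (c : C) : is_cint phi v -> is_cint psi w ->
  is_cint (fun t => c * phi t + psi t) (c * v + w).
Proof.
move=> [Phi dPhi ->] [Psi dPsi ->]; exists (fun t => c * Phi t + Psi t); last by ring.
by move=> t t01; apply: curve_derD; [apply: curve_derZ; exact: dPhi|exact: dPsi].
Qed.

Lemma is_cint_unique phi v w : is_cint phi v -> is_cint phi w -> v = w.
Proof.
move=> pv pw; apply/esym/eqP; rewrite -subr_eq0 -normc_eq0 eq_le normc_ge0 andbT addrC -mulN1r.
apply: (le_is_cint (is_cint_lin (-1) pv pw)) => t _.
by rewrite mulN1r addNr normc0.
Qed.

Lemma cintE phi v : is_cint phi v -> cint phi = v.
Proof.
move=> pv; apply: (is_cint_unique _ pv).
by rewrite /cint; case: xgetP => [w -> //|/(_ v)].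
Qed.

Lemma eq_cint phi psi : (forall t, 0 <= t <= 1 -> phi t = psi t) -> cint phi = cint psi.
Proof.
move=> phipsi; congr (xget _ _); apply/seteqP.
split=> v [Phi dPhi ->]; exists Phi => // t t01.
  by rewrite -phipsi//; exact: dPhi.
by rewrite phipsi//; exact: dPhi.
Qed.

Definition clamp01 t : R := (1 + `|t| - `|t - 1|) / 2.

Lemma clamp01_id t : 0 <= t <= 1 -> clamp01 t = t.
Proof. by move=> /andP[t0 t1]; rewrite /clamp01 ger0_norm// ler0_norm; lra. Qed.

Lemma clamp01_itv t : 0 <= clamp01 t <= 1.
Proof.
by rewrite /clamp01; case: (ger0P t) => ?; case: (ger0P (t - 1)) => ?; apply/andP; split; lra.
Qed.

Lemma continuous_clamp01 : continuous clamp01.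
Proof.
move=> t; have cnorm c : {for t, continuous (fun s : R => `|s - c|)}.
  by apply: cvg_norm; exact: cvgB (@cvg_id _ _) (@cvg_cst _ _ _ _ _).
rewrite /clamp01; apply: cvgM; last exact: cvg_cst.
apply: cvgB (cnorm 1); apply: cvgD; first exact: cvg_cst.
exact: cvg_norm (@cvg_id _ _).
Qed.

Lemma continuous_primitive (f : R -> R) : continuous f ->
  exists F : R -> R, forall t, 0 <= t <= 1 -> is_derive t 1 F (f t).
Proof.
move=> cf; exists (fun x => \int[lebesgue_measure]_(t in `[(-1)%R, x]) (f t))%R => t /andP[t0 t1].
have intf : lebesgue_measure.-integrable `[(-1 : R), 2] (EFin \o f).
  apply: continuous_compact_integrable; first exact: segment_compact.
  exact: continuous_subspaceT.
have tN1 : -1 < t by lra.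
have t2 : t < 2 by lra.
have [d] := @continuous_FTC1_closed R f (-1) t 2 t2 intf tN1 (cf t).
by rewrite derive1E; exact: DeriveDef.
Qed.

Lemma continuous_is_cint phi : continuous01 phi -> is_cint phi (cint phi).
Proof.
move=> cphi; suff [v pv] : exists v, is_cint phi v by rewrite (cintE pv).
have cclamp : continuous (phi \o clamp01).
  by move=> t; apply: continuous_comp (@continuous_clamp01 t) (cphi _ (clamp01_itv t)).
have [P dP] : exists P : R -> R,
    forall t, 0 <= t <= 1 -> is_derive t 1 P (complex.Re (phi (clamp01 t))).
  apply: (@continuous_primitive (fun t => complex.Re (phi (clamp01 t)))) => t.
  exact: continuous_comp (cclamp t) (@continuous_Re R _).
have [Q dQ] : exists Q : R -> R,
    forall t, 0 <= t <= 1 -> is_derive t 1 Q (complex.Im (phi (clamp01 t))).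
  apply: (@continuous_primitive (fun t => complex.Im (phi (clamp01 t)))) => t.
  exact: continuous_comp (cclamp t) (@continuous_Im R _).
exists ((Complex (P 1) (Q 1) : C) - Complex (P 0) (Q 0)).
exists (fun t => Complex (P t) (Q t) : C) => // t t01.
have := curve_der_complex (dP t t01) (dQ t t01).
by rewrite clamp01_id//; case: (phi t).
Qed.

Lemma le_cint phi (M : R) : continuous01 phi ->
  (forall t, 0 <= t <= 1 -> normc (phi t) <= M) -> normc (cint phi) <= M.
Proof. by move=> /continuous_is_cint; exact: le_is_cint. Qed.

Lemma cint_lin phi psi (c : C) : continuous01 phi -> continuous01 psi ->
  cint (fun t => c * phi t + psi t) = c * cint phi + cint psi.
Proof.
by move=> /continuous_is_cint pv /continuous_is_cint pw; exact: cintE (is_cint_lin c pv pw).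
Qed.

Lemma continuous01M phi psi : continuous01 phi -> continuous01 psi ->
  continuous01 (fun t => phi t * psi t).
Proof. by move=> cphi cpsi t t01; exact: (continuousM (cphi t t01) (cpsi t t01)). Qed.

Lemma continuous01D phi psi : continuous01 phi -> continuous01 psi ->
  continuous01 (fun t => phi t + psi t).
Proof. by move=> cphi cpsi t t01; exact: (continuousD (cphi t t01) (cpsi t t01)). Qed.

Lemma continuous01_cst v : continuous01 (fun=> v).
Proof. by move=> t _; exact: cst_continuous. Qed.

Lemma continuous01_comp (f : C -> C) phi : continuous01 phi ->
  (forall t, 0 <= t <= 1 -> {for phi t, continuous f}) -> continuous01 (fun t => f (phi t)).
Proof. by move=> cphi cf t t01; exact: (continuous_comp (cphi t t01) (cf t t01)). Qed.

Lemma continuous01_subr phi v : continuous01 phi -> continuous01 (fun t => phi t - v).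
Proof. by move=> cphi; exact: (continuous01D cphi (@continuous01_cst (- v))). Qed.

Lemma cintZ phi (c : C) : continuous01 phi -> cint (fun t => c * phi t) = c * cint phi.
Proof.
move=> cphi; have := cint_lin c cphi (@continuous01_cst 0).
rewrite (@cintE (fun=> 0) 0) ?addr0 => [<-|].
  by apply: eq_cint => t _; rewrite addr0.
exists (fun=> 0); last by rewrite subrr.
by move=> t _; exists (fun=> 0); split=> [s| |//]; [rewrite mul0r subrr|exact: cst_continuous].
Qed.

End NewtonIntegral.

Section SegmentIntegral.
Context {R : realType}.
Local Notation C := (Cplx R).
Implicit Types (a b x : C) (f F : C -> C) (K : set C) (s t r : R).

Definition seg a b t : C := a + t%:C * (b - a).

Definition convex K := forall a b t, K a -> K b -> 0 <= t <= 1 -> K (seg a b t).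

Definition seg_int f a b := cint (fun t => f (seg a b t) * (b - a)).

Lemma seg0 a b : seg a b 0 = a. Proof. by rewrite /seg rmorph0 mul0r addr0. Qed.
Lemma seg1 a b : seg a b 1 = b. Proof. by rewrite /seg rmorph1 mul1r addrC subrK. Qed.

Lemma seg_half a b : seg a b 2^-1 = (a + b) / 2.
Proof. by rewrite /seg fmorphV rmorph_nat; field. Qed.

Lemma dist_seg a b s t : normc (seg a b s - seg a b t) = `|s - t| * normc (b - a).
Proof.
rewrite (_ : _ - _ = (s - t)%:C * (b - a)) ?normcM ?normc_real//.
by rewrite rmorphB /seg; ring.
Qed.

Lemma cdisc_convex x r : convex (cdisc x r).
Proof.
move=> a b t; rewrite /cdisc /= => ax bx /andP[t0 t1].
have -> : seg a b t - x = (1 - t)%:C * (a - x) + t%:C * (b - x).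
  by rewrite rmorphB rmorph1 /seg; ring.
apply: le_trans (le_normcD _ _) _; rewrite !normcM !normc_real !ger0_norm ?subr_ge0//.
nra.
Qed.

Lemma disc_convex x r : convex (disc x r).
Proof.
move=> a b t ax bx t01.
have sub : cdisc x (Order.max (normc (a - x)) (normc (b - x))) (seg a b t).
  by apply: cdisc_convex; rewrite /cdisc //= le_max lexx ?orbT.
by apply: le_lt_trans sub _; rewrite gt_max; apply/andP.
Qed.

Lemma continuous_seg a b t : {for t, continuous (seg a b)}.
Proof. exact: curve_der_continuous (curve_der_line a (b - a) t). Qed.

Lemma continuous_seg_int f a b :
  (forall t, 0 <= t <= 1 -> {for seg a b t, continuous f}) ->
  continuous01 (fun t => f (seg a b t) * (b - a)).
Proof.
move=> cf; apply: continuous01M; last exact: continuous01_cst.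
by apply: continuous01_comp cf => t _; exact: continuous_seg.
Qed.

Lemma seg_int_primitive F f a b :
  (forall t, 0 <= t <= 1 -> is_derive (seg a b t) 1 F (f (seg a b t))) ->
  seg_int f a b = F b - F a.
Proof.
move=> dF; apply: cintE; exists (F \o seg a b) => [t t01|]; last by rewrite /= seg0 seg1.
exact: curve_der_comp (dF t t01) (curve_der_line a (b - a) t).
Qed.

Lemma seg_int_sub f a b s t : (forall u, 0 <= u <= 1 -> {for seg a b u, continuous f}) ->
  0 <= s <= 1 -> 0 <= t <= 1 ->
  seg_int f (seg a b s) (seg a b t) =
  seg_int f a (seg a b t) - seg_int f a (seg a b s).
Proof.
move=> cf; have [Phi dPhi _] := continuous_is_cint (continuous_seg_int cf).
have sub u v : 0 <= u <= 1 -> 0 <= v <= 1 ->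
    seg_int f (seg a b u) (seg a b v) = Phi v - Phi u.
  move=> u01 v01; apply: cintE.
  exists (Phi \o (fun p => u + p * (v - u))) => [p p01|]; last first.
    by rewrite /= mul0r mul1r addr0 [u + _]addrC subrK.
  have -> : seg (seg a b u) (seg a b v) p = seg a b (u + p * (v - u)).
    by rewrite /seg rmorphD rmorphM rmorphB /=; ring.
  have -> : seg a b v - seg a b u = (b - a) * (v - u)%:C.
    by rewrite /seg rmorphB /=; ring.
  rewrite mulrA; apply: curve_der_reparam.
    apply: dPhi; move: u01 v01 p01 => /andP[? ?] /andP[? ?] /andP[? ?].
    by apply/andP; split; nra.
  have dlin := is_derive_mul (is_derive_id p 1) (is_derive_cst (v - u) p 1).
  apply: is_derive_eq (is_deriveD (is_derive_cst u p 1) dlin) _.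
  by rewrite mulr0 addr0 mul1r add0r.
move=> s01 t01; have z01 : 0 <= (0 : R) <= 1 by rewrite lexx ler01.
have sub0 u : 0 <= u <= 1 -> seg_int f a (seg a b u) = Phi u - Phi 0.
  by move=> u01; rewrite -{1}(seg0 a b) sub.
by rewrite sub// !sub0//; ring.
Qed.

Lemma seg_int_rev f a b : (forall t, 0 <= t <= 1 -> {for seg a b t, continuous f}) ->
  seg_int f b a = - seg_int f a b.
Proof.
move=> /seg_int_sub sub; have z01 : 0 <= (0 : R) <= 1 by rewrite lexx ler01.
have o01 : 0 <= (1 : R) <= 1 by rewrite lexx ler01.
have := sub 1 0 o01 z01; have := sub 0 0 z01 z01; rewrite seg0 seg1 subrr => ->.
by rewrite sub0r.
Qed.

End SegmentIntegral.

Section UniformDerivative.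
Context {R : realType}.
Local Notation C := (Cplx R).
Implicit Types (a b u v x z w l : C) (f F : C -> C) (K : set C) (e d r M : R) (phi : R -> C).

Lemma is_derive_ler_distP f z l : is_derive z 1 f l <->
  forall e, 0 < e -> \forall w \near z, normc (f w - f z - l * (w - z)) <= e * normc (w - z).
Proof.
split=> [/is_derive_caratheodory[phi [fphi cphi <-]] e e0|fl].
  have /(@cvgcP _ _ (nbhs z))/(_ e e0) : {for z, continuous phi} by [].
  apply: filterS => w /ltW we; rewrite fphi -mulrBl normcM.
  by apply: ler_wpM2r we; exact: normc_ge0.
apply/is_derive_caratheodory; exists (fun w => if w == z then l else (f w - f z) / (w - z)).
split; last by rewrite eqxx.
- move=> w; have [->|wz] := eqVneq w z; first by rewrite !subrr mulr0.
  by rewrite divfK// subr_eq0.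
apply/(@cvgcP _ _ (nbhs z)) => e e0; have e2 : 0 < e / 2 by lra.
apply: filterS (fl _ e2) => w; rewrite eqxx.
have [->|wz fwl] := eqVneq w z; first by move=> _ /=; rewrite subrr normc0.
have wz0 : w - z != 0 by rewrite subr_eq0.
have wz_gt0 : 0 < normc (w - z) by rewrite normc_gt0.
have -> : (f w - f z) / (w - z) - l = (f w - f z - l * (w - z)) / (w - z) by field.
rewrite normcM normcV ltr_pdivrMr//; nra.
Qed.

Lemma segment_mean_value F f a b l M :
  (forall t, 0 <= t <= 1 -> is_derive (seg a b t) 1 F (f (seg a b t))) ->
  (forall t, 0 <= t <= 1 -> normc (f (seg a b t) - l) <= M) ->
  normc (F b - F a - l * (b - a)) <= M * normc (b - a).
Proof.
move=> dF fM; pose Phi t := F (seg a b t) + - l * seg a b t.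
have -> : F b - F a - l * (b - a) = Phi 1 - Phi 0 by rewrite /Phi seg0 seg1; ring.
apply: (@curve_mean_value _ _ (fun t => (f (seg a b t) - l) * (b - a))) => t t01.
  have dseg := curve_der_line a (b - a) t.
  rewrite mulrBl -mulNr.
  exact: curve_derD (curve_der_comp (dF t t01) dseg) (curve_derZ _ dseg).
by rewrite normcM ler_wpM2r ?normc_ge0 ?fM.
Qed.

Lemma derive0_seg_cst F a b : (forall t, 0 <= t <= 1 -> is_derive (seg a b t) 1 F 0) ->
  F b = F a.
Proof.
move=> dF; apply/eqP; rewrite -subr_eq0 -normc_eq0 eq_le normc_ge0 andbT.
have -> : F b - F a = F b - F a - 0 * (b - a) by rewrite mul0r subr0.
rewrite -(mul0r (normc (b - a))); apply: (segment_mean_value (f := fun=> 0)) dF _ => t _.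
by rewrite subrr normc0.
Qed.

Lemma derive0_disc_cst F x r : (forall z, disc x r z -> is_derive z 1 F 0) ->
  forall z, disc x r z -> F z = F x.
Proof.
move=> dF z zr; have xr : disc x r x by apply: disc_center; exact: le_lt_trans (normc_ge0 _) zr.
by apply: derive0_seg_cst => t t01; apply: dF; exact: disc_convex.
Qed.

Lemma lebesgue_number K (G : set C -> Prop) : compact K ->
  (forall A B, B `<=` A -> G A -> G B) ->
  (forall x, K x -> exists2 d, 0 < d & G (disc x d)) ->
  exists2 d, 0 < d & forall x, K x -> G (disc x d).
Proof.
move=> /compact_near_coveringP cK Gsub Gloc.
have cover : \forall d \near (0 : R)^'+, K `<=` (fun x => G (disc x d)).
  apply: cK => x /Gloc[d d0 Gd]; have d2 : 0 < d / 2 by lra.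
  exists (disc x (d / 2), [set e | e < d / 2]) => /=.
    split; first exact: near_disc (disc_center x d2).
    by near=> e; near: e; exact: nbhs_right_lt.
  move=> [y e] /= [yx ed]; apply: Gsub Gd => w; rewrite /disc /= in yx *.
  by move=> wy; have := ler_distcD y w x; lra.
have [d [d0 Gd]] : exists d, 0 < d /\ K `<=` (fun x => G (disc x d)).
  apply: (@filter_ex _ (0 : R)^'+); near=> d; split; near: d; last exact: cover.
  exact: nbhs_right_gt.
by exists d.
Unshelve. all: by end_near.
Qed.

Lemma compact_uniform_derive K F f e : compact K -> 0 < e ->
  (forall x, K x -> \forall u \near x, is_derive (u : C) 1 F (f u)) ->
  (forall x, K x -> {for x, continuous f}) ->
  exists2 d, 0 < d & forall u v, K u -> normc (v - u) < d ->
    is_derive v 1 F (f v) /\ normc (F v - F u - f u * (v - u)) <= e * normc (v - u).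
Proof.
move=> cK e0 dF cf.
pose G (A : set C) := forall u v, A u -> A v ->
  is_derive v 1 F (f v) /\ normc (F v - F u - f u * (v - u)) <= e * normc (v - u).
have [||d d0 Gd] := @lebesgue_number K G cK.
- by move=> A B BA GA u v /BA Au /BA; exact: GA.
- move=> x Kx; have e2 : 0 < e / 2 by lra.
  have /(@cvgcP _ _ (nbhs x))/(_ _ e2) fx := cf x Kx.
  have /nearcP[d d0 dfx] : \forall u \near x,
      is_derive (u : C) 1 F (f u) /\ normc (f u - f x) < e / 2.
    by apply: filterS2 (dF x Kx) fx.
  exists d => // u v ux vx; split; first by have [] := dfx v vx.
  have uv t : 0 <= t <= 1 -> disc x d (seg u v t) by exact: disc_convex.
  apply: (segment_mean_value (f := f)) => t /uv /dfx[] // _ ft.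
  have [_ fu] := dfx u ux; apply: le_trans (ler_distcD (f x) _ _) _.
  by rewrite [normc (f x - _)]distcC; lra.
exists d => // u v Ku uv; apply: (Gd u Ku); last exact: uv.
exact: disc_center.
Qed.

Lemma bounded01 phi : continuous01 phi ->
  exists M, forall t, 0 <= t <= 1 -> normc (phi t) <= M.
Proof.
move=> cphi; have := @compact_EVT_max _ R (fun t => normc (phi t)) `[0, 1].
case=> [|||t _ tmax].
- by exists 0; rewrite /= in_itv /= lexx ler01.
- exact: segment_compact.
- apply: continuous_in_subspaceT => t /set_mem /=; rewrite in_itv /= => t01.
  exact: continuous_comp (cphi t t01) (@continuous_normc R _).
by exists (normc (phi t)) => s s01; apply: tmax; rewrite inE /= in_itv.
Qed.

Lemma compact_image01 phi : continuous01 phi -> compact [set phi t | t in `[0, 1]].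
Proof.
move=> cphi; apply: continuous_compact; last exact: segment_compact.
by apply: continuous_in_subspaceT => t /set_mem /=; rewrite in_itv /=; exact: cphi.
Qed.

Lemma affine_family_uniform_derive (p q : R -> C) F f z e :
  continuous01 p -> continuous01 q -> 0 < e ->
  (forall t, 0 <= t <= 1 -> \forall u \near p t + z * q t, is_derive (u : C) 1 F (f u)) ->
  (forall t, 0 <= t <= 1 -> {for p t + z * q t, continuous f}) ->
  exists2 d, 0 < d & forall w t, normc (w - z) < d -> 0 <= t <= 1 ->
    is_derive (p t + w * q t) 1 F (f (p t + w * q t)) /\
    normc (F (p t + w * q t) - F (p t + z * q t) - f (p t + z * q t) * ((w - z) * q t)) <=
      e * normc (w - z).
Proof.
move=> cp cq e0 dF cf; have [B qB] := bounded01 cq.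
have cz : continuous01 (fun t => p t + z * q t).
  by apply: continuous01D cp _; apply: continuous01M cq; exact: continuous01_cst.
have B0 : 0 < B + 1.
  by rewrite ltr_wpDl// (le_trans (normc_ge0 _) (qB 0 _))// lexx ler01.
have e'0 : 0 < e / (B + 1) by exact: divr_gt0.
have [||d d0 unif] := compact_uniform_derive (F := F) (f := f) (compact_image01 cz) e'0.
- by move=> _ [t /= t01 <-]; apply: dF; move: t01; rewrite in_itv.
- by move=> _ [t /= t01 <-]; apply: cf; move: t01; rewrite in_itv.
exists (d / (B + 1)) => [|w t]; first exact: divr_gt0.
rewrite ltr_pdivlMr// => wz t01.
have incr : p t + w * q t - (p t + z * q t) = (w - z) * q t by ring.
have le_incr : normc ((w - z) * q t) <= normc (w - z) * (B + 1).
  by rewrite normcM ler_wpM2l ?normc_ge0//; have := qB t t01; lra.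
have [||dFw bound] := unif (p t + z * q t) (p t + w * q t).
- by exists t; rewrite //= in_itv.
- by rewrite incr; exact: le_lt_trans wz.
split; first exact: dFw.
rewrite -incr; apply: le_trans bound _; rewrite incr mulrAC ler_pdivrMr// -mulrA.
by rewrite ler_pM2l.
Qed.

Lemma is_derive_cint (g p q : R -> C) F f z :
  continuous01 g -> continuous01 p -> continuous01 q ->
  (forall t, 0 <= t <= 1 -> \forall u \near p t + z * q t, is_derive (u : C) 1 F (f u)) ->
  (forall t, 0 <= t <= 1 -> {for p t + z * q t, continuous f}) ->
  is_derive z 1 (fun w => cint (fun t => g t * F (p t + w * q t)))
    (cint (fun t => g t * q t * f (p t + z * q t))).
Proof.
move=> cg cp cq dF cf; apply/is_derive_ler_distP => e e0.
have caff w : continuous01 (fun t => p t + w * q t).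
  by apply: continuous01D cp _; apply: continuous01M cq; exact: continuous01_cst.
have [A gA] := bounded01 cg; have A0 : 0 <= A.
  by apply: le_trans (normc_ge0 _) (gA 0 _); rewrite lexx ler01.
have e'0 : 0 < e / (A + 1) by rewrite divr_gt0// ltr_wpDl.
have [d d0 unif] := affine_family_uniform_derive cp cq e'0 dF cf.
have cN w : normc (w - z) < d -> continuous01 (fun t => g t * F (p t + w * q t)).
  move=> wz; apply: continuous01M cg _; apply: continuous01_comp (caff w) _ => t t01.
  by have [[/derivable_continuous]] := unif w t wz t01.
have cN' : continuous01 (fun t => g t * q t * f (p t + z * q t)).
  exact: continuous01M (continuous01M cg cq) (continuous01_comp (caff z) cf).
apply/nearcP; exists d => // w wz.
have zz : normc (z - z) < d by rewrite subrr normc0.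
have icN y (yz : normc (y - z) < d) := continuous_is_cint (cN y yz).
have increment (I J I' : C) : J - I - I' * (w - z) = - (w - z) * I' + (-1 * I + J) by ring.
rewrite increment; apply: (le_is_cint (is_cint_lin _ (continuous_is_cint cN')
  (is_cint_lin _ (icN z zz) (icN w wz)))) => t t01.
have [_ bound] := unif w t wz t01.
rewrite (_ : _ + _ = g t * (F (p t + w * q t) - F (p t + z * q t) -
  f (p t + z * q t) * ((w - z) * q t))); last by ring.
rewrite normcM; apply: le_trans (ler_pM (normc_ge0 _) (normc_ge0 _) (gA t t01) bound) _.
rewrite mulrA ler_wpM2r ?normc_ge0// mulrA ler_pdivrMr ?ltr_wpDl// mulrC.
by rewrite ler_pM2l// lerDl.
Qed.

End UniformDerivative.

(** * Goursat's theorem *)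

Section Goursat.
Context {R : realType}.
Local Notation C := (Cplx R).
Implicit Types (a b c u v w x z l : C) (f F : C -> C) (K : set C) (r e d M L : R).

Lemma compact_geometric_limit K (u : nat -> C) L : compact K -> (forall k, K (u k)) ->
  (forall k, normc (u k.+1 - u k) <= L / 2 ^+ k) ->
  exists2 x, K x & forall k, normc (u k - x) <= 2 * L / 2 ^+ k.
Proof.
move=> cK Ku step.
have tail k m : normc (u (k + m)%N - u k) <= 2 * L / 2 ^+ k * (1 - (2 ^+ m)^-1).
  elim: m => [|m IH]; first by rewrite addn0 subrr normc0 expr0 invr1 subrr mulr0.
  rewrite addnS; apply: le_trans (ler_distcD (u (k + m)%N) _ _) _.
  apply: le_trans (lerD (step _) IH) _; rewrite exprD exprS !invfM.
  by rewrite le_eqVlt; apply/orP; left; apply/eqP; field; rewrite !expf_neq0.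
have L0 : 0 <= L by have := le_trans (normc_ge0 _) (step 0%N); rewrite expr0 divr1.
have Ku' : (u @ \oo) K by exists 0%N => // k _; exact: Ku.
have [x [Kx clx]] := cK (u @ \oo) _ Ku'; exists x => // k.
have ule : (u @ \oo) [set w | normc (u k - w) <= 2 * L / 2 ^+ k].
  exists k => // m /= km; rewrite distcC -(subnKC km); apply: le_trans (tail _ _) _.
  by rewrite ler_piMr ?divr_ge0 ?mulr_ge0 ?exprn_ge0// gerBl invr_ge0 exprn_ge0.
apply/ler_addgt0Pr => e e0.
have [w [/= uw wx]] := clx _ _ ule (near_disc (disc_center x e0)).
by apply: le_trans (ler_distcD w _ _) _; apply: lerD => //; exact: ltW.
Qed.

Definition triangle : Type := C * C * C.

Definition vertices_in K (T : triangle) := [/\ K T.1.1, K T.1.2 & K T.2].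

Definition perimeter (T : triangle) : R :=
  normc (T.1.2 - T.1.1) + normc (T.2 - T.1.2) + normc (T.1.1 - T.2).

Definition triangle_int f (T : triangle) :=
  seg_int f T.1.1 T.1.2 + seg_int f T.1.2 T.2 + seg_int f T.2 T.1.1.

Definition subtriangles (T : triangle) : seq triangle :=
  let: (a, b, c) := T in
  let m := seg a b 2^-1 in let n := seg b c 2^-1 in let p := seg c a 2^-1 in
  [:: (a, m, p); (m, b, n); (p, n, c); (m, n, p)].

Lemma half01 : 0 <= (2^-1 : R) <= 1. Proof. by apply/andP; split; lra. Qed.

Lemma subtriangles_vertices_in K T T' : convex K -> vertices_in K T ->
  T' \in subtriangles T -> vertices_in K T'.
Proof.
case: T => [[a b] c] cvxK [/= Ka Kb Kc].
have Kmid u v : K u -> K v -> K (seg u v 2^-1) by move=> Ku Kv; exact: cvxK half01.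
by rewrite !inE => /or4P[] /eqP ->; split; rewrite /= //; exact: Kmid.
Qed.

Lemma normc_half u v w : w = (u - v) / 2 -> normc w = normc (u - v) / 2.
Proof. by move=> ->; rewrite normcM normcV normc_nat. Qed.

Lemma perimeter_subtriangles T T' : T' \in subtriangles T -> perimeter T' = perimeter T / 2.
Proof.
case: T => [[a b] c]; rewrite !inE /perimeter => /or4P[] /eqP -> /=; rewrite !seg_half !mulrDl.
- by congr (_ + _ + _); apply: normc_half; field.
- by congr (_ + _ + _); apply: normc_half; field.
- by congr (_ + _ + _); apply: normc_half; field.
- rewrite [RHS]addrC addrA.
  by congr (_ + _ + _); rewrite distcC; apply: normc_half; field.
Qed.

Lemma subtriangles_apex T T' : T' \in subtriangles T -> normc (T'.1.1 - T.1.1) <= perimeter T.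
Proof.
case: T => [[a b] c].
have := normc_ge0 (b - a); have := normc_ge0 (c - b); have := normc_ge0 (a - c).
rewrite !inE /perimeter => ca0 bc0 ab0 /or4P[] /eqP -> /=.
- by rewrite subrr normc0; lra.
- by rewrite (@normc_half b a) ?seg_half; [lra|field].
- by rewrite distcC (@normc_half a c) ?seg_half; [lra|field].
- by rewrite (@normc_half b a) ?seg_half; [lra|field].
Qed.

(* Otherwise successive subdivision gives a nested sequence of triangles on which [P] fails,
   shrinking to a point of [K]. *)
Lemma triangle_subdivision_ind K (P : triangle -> Prop) : compact K -> convex K ->
  (forall T, vertices_in K T -> (forall T', T' \in subtriangles T -> P T') -> P T) ->
  (forall x, K x -> exists2 d, 0 < d & forall T, vertices_in K T ->
    perimeter T < d -> normc (T.1.1 - x) <= 2 * perimeter T -> P T) ->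
  forall T, vertices_in K T -> P T.
Proof.
move=> cK cvxK Psplit Plocal T0 KT0; apply: contrapT => nPT0.
pose bad T := vertices_in K T /\ ~ P T.
have /choice[next nextP] : forall T, exists T', bad T -> bad T' /\ T' \in subtriangles T.
  move=> T; have [[KT nPT]|nbad] := pselect (bad T); last by exists T.
  have /existsNP[T' /not_implyP[TT' nPT']] : ~ forall T', T' \in subtriangles T -> P T'.
    by move=> allP; apply: nPT; exact: Psplit.
  by exists T'; split=> //; split=> //; exact: subtriangles_vertices_in TT'.
pose T k := iter k next T0.
have badT k : bad (T k) by elim: k => [//|k /nextP[]].
have perT k : perimeter (T k) = perimeter T0 / 2 ^+ k.
  elim: k => [|k IH]; first by rewrite expr0 divr1.
  have [_ TT'] := nextP _ (badT k).
  by rewrite (perimeter_subtriangles TT') IH exprSr invfM mulrA.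
have KT k : K (T k).1.1 by have [[]] := badT k.
have [k|x Kx Tx] := @compact_geometric_limit K (fun k => (T k).1.1) (perimeter T0) cK KT.
  by rewrite -perT; have [_ /subtriangles_apex] := nextP _ (badT k).
have [d d0 Pd] := Plocal x Kx.
have [k kd] : exists k, perimeter T0 / 2 ^+ k < d.
  apply: contrapT => /forallNP dle; suff : d <= 0 by lra.
  apply: (@le0_geometric _ d (perimeter T0) 2^-1) => [|k]; first by apply/andP; split; lra.
  by rewrite exprVn leNgt; apply/negP.
have [KTk] := badT k; apply; apply: Pd => //; first by rewrite perT.
by rewrite perT mulrA; exact: Tx.
Qed.

Lemma triangle_int_primitive F f K T : convex K ->
  (forall z, K z -> is_derive z 1 F (f z)) -> vertices_in K T -> triangle_int f T = 0.
Proof.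
case: T => [[a b] c] cvxK dF [/= Ka Kb Kc]; rewrite /triangle_int /=.
have int u v : K u -> K v -> seg_int f u v = F v - F u.
  by move=> Ku Kv; apply: seg_int_primitive => t t01; apply: dF; exact: cvxK.
by rewrite !int//; ring.
Qed.

Lemma triangle_int_split f K T : convex K -> (forall z, K z -> {for z, continuous f}) ->
  vertices_in K T ->
  triangle_int f T = \sum_(T' <- subtriangles T) triangle_int f T'.
Proof.
case: T => [[a b] c] cvxK cf [/= Ka Kb Kc]; have half := half01.
have cseg u v : K u -> K v -> forall t, 0 <= t <= 1 -> {for seg u v t, continuous f}.
  by move=> Ku Kv t t01; apply: cf; exact: cvxK.
have o01 : 0 <= (1 : R) <= 1 by rewrite lexx ler01.
have rev u v : K u -> K v -> seg_int f v u = - seg_int f u v.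
  by move=> Ku Kv; exact: seg_int_rev (cseg u v Ku Kv).
have mid u v : K u -> K v ->
    seg_int f u v = seg_int f u (seg u v 2^-1) + seg_int f (seg u v 2^-1) v.
  move=> Ku Kv; have := seg_int_sub (cseg u v Ku Kv) half o01.
  by rewrite seg1 => ->; ring.
set m := seg a b _; set n := seg b c _; set p := seg c a _.
have [Km Kn Kp] : [/\ K m, K n & K p] by split; exact: cvxK.
rewrite !big_cons big_nil /triangle_int /= (mid a b)// (mid b c)// (mid c a)// -/m -/n -/p.
by rewrite (rev n p)// (rev m n)// (rev p m)//; ring.
Qed.

Lemma le_seg_intB f g a b M : (forall t, 0 <= t <= 1 -> {for seg a b t, continuous f}) ->
  (forall t, 0 <= t <= 1 -> {for seg a b t, continuous g}) ->
  (forall t, 0 <= t <= 1 -> normc (f (seg a b t) - g (seg a b t)) <= M) ->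
  normc (seg_int f a b - seg_int g a b) <= M * normc (b - a).
Proof.
move=> cf cg fgM; rewrite addrC -mulN1r.
rewrite -(cint_lin _ (continuous_seg_int cg) (continuous_seg_int cf)).
apply: le_cint => [|t t01].
  apply: continuous01D (continuous_seg_int cf).
  by apply: continuous01M (continuous_seg_int cg); exact: continuous01_cst.
rewrite (_ : _ + _ = (f (seg a b t) - g (seg a b t)) * (b - a)); last by ring.
by rewrite normcM ler_wpM2r ?normc_ge0 ?fgM.
Qed.

Lemma le_triangle_intB f g K T M : convex K -> vertices_in K T ->
  (forall z, K z -> {for z, continuous f}) -> (forall z, K z -> {for z, continuous g}) ->
  (forall z, K z -> normc (f z - g z) <= M) ->
  normc (triangle_int f T - triangle_int g T) <= M * perimeter T.
Proof.
case: T => [[a b] c] cvxK [/= Ka Kb Kc] cf cg fgM.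
have side u v : K u -> K v -> normc (seg_int f u v - seg_int g u v) <= M * normc (v - u).
  move=> Ku Kv; have Kuv t : 0 <= t <= 1 -> K (seg u v t) by exact: cvxK.
  by apply: le_seg_intB => t /Kuv; [exact: cf|exact: cg|exact: fgM].
rewrite /triangle_int /perimeter /= (_ : _ - _ = (seg_int f a b - seg_int g a b) +
  (seg_int f b c - seg_int g b c) + (seg_int f c a - seg_int g c a)); last by ring.
apply: le_trans (le_normcD _ _) _; apply: le_trans (lerD (le_normcD _ _) (lexx _)) _.
rewrite !mulrDr; apply: lerD; last exact: side.
by apply: lerD; exact: side.
Qed.

Lemma triangle_int_affine u l x T : triangle_int (fun z => u + l * (z - x)) T = 0.
Proof.
have primitive z (_ : [set: C] z) :
    is_derive z 1 (fun z => u * z + l / 2 * (z - x) ^+ 2) (u + l * (z - x)).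
  have dsqr := is_derive_scale (l / 2) (is_derive_exp 2 (is_derive_subr x z)).
  apply: is_derive_eq (is_deriveD (is_derive_scale u (is_derive_id z 1)) dsqr) _.
  by rewrite expr1; field.
by apply: triangle_int_primitive primitive _.
Qed.

Lemma convexI K K' : convex K -> convex K' -> convex (K `&` K').
Proof.
by move=> cvxK cvxK' a b t [Ka K'a] [Kb K'b] t01; split; [exact: cvxK|exact: cvxK'].
Qed.

(* The affine part of [f] at [x] does not contribute to the integral. *)
Lemma triangle_int_local f K x e : convex K -> (forall z, K z -> {for z, continuous f}) ->
  derivable f x 1 -> 0 < e ->
  exists2 d, 0 < d & forall T, vertices_in K T ->
    perimeter T < d -> normc (T.1.1 - x) <= 2 * perimeter T ->
    normc (triangle_int f T) <= e * perimeter T ^+ 2.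
Proof.
move=> cvxK cf /derivable_is_derive; set l := f^`() x => /is_derive_ler_distP dfx e0.
have e4 : 0 < e / 4 by lra.
have /nearcP[d d0 dfd] := dfx _ e4.
exists (d / 4) => [|T KT Td Tx]; first by lra.
pose g z := f x + l * (z - x); have cg z : {for z, continuous g}.
  have hsub : holo (fun z => z - x) z := holoB (holo_id z) (holo_cst x z).
  exact: holo_continuous (holoD (holo_cst _ z) (holoM (holo_cst l z) hsub)).
set L := perimeter T in Td *; have KT' : vertices_in (K `&` cdisc x (4 * L)) T.
  rewrite /L; case: (T) KT Tx => [[a b] c] [/= Ka Kb Kc]; rewrite /cdisc /perimeter /= => ax.
  have := normc_ge0 (b - a); have := normc_ge0 (c - b); have := normc_ge0 (a - c).
  have := ler_distcD a b x; have := ler_distcD a c x; rewrite [normc (c - a)]distcC.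
  by split; split=> //=; lra.
have cvxK' := convexI cvxK (@cdisc_convex R x (4 * L)).
have fg z : (K `&` cdisc x (4 * L)) z -> normc (f z - g z) <= e * L.
  rewrite /cdisc => -[_ /= zx]; rewrite /g opprD addrA; apply: le_trans (dfd _ _) _; first by lra.
  by have := ler_wpM2l (ltW e4) zx; lra.
rewrite -[triangle_int f T]subr0 -(triangle_int_affine (f x) l x T) expr2 mulrA.
exact: (le_triangle_intB cvxK' KT' (fun z Kz => cf z Kz.1) (fun z _ => cg z) fg).
Qed.

Lemma goursat f K T : compact K -> convex K -> (forall z, K z -> derivable f z 1) ->
  vertices_in K T -> triangle_int f T = 0.
Proof.
move=> cK cvxK df KT; have cf z : K z -> {for z, continuous f}.
  by move=> /df; exact: derivable_continuous.
apply/eqP; rewrite -normc_eq0 eq_le normc_ge0 andbT; apply/ler_addgt0Pr => e e0; rewrite add0r.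
have le_P e' : 0 < e' -> normc (triangle_int f T) <= e' * perimeter T ^+ 2.
  move=> e'0; apply: (@triangle_subdivision_ind K
    (fun T => normc (triangle_int f T) <= e' * perimeter T ^+ 2)) => // [{}T {}KT subT|x Kx].
    rewrite (triangle_int_split cvxK cf KT).
    apply: le_trans (ler_norm_sum (V := Rcomplex R) _ _ _) _.
    apply: (@le_trans _ _ (\sum_(T' <- subtriangles T) e' * (perimeter T / 2) ^+ 2)).
      rewrite big_seq [leRHS]big_seq; apply: ler_sum => T' TT'.
      by rewrite -(perimeter_subtriangles TT'); exact: subT.
    by case: (T) => [[a b] c]; rewrite !big_cons big_nil; lra.
  exact: triangle_int_local cvxK cf (df x Kx) e'0.
have P0 : 0 < perimeter T ^+ 2 + 1 by have := sqr_ge0 (perimeter T); lra.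
apply: le_trans (le_P (e / (perimeter T ^+ 2 + 1)) _) _; first by rewrite divr_gt0.
by rewrite mulrAC ler_pdivrMr// ler_pM2l//; lra.
Qed.

Lemma disc_primitive f x r : (forall z, disc x r z -> derivable f z 1) ->
  exists F, forall z, disc x r z -> is_derive z 1 F (f z).
Proof.
move=> df; exists (fun z => seg_int f x z) => z zr.
have cf y : disc x r y -> {for y, continuous f} by move=> /df; exact: derivable_continuous.
have xr : disc x r x by apply: disc_center; exact: le_lt_trans (normc_ge0 _) zr.
have cseg u v : disc x r u -> disc x r v -> forall t, 0 <= t <= 1 -> {for seg u v t, continuous f}.
  by move=> ur vr t t01; apply: cf; exact: disc_convex.
apply/is_derive_ler_distP => e e0.
have /(@cvgcP _ _ (nbhs z))/(_ e e0)/nearcP[d d0 fzd] := cf z zr.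
have /nearcP[d' d'0 zd'] := near_disc zr.
apply/nearcP; exists (Order.min d d') => [|w]; first by rewrite lt_min d0.
rewrite lt_min => /andP[wd /zd' wr].
have increment : seg_int f x w - seg_int f x z = seg_int f z w.
  pose s := Order.max (normc (z - x)) (normc (w - x)).
  have triangle0 : triangle_int f (x, z, w) = 0.
    apply: (@goursat f (cdisc x s)); [exact: compact_cdisc|exact: cdisc_convex| |].
      by move=> y ys; apply: df; apply: le_lt_trans ys _; rewrite gt_max; apply/andP.
    split; rewrite /cdisc /= ?subrr ?normc0 /s ?le_max ?normc_ge0 ?lexx ?orbT//.
  move: triangle0; rewrite /triangle_int /= (seg_int_rev (cseg x w xr wr)) => /eqP.
  by rewrite subr_eq0 => /eqP <-; ring.
rewrite increment (_ : f z * (w - z) = seg_int (fun=> f z) z w); last first.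
  apply/esym; apply: etrans (seg_int_primitive (F := fun y => f z * y) _) _; last by ring.
  by move=> t _; have := is_derive_scale (f z) (is_derive_id (seg z w t) 1); rewrite mulr1.
apply: le_seg_intB => [|t _|t t01]; [exact: cseg|exact: cst_continuous|].
apply/ltW/fzd; rewrite -[X in _ - X](seg0 z w) dist_seg subr0; apply: le_lt_trans wd.
by case/andP: t01 => t0 t1; rewrite ger0_norm// ler_piMl ?normc_ge0.
Qed.

End Goursat.

(** * Cauchy's formula and Taylor expansion *)

Section CircleIntegral.
Context {R : realType}.
Local Notation C := (Cplx R).
Implicit Types (x y z : C) (f g F : C -> C) (r s t M : R) (n : nat).

Definition cis t : C := Complex (cos (2 * pi * t)) (sin (2 * pi * t)).
Definition twopii : C := Complex 0 (2 * pi).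
Definition circle x r t : C := x + r%:C * cis t.

Lemma twopii_neq0 : twopii != 0.
Proof. by rewrite -normc_gt0 /= expr0n add0r sqrtr_gt0 exprn_gt0// mulr_gt0// pi_gt0. Qed.

Lemma normc_cis t : normc (cis t) = 1.
Proof. by rewrite /= cos2Dsin2 sqrtr1. Qed.

Lemma dist_circle x r t : 0 <= r -> normc (circle x r t - x) = r.
Proof. by move=> r0; rewrite addrC addKr normcM normc_cis mulr1 normc_real ger0_norm. Qed.

Lemma curve_der_circle x r t : curve_der (circle x r) t (twopii * (circle x r t - x)).
Proof.
have dangle : is_derive t 1 (fun s : R => 2 * pi * s) (2 * pi).
  by have := is_derive_scale (2 * pi) (is_derive_id t 1); rewrite mulr1.
have dcis : curve_der cis t (twopii * cis t).
  have := curve_der_complex (is_derive_comp (is_derive_cos _) dangle)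
    (is_derive_comp (is_derive_sin _) dangle).
  rewrite (_ : Complex _ _ = twopii * cis t)//.
  by apply: eqc; rewrite !ReImE /=; ring.
have -> : twopii * (circle x r t - x) = 0 + r%:C * (twopii * cis t).
  by rewrite /circle; ring.
apply: curve_derD (curve_derZ _ dcis).
by exists (fun=> 0); split=> [s| |//]; [rewrite mul0r subrr|exact: cst_continuous].
Qed.

Lemma continuous_circle x r : continuous01 (circle x r).
Proof. by move=> t _; exact: curve_der_continuous (curve_der_circle x r t). Qed.

Definition circle_int f x r := cint (fun t => f (circle x r t) * (twopii * (circle x r t - x))).

Lemma continuous_circle_int f x r : 0 <= r ->
  (forall y, normc (y - x) = r -> {for y, continuous f}) ->
  continuous01 (fun t => f (circle x r t) * (twopii * (circle x r t - x))).
Proof.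
move=> r0 cf; have cfcircle t (_ : 0 <= t <= 1) : {for circle x r t, continuous f}.
  by apply: cf; exact: dist_circle.
apply: continuous01M; first exact: (continuous01_comp (@continuous_circle x r) cfcircle).
apply: continuous01M; first exact: continuous01_cst.
exact: continuous01_subr (@continuous_circle x r).
Qed.

Lemma circle_int_primitive F f x r : 0 <= r ->
  (forall y, normc (y - x) = r -> is_derive y 1 F (f y)) -> circle_int f x r = 0.
Proof.
move=> r0 dF; apply: cintE; exists (F \o circle x r) => [t _|].
  exact: curve_der_comp (dF _ (dist_circle _ _ r0)) (curve_der_circle x r t).
have loop : circle x r 1 = circle x r 0.
  by rewrite /circle /cis mulr1 mulr0 [2 * pi]mulr_natl cos2pi sin2pi cos0 sin0.
by rewrite /= loop subrr.
Qed.

Lemma eq_circle_int f g x r : 0 <= r -> (forall y, normc (y - x) = r -> f y = g y) ->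
  circle_int f x r = circle_int g x r.
Proof. by move=> r0 fg; apply: eq_cint => t _; rewrite fg ?dist_circle. Qed.

Lemma circle_int_lin f g x r (c : C) : 0 <= r ->
  (forall y, normc (y - x) = r -> {for y, continuous f}) ->
  (forall y, normc (y - x) = r -> {for y, continuous g}) ->
  circle_int (fun y => c * f y + g y) x r = c * circle_int f x r + circle_int g x r.
Proof.
move=> r0 cf cg; rewrite -(cint_lin _ (continuous_circle_int r0 cf) (continuous_circle_int r0 cg)).
by apply: eq_cint => t _; ring.
Qed.

Lemma le_circle_int f x r M : 0 <= r ->
  (forall y, normc (y - x) = r -> {for y, continuous f}) ->
  (forall y, normc (y - x) = r -> normc (f y) <= M) ->
  normc (circle_int f x r) <= M * (normc twopii * r).
Proof.
move=> r0 cf fM; apply: le_cint (continuous_circle_int r0 cf) _ => t _.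
rewrite !normcM dist_circle// ler_wpM2r ?mulr_ge0 ?normc_ge0//.
by apply: fM; exact: dist_circle.
Qed.

Definition cauchy_int f x r n z := circle_int (fun y => f y / (y - z) ^+ n) x r.

Lemma circle_neq x r y z : normc (y - x) = r -> disc x r z -> y - z != 0.
Proof.
by move=> yr; rewrite /disc /= subr_eq0; apply: contraTneq => <-; rewrite yr ltxx.
Qed.

Lemma continuous_cauchy_kernel f x r n z : disc x r z ->
  (forall y, normc (y - x) = r -> {for y, continuous f}) ->
  forall y, normc (y - x) = r -> {for y, continuous (fun y => f y / (y - z) ^+ n)}.
Proof.
move=> zr cf y yr; have csub : {for y, continuous (fun y => y - z)}.
  exact: continuousB (@cvg_id _ _) (@cst_continuous _ _ z y).
apply: (continuousM (cf y yr)); apply: continuousV; last exact: continuousX.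
by rewrite expf_neq0// (circle_neq yr zr).
Qed.

Lemma is_derive_inv_exp x n : x != 0 ->
  is_derive x 1 (fun y => (y ^+ n)^-1) (- n%:R / x ^+ n.+1).
Proof.
move=> x0; have xn0 : x ^+ n != 0 by rewrite expf_neq0.
have dexp := is_derive_exp n (is_derive_id x 1).
apply: is_derive_eq (is_derive_inv (f := fun y => y ^+ n) xn0 dexp) _.
case: n xn0 {dexp} => [|n] xn0; first by rewrite !mul0r oppr0 !mul0r.
by rewrite /= !exprS; field; rewrite x0 expf_neq0.
Qed.

Lemma is_derive_cauchy_int f x r n z : disc x r z ->
  (forall y, normc (y - x) = r -> {for y, continuous f}) ->
  is_derive z 1 (cauchy_int f x r n) (n%:R * cauchy_int f x r n.+1 z).
Proof.
move=> zr cf; have r0 : 0 <= r by apply/ltW; apply: le_lt_trans zr; exact: normc_ge0.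
pose F (u : C) : C := (u ^+ n)^-1; pose F' (u : C) : C := - n%:R / u ^+ n.+1.
pose ker t := f (circle x r t) * (twopii * (circle x r t - x)).
have neq0 t : circle x r t + z * -1 != 0.
  by rewrite mulrN1; exact: circle_neq (dist_circle _ _ r0) zr.
have cF' u : u != 0 -> {for u, continuous F'}.
  move=> u0; have un0 : u ^+ n.+1 != 0 by rewrite expf_neq0.
  have cexp : {for u, continuous (fun u : C => u ^+ n.+1)} := continuousX (@cvg_id _ _).
  exact: (continuousM (@cst_continuous C C (- n%:R) u)
    (continuousV (s := fun v : C => v ^+ n.+1) un0 cexp)).
have := @is_derive_cint R ker (circle x r) (fun=> -1) F F' z (continuous_circle_int r0 cf)
  (@continuous_circle x r) (@continuous01_cst _ _) _ (fun t _ => cF' _ (neq0 t)).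
case=> [t _|dint intE]; first by apply: filterS (near_neq (neq0 t)) => u; exact: is_derive_inv_exp.
have -> : cauchy_int f x r n = fun w => cint (fun t => ker t * F (circle x r t + w * -1)).
  by apply: funext => w; apply: eq_cint => t _; rewrite mulrN1 mulrAC.
apply: DeriveDef => //; rewrite intE -cintZ.
  by apply: eq_cint => t _; rewrite /F' (mulrN1 z) /ker; ring.
exact: continuous_circle_int r0 (continuous_cauchy_kernel zr cf).
Qed.

Lemma cauchy_int_cst1 x r z : disc x r z -> cauchy_int (fun=> 1) x r 1 z = twopii.
Proof.
move=> zr; have r0 : 0 < r by apply: le_lt_trans zr; exact: normc_ge0.
have d0 w : disc x r w -> is_derive w 1 (cauchy_int (fun=> 1) x r 1) 0.
  move=> wr; have dW := is_derive_cauchy_int 1 wr (fun y _ => @cst_continuous C C 1 y).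
  apply: is_derive_eq dW _; rewrite mul1r.
  apply: (@circle_int_primitive (fun y => - (y - w)^-1)) => [|y yr]; first exact: ltW.
  have yw := circle_neq yr wr.
  have dinv := is_derive_inv (f := fun y => y - w) yw (is_derive_subr w y).
  by apply: is_derive_eq (is_deriveN dinv) _; rewrite mulNr opprK.
rewrite (derive0_disc_cst d0 zr); apply: cintE.
exists (fun t => 0 + t%:C * twopii); last by rewrite rmorph1 rmorph0; ring.
move=> t _; rewrite expr1 div1r mulrCA mulVf ?mulr1; first exact: curve_der_line.
by rewrite -normc_gt0 dist_circle// ltW.
Qed.

Lemma homothety_in_disc x r rho z y s : r < rho -> disc x r z -> 0 <= s <= 1 ->
  normc (y - x) = r -> disc x rho (z + s%:C * (y - z)).
Proof.
move=> rrho zr s01 yr; apply: (@disc_convex _ x rho z y s) s01; first exact: lt_trans zr rrho.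
by rewrite /disc /= yr.
Qed.

Lemma circle_int_homothety0 f f' x r rho z s : r < rho -> disc x r z -> 0 <= s <= 1 ->
  (forall y, disc x rho y -> is_derive y 1 f (f' y)) ->
  circle_int (fun y => f' (z + s%:C * (y - z))) x r = 0.
Proof.
move=> rrho zr s01 df; have r0 : 0 <= r by apply/ltW; apply: le_lt_trans zr; exact: normc_ge0.
have [->|s0] := eqVneq s 0.
  rewrite (@eq_circle_int _ (fun=> f' z))// => [|y _]; last by rewrite rmorph0 mul0r addr0.
  apply: (@circle_int_primitive (fun y => f' z * y)) => // y _.
  by have := is_derive_scale (f' z) (is_derive_id y 1); rewrite mulr1.
have sC0 : s%:C != 0 by rewrite fmorph_eq0.
apply: (@circle_int_primitive (fun y => s%:C^-1 * f (z + s%:C * (y - z)))) => [//|y yr].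
have dline : is_derive y 1 (fun y => z + s%:C * (y - z)) s%:C.
  have dscale := is_derive_scale s%:C (is_derive_subr z y).
  by apply: is_derive_eq (is_deriveD (is_derive_cst z y 1) dscale) _; rewrite mulr1 add0r.
have dcomp := is_derive_scale s%:C^-1 (is_derive_comp
  (g := fun y => z + s%:C * (y - z)) (df _ (homothety_in_disc rrho zr s01 yr)) dline).
by apply: is_derive_eq dcomp _; rewrite mulrCA mulVf// mulr1.
Qed.

(* The integral of [f (z + s (y - z)) / (y - z)] over the circle does not depend on [s]
   between [0] and [1]. *)
Lemma cauchy_formula_C1 f f' x r rho z : r < rho -> disc x r z ->
  (forall y, disc x rho y -> is_derive y 1 f (f' y)) ->
  (forall y, disc x rho y -> {for y, continuous f'}) ->
  cauchy_int f x r 1 z = twopii * f z.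
Proof.
move=> rrho zr df cf'; have r0 : 0 <= r by apply/ltW; apply: le_lt_trans zr; exact: normc_ge0.
pose q t := circle x r t - z.
pose g t := twopii * (circle x r t - x) / q t.
have q0 t : q t != 0 := circle_neq (dist_circle _ _ r0) zr.
have in_disc s t : 0 <= s <= 1 -> disc x rho (z + s%:C * q t).
  by move=> s01; exact: homothety_in_disc rrho zr s01 (dist_circle _ _ r0).
have cq : continuous01 q := continuous01_subr (@continuous_circle x r).
have cg : continuous01 g.
  apply: continuous01M => [|t t01]; last exact: (continuousV (q0 t) (cq t t01)).
  apply: continuous01M; first exact: continuous01_cst.
  exact: continuous01_subr (@continuous_circle x r).
pose Phi (s : C) := cint (fun t => g t * f (z + s * q t)).
have dPhi s : 0 <= s <= 1 -> is_derive s%:C 1 Phi 0.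
  move=> s01; have dfq t : 0 <= t <= 1 ->
      \forall u \near z + s%:C * q t, is_derive (u : C) 1 f (f' u).
    by move=> _; apply: filterS (near_disc (in_disc s t s01)) => u; exact: df.
  have dcint := is_derive_cint cg (@continuous01_cst _ z) cq dfq
    (fun t _ => cf' _ (in_disc s t s01)).
  apply: is_derive_eq dcint _; rewrite -(circle_int_homothety0 rrho zr s01 df).
  by apply: eq_cint => t _; rewrite /g mulfVK// mulrC.
have Phi01 : Phi 1 = Phi 0.
  by apply: derive0_seg_cst => t t01; rewrite /seg add0r subr0 mulr1; exact: dPhi.
have -> : cauchy_int f x r 1 z = Phi 1.
  apply: eq_cint => t _; have -> : z + 1 * q t = circle x r t by rewrite /q; ring.
  by rewrite expr1 -/(q t) /g; ring.
rewrite Phi01 -(cauchy_int_cst1 zr) mulrC -cintZ.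
  by apply: eq_cint => t _; rewrite /g mul0r addr0 expr1 -/(q t); ring.
exact: continuous_circle_int r0
  (continuous_cauchy_kernel zr (fun y _ => @cst_continuous C C 1 y)).
Qed.

Lemma disc_derivable_derive1 f x r z : (forall y, disc x r y -> derivable f y 1) ->
  disc x r z -> derivable f^`() z 1.
Proof.
move=> df zr; have [F dF] := disc_primitive df; pose s := (normc (z - x) + r) / 2.
have [zs sr] : disc x s z /\ s < r by move: zr; rewrite /disc /s /=; split; lra.
have cF y : normc (y - x) = s -> {for y, continuous F}.
  by move=> ys; have [|/derivable_continuous] := dF y; first by rewrite /disc /= ys.
have cf y : disc x r y -> {for y, continuous f} by move=> /df; exact: derivable_continuous.
have FE y : disc x s y -> twopii^-1 * cauchy_int F x s 1 y = F y.
  by move=> ys; rewrite (cauchy_formula_C1 sr ys dF cf) mulKf ?twopii_neq0.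
have fE y : disc x s y -> twopii^-1 * cauchy_int F x s 2 y = f y.
  move=> ys; have dI := is_derive_scale twopii^-1 (is_derive_cauchy_int 1 ys cF).
  rewrite mul1r in dI; rewrite -(derive1_val dI).
  apply: derive1_val; apply: near_eq_is_derive (dF y (lt_trans ys sr)).
  by apply: filterS (near_disc ys) => w /FE.
have f'E y : disc x s y -> twopii^-1 * (2%:R * cauchy_int F x s 3 y) = f^`() y.
  move=> ys; apply/esym/derive1_val.
  apply: near_eq_is_derive (is_derive_scale twopii^-1 (is_derive_cauchy_int 2 ys cF)).
  by apply: filterS (near_disc ys) => w /fE.
have [d3 _] := is_derive_scale twopii^-1 (is_derive_scale 2%:R (is_derive_cauchy_int 3 zs cF)).
by apply: near_eq_derivable d3; apply: filterS (near_disc zs) => w /f'E.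
Qed.

Lemma holo_derive1 f z : holo f z -> holo f^`() z.
Proof.
move=> /nearcP[r r0 df]; have zr := disc_center z r0.
by apply: filterS (near_disc zr) => w; exact: disc_derivable_derive1.
Qed.

Lemma cauchy_formula f x r rho z : r < rho -> (forall y, disc x rho y -> derivable f y 1) ->
  disc x r z -> cauchy_int f x r 1 z = twopii * f z.
Proof.
move=> rrho df zr; apply: (cauchy_formula_C1 rrho zr) => [y yrho|y yrho].
  exact: derivable_is_derive (df y yrho).
by apply: derivable_continuous; exact: disc_derivable_derive1 yrho.
Qed.

End CircleIntegral.

Section LocalTheory.
Context {R : realType}.
Local Notation C := (Cplx R).
Implicit Types (x y z : C) (f g : C -> C) (r M : R) (n k : nat).

(* The [n]-th remainder of the Taylor expansion of [f] at [x], divided by [(z - x)^n]. *)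
Definition taylor_rest f x r n z : C :=
  (@twopii R)^-1 * cauchy_int (fun y => f y / (y - x) ^+ n) x r 1 z.

Lemma taylor_restS f x r n z : (forall y, normc (y - x) = r -> {for y, continuous f}) ->
  disc x r z ->
  taylor_rest f x r n z = taylor_rest f x r n x + (z - x) * taylor_rest f x r n.+1 z.
Proof.
move=> cf zr; have r0 : 0 < r by apply: le_lt_trans zr; exact: normc_ge0.
have xr := disc_center x r0.
have cfn m := continuous_cauchy_kernel (n := m) xr cf.
rewrite /taylor_rest mulrCA -mulrDr; congr (_ * _); rewrite addrC -circle_int_lin; last first.
- exact: continuous_cauchy_kernel xr (cfn n).
- exact: continuous_cauchy_kernel zr (cfn n.+1).
- exact: ltW.
apply: eq_circle_int => [|y yr]; first exact: ltW.
have yx := circle_neq yr xr; have yz := circle_neq yr zr.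
by rewrite !expr1 exprS; field; rewrite yx yz expf_neq0.
Qed.

Lemma taylor_formula f x r rho n z : r < rho -> (forall y, disc x rho y -> derivable f y 1) ->
  (forall m, (m < n)%N -> taylor_rest f x r m x = 0) -> disc x r z ->
  f z = (z - x) ^+ n * taylor_rest f x r n z.
Proof.
move=> rrho df vanish zr; have cf y : normc (y - x) = r -> {for y, continuous f}.
  by move=> yr; apply: derivable_continuous; apply: df; rewrite /disc /= yr.
elim: n vanish => [|n IH] vanish.
  rewrite expr0 mul1r /taylor_rest -(mulKf (@twopii_neq0 R) (f z)) -(cauchy_formula rrho df zr).
  congr (_ * _); apply: eq_cint => t _; by rewrite expr0 divr1.
rewrite IH => [|m mn]; last by apply: vanish; exact: ltnW.
by rewrite (taylor_restS n cf zr) vanish// add0r mulrA -exprSr.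
Qed.

Lemma le_taylor_rest f x r M n z : (forall y, normc (y - x) = r -> {for y, continuous f}) ->
  (forall y, normc (y - x) = r -> normc (f y) <= M) -> disc x r z ->
  normc (taylor_rest f x r n z) <= M * r / (r - normc (z - x)) / r ^+ n.
Proof.
move=> cf fM zr; have r0 : 0 < r by apply: le_lt_trans zr; exact: normc_ge0.
have xr := disc_center x r0.
have rz : 0 < r - normc (z - x) by rewrite subr_gt0.
have twopii0 : 0 < normc (@twopii R) by rewrite normc_gt0 twopii_neq0.
rewrite /taylor_rest normcM normcV ler_pdivrMl//.
rewrite [leRHS](_ : _ = M / r ^+ n / (r - normc (z - x)) * (normc (@twopii R) * r)); last first.
  by field; rewrite !gt_eqF// exprn_gt0.
apply: le_circle_int => [||y yr]; first exact: ltW.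
  exact: continuous_cauchy_kernel zr (continuous_cauchy_kernel (n := n) xr cf).
rewrite expr1 !normcM !normcV normcX yr.
have yz : r - normc (z - x) <= normc (y - z) by have := ler_distcD z y x; rewrite yr; lra.
have rn0 : 0 <= (r ^+ n)^-1 by rewrite invr_ge0 exprn_ge0// ltW.
apply: ler_pM; [by rewrite mulr_ge0 ?normc_ge0|by rewrite invr_ge0 normc_ge0| |].
  by apply: (ler_wpM2r rn0); exact: fM.
by rewrite lef_pV2 ?posrE// (lt_le_trans rz).
Qed.

Lemma derivable_taylor_rest f x r n z : (forall y, normc (y - x) = r -> {for y, continuous f}) ->
  disc x r z -> derivable (taylor_rest f x r n) z 1.
Proof.
move=> cf zr; have xr : disc x r x by apply: disc_center; exact: le_lt_trans (normc_ge0 _) zr.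
have dI := is_derive_cauchy_int 1 zr (continuous_cauchy_kernel (n := n) xr cf).
by case: (is_derive_scale (@twopii R)^-1 dI).
Qed.

Lemma zero_order f x : holo f x -> (\forall z \near x, f z = 0) \/
  exists k g, [/\ holo g x, g x != 0 & \forall z \near x, f z = (z - x) ^+ k * g z].
Proof.
move=> /nearcP[rho rho0 df]; pose r := rho / 2.
have [r0 rrho] : 0 < r /\ r < rho by rewrite /r; split; lra.
have xr := disc_center x r0.
have cf y : normc (y - x) = r -> {for y, continuous f}.
  by move=> yr; apply: derivable_continuous; apply: df; rewrite yr.
have [flat|/existsNP[n0 /eqP nflat]] := pselect (forall n, taylor_rest f x r n x = 0); [left|right].
  have [M fM] : exists M, forall y, normc (y - x) = r -> normc (f y) <= M.
    have [||z _ zmax] := @cdisc_EVT_max R (fun y => normc (f y)) x r; first exact: ltW.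
      move=> y yr; apply: continuous_comp (@continuous_normc R _); apply: derivable_continuous.
      by apply: df; exact: le_lt_trans yr rrho.
    by exists (normc (f z)) => y yr; apply: zmax; rewrite /cdisc /= yr.
  apply: filterS (near_disc xr) => z zr; apply/eqP; rewrite -normc_eq0 eq_le normc_ge0 andbT.
  pose q := normc (z - x) / r; pose B := M * r / (r - normc (z - x)).
  have q01 : 0 <= q < 1 by rewrite divr_ge0 ?normc_ge0 ?ltW// ltr_pdivrMr// mul1r.
  apply: (le0_geometric q01 (b := B)) => n.
  rewrite (taylor_formula (n := n) rrho df (fun m _ => flat m) zr) normcM normcX.
  rewrite /q expr_div_n mulrCA ler_wpM2l ?exprn_ge0 ?normc_ge0//; exact: le_taylor_rest.
case: (ex_minnP (ex_intro (fun n => taylor_rest f x r n x != 0) n0 nflat)) => k gk kmin.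
exists k, (taylor_rest f x r k); split=> //.
  by apply: filterS (near_disc xr) => z; exact: derivable_taylor_rest.
apply: filterS (near_disc xr) => z; apply: taylor_formula rrho df _ => m mk.
by apply/eqP; apply: contraLR mk => /kmin; rewrite -leqNgt.
Qed.

Lemma isolated_zeros f x : holo f x ->
  (\forall z \near x, f z = 0) \/ (\forall z \near x^', f z != 0).
Proof.
move=> /zero_order[|[k [g [hg gx fE]]]]; [by left|right].
have g0 := near_neq0 (holo_continuous hg) gx.
apply: filterS3 (nbhs_dnbhs_neq x) (near_dnear fE) (near_dnear g0) => z zx -> gz.
by rewrite mulf_neq0// expf_neq0// subr_eq0.
Qed.

Lemma is_derive_sqr_mul_bounded f x M : (\forall z \near x^', normc (f z) <= M) ->
  is_derive x 1 (fun z => (z - x) ^+ 2 * f z) 0.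
Proof.
move=> fM; have M0 : 0 <= M by have [z /(le_trans (normc_ge0 _))] := filter_ex fM.
apply/is_derive_ler_distP => e e0; have M1 : 0 < M + 1 by lra.
move: fM => /dnearcP[d d0 fM]; apply/nearcP; exists (Order.min d (e / (M + 1))) => [|z].
  by rewrite lt_min d0 divr_gt0.
rewrite lt_min ltr_pdivlMr// => /andP[zd ze].
rewrite subrr expr0n mul0r mul0r !subr0; have [->|zx] := eqVneq z x.
  by rewrite subrr expr0n mul0r normc0 mulr0.
have fzM := fM z zx zd; have zx0 := normc_ge0 (z - x); have fz0 := normc_ge0 (f z).
rewrite normcM normcX expr2 -mulrA [leRHS]mulrC ler_wpM2l//; nra.
Qed.

(* Riemann's trick: [(z - x)^2 f z] is holomorphic at [x] and vanishes to order at least 2. *)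
Lemma removable_singularity f x M : (\forall z \near x^', derivable f z 1) ->
  (\forall z \near x^', normc (f z) <= M) ->
  exists2 g, holo g x & \forall z \near x^', f z = g z.
Proof.
move=> df fM; pose h z := (z - x) ^+ 2 * f z.
have dh : is_derive x 1 h 0 := is_derive_sqr_mul_bounded fM.
have hx : h x = 0 by rewrite /h subrr expr0n mul0r.
have hh : holo h x.
  have dsqr z : derivable (fun z => (z - x) ^+ 2) z 1.
    exact: holo_derivable (holoX 2 (holoB (holo_id z) (holo_cst x z))).
  move: df => /dnearcP[d d0 df]; apply/nearcP; exists d => // z zd.
  have [->|zx] := eqVneq z x; first by case: dh.
  exact: derivableM (dsqr z) (df z zx zd).
have fE z : z != x -> f z = h z / (z - x) ^+ 2.
  by move=> zx; rewrite /h mulrC mulKf// expf_neq0// subr_eq0.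
case: (zero_order hh) => [h0|[k [g [hg gx hE]]]].
  exists (fun=> 0); first exact: holo_cst.
  by apply: filterS2 (nbhs_dnbhs_neq x) (near_dnear h0) => z zx hz; rewrite fE// hz mul0r.
have k2 : (1 < k)%N.
  case: k hE => [|[|//]] hE.
    by move/nbhs_singleton: hE; rewrite hx expr0 mul1r => /esym/eqP; rewrite (negbTE gx).
  have dg := is_derive_mul (is_derive_subr x x) (derivable_is_derive (holo_derivable hg)).
  have : h^`() x = g x.
    rewrite (derive1_val (near_eq_is_derive _ dg)) ?subrr ?mul0r ?addr0 ?mul1r//.
    by apply: filterS hE => z ->; rewrite expr1.
  by rewrite (derive1_val dh) => /esym/eqP; rewrite (negbTE gx).
exists (fun z => (z - x) ^+ (k - 2) * g z).
  by apply: holoM hg; apply: holoX; exact: holoB (holo_id x) (holo_cst x x).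
apply: filterS2 (nbhs_dnbhs_neq x) (near_dnear hE) => z zx hz; rewrite fE// hz.
have zx2 : (z - x) ^+ 2 != 0 by rewrite expf_neq0// subr_eq0.
by rewrite -{1}(subnK k2) exprD [X in X / _]mulrAC mulfK.
Qed.

End LocalTheory.

(** * Meromorphic functions *)

Section Germs.
Context {R : realType}.
Local Notation C := (Cplx R).
Implicit Types (z w : C) (f g h : C -> C).

(* Values on the polar set are unconstrained: only the behaviour near [z] off [z] matters. *)
Definition mero h z := exists p q, [/\ holo p z, holo q z &
  \forall w \near z^', q w != 0 /\ h w = p w / q w].

Lemma holo_mero h z : holo h z -> mero h z.
Proof.
move=> hh; exists h, (fun=> 1); split; [exact: hh|exact: holo_cst|].
by apply: filterS filterT => w _; rewrite oner_neq0 divr1.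
Qed.

Lemma near_eq_mero f h z : (\forall w \near z^', f w = h w) -> mero f z -> mero h z.
Proof.
move=> fh [p [q [hp hq fE]]]; exists p, q; split=> //.
by apply: filterS2 fh fE => w <-.
Qed.

Lemma meroD f h z : mero f z -> mero h z -> mero (fun w => f w + h w) z.
Proof.
move=> [p [q [hp hq fE]]] [r [s [hr hs hE]]].
exists (fun w => p w * s w + r w * q w), (fun w => q w * s w); split.
- exact: holoD (holoM hp hs) (holoM hr hq).
- exact: holoM.
- by apply: filterS2 fE hE => w [q0 ->] [s0 ->]; split; [rewrite mulf_neq0|field; rewrite s0 q0].
Qed.

Lemma meroM f h z : mero f z -> mero h z -> mero (fun w => f w * h w) z.
Proof.
move=> [p [q [hp hq fE]]] [r [s [hr hs hE]]].
exists (fun w => p w * r w), (fun w => q w * s w); split; [exact: holoM|exact: holoM|].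
by apply: filterS2 fE hE => w [q0 ->] [s0 ->]; split; [rewrite mulf_neq0|field; rewrite s0 q0].
Qed.

Lemma meroX h n z : mero h z -> mero (fun w => h w ^+ n) z.
Proof.
move=> mh; elim: n => [|n IH]; first exact: holo_mero (holo_cst 1 z).
by apply: near_eq_mero (meroM mh IH); apply: filterS filterT => w _; rewrite exprS.
Qed.

Lemma mero_eq0 h z : mero h z -> (\forall w \near z^', h w = 0) \/ (\forall w \near z^', h w != 0).
Proof.
move=> [p [q [hp hq hE]]]; have [/near_dnear p0|p0] := isolated_zeros hp; [left|right].
  by apply: filterS2 p0 hE => w -> [_ ->]; rewrite mul0r.
by apply: filterS2 p0 hE => w p0 [q0 ->]; rewrite mulf_neq0// invr_neq0.
Qed.

Lemma meroV h z : mero h z -> mero (fun w => (h w)^-1) z.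
Proof.
move=> mh; have [h0|h0] := mero_eq0 mh.
  by apply: near_eq_mero (holo_mero (holo_cst 0 z)); apply: filterS h0 => w ->; rewrite invr0.
case: mh => p [q [hp hq hE]]; exists q, p; split=> //.
apply: filterS2 h0 hE => w + [q0 hwE]; rewrite hwE mulf_eq0 negb_or => /andP[p0 _].
by rewrite invf_div.
Qed.

(* [v] is the value at [z] of the map to the sphere that [h] induces near [z]. *)
Definition germ_value h z (v : sphere R) := match v with
  | Some u => exists H, [/\ holo H z, H z = u & \forall w \near z^', h w = H w]
  | None => exists H, [/\ holo H z, H z = 0 & \forall w \near z^', H w != 0 /\ h w = (H w)^-1]
  end.

Lemma holo_germ_value h z : holo h z -> germ_value h z (Some (h z)).
Proof. by move=> hh; exists h; split=> //; exact: filterS filterT. Qed.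

Lemma near_eq_germ_value f h z v : (\forall w \near z^', f w = h w) ->
  germ_value f z v -> germ_value h z v.
Proof.
move=> fh; case: v => [u|] [H [hH Hz fH]]; exists H; split=> //.
  by apply: filterS2 fh fH => w ->.
by apply: filterS2 fh fH => w ->.
Qed.

Lemma continuous_dnear_eq f g z : {for z, continuous f} -> {for z, continuous g} ->
  (\forall w \near z^', f w = g w) -> f z = g z.
Proof.
move=> cf /continuous_withinNx cg fg; apply: continuous_dnear_lim cf _.
by apply: cvg_trans cg; apply: near_eq_cvg; apply: filterS fg => w ->.
Qed.

Lemma germ_value_unique h z v v' : germ_value h z v -> germ_value h z v' -> v = v'.
Proof.
have mixed u : germ_value h z (Some u) -> ~ germ_value h z None.
  move=> [H [hH _ hE]] [H' [hH' H'z h'E]].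
  have /eqP : H z * H' z = 1.
    apply: (@continuous_dnear_eq (fun w => H w * H' w) (fun=> 1)).
    - exact: holo_continuous (holoM hH hH').
    - exact: cst_continuous.
    - by apply: filterS2 hE h'E => w -> [H'w ->]; rewrite mulVf.
  by rewrite H'z mulr0 eq_sym oner_eq0.
case: v v' => [u|] [u'|] // hv hv'; [|by case: (mixed _ hv)|by case: (mixed _ hv')].
move: hv hv' => [H [hH <- hE]] [H' [hH' <- h'E]]; congr Some.
apply: (continuous_dnear_eq (holo_continuous hH) (holo_continuous hH')).
by apply: filterS2 hE h'E => w ->.
Qed.

(* Near [z] the quotient is [(w - z)^(k - l)] times a holomorphic function that does not vanish. *)
Lemma mero_germ_value h z : mero h z -> exists v, germ_value h z v.
Proof.
move=> [p [q [hp hq hE]]].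
have [/near_dnear p0|[k [u [hu u0 /near_dnear pE]]]] := zero_order hp.
  exists (Some 0), (fun=> 0); split; [exact: holo_cst|by []|].
  by apply: filterS2 p0 hE => w -> [_ ->]; rewrite mul0r.
have [/near_dnear q0|[l [v [hv v0 /near_dnear qE]]]] := zero_order hq.
  by have [w [[/eqP]]] := filter_ex (filterI hE q0).
have holo_pow i f g : holo f z -> holo g z -> g z != 0 ->
    holo (fun w => (w - z) ^+ i * (f w / g w)) z.
  move=> hf hg g0; apply: holoM (holoM hf (holoV g0 hg)).
  by apply: holoX; exact: holoB (holo_id z) (holo_cst z z).
have nonzero : \forall w \near z^', [/\ w - z != 0, u w != 0 & v w != 0].
  have u0' := near_dnear (near_neq0 (holo_continuous hu) u0).
  have v0' := near_dnear (near_neq0 (holo_continuous hv) v0).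
  by apply: filterS3 (nbhs_dnbhs_neq z) u0' v0' => w; rewrite -subr_eq0.
have {}hE : \forall w \near z^', h w = (w - z) ^+ k * u w / ((w - z) ^+ l * v w).
  by apply: filterS3 hE pE qE => w [_ ->] -> ->.
have [lk|kl] := leqP l k.
  pose H w := (w - z) ^+ (k - l) * (u w / v w).
  exists (Some (H z)), H; split; [exact: holo_pow|by []|].
  apply: filterS2 hE nonzero => w -> [wz _ vw]; rewrite /H -{1}(subnK lk) exprD.
  by field; rewrite vw expf_neq0.
exists None, (fun w => (w - z) ^+ (l - k) * (v w / u w)); split; first exact: holo_pow.
  by rewrite subrr expr0n subn_eq0 leqNgt kl mul0r.
apply: filterS2 hE nonzero => w -> [wz uw vw].
split; first by rewrite !mulf_neq0 ?invr_neq0 ?expf_neq0.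
rewrite -{1}(subnK (ltnW kl)) exprD.
by field; rewrite vw uw !expf_neq0.
Qed.

Lemma germ_value_near_holo h z v : germ_value h z v -> \forall w \near z^', holo h w.
Proof.
case: v => [u|] [H [hH _ hE]].
  by apply: filterS2 (dnear_join hE) (near_dnear (near_holo hH)) => w hw;
    apply: near_eq_holo; apply: filterS hw => y ->.
apply: filterS2 (dnear_join hE) (near_dnear (near_holo hH)) => w hw hHw.
have [Hw _] := nbhs_singleton hw; apply: near_eq_holo (holoV Hw hHw).
by apply: filterS hw => y [_ ->].
Qed.

End Germs.

Section MeromorphicFunctions.
Context {R : realType}.
Local Notation C := (Cplx R).
Implicit Types (z w : C) (f g : C -> sphere R) (h : C -> C).

Lemma finite_partE f z : f z <> None -> f z = Some (finite_part f z).
Proof. by rewrite /finite_part; case: (f z). Qed.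

Lemma meromorphic_regular f z : meromorphic f ->
  \forall w \near z^', f w <> None /\ derivable (finite_part f) w 1.
Proof. by move=> /(_ z)[]. Qed.

Lemma meromorphic_holo f z : meromorphic f -> f z <> None -> holo (finite_part f) z.
Proof.
move=> mf fz; have [_] := mf z; rewrite (finite_partE fz) => dz.
apply: dnear_near; first by [].
by apply: filterS (meromorphic_regular z mf) => w [].
Qed.

Lemma meromorphic_pole f z (M : R) : meromorphic f -> f z = None -> 0 < M ->
  \forall w \near z^', M < normc (finite_part f w).
Proof.
move=> mf fz M0; have [_] := mf z; rewrite fz => /(_ M%:C).
rewrite -(rmorph0 of_real) ltr_of_real => /(_ M0).
by apply: filterS => w; rewrite normrE ltr_of_real.
Qed.

Lemma meromorphic_germ_value f z : meromorphic f -> germ_value (finite_part f) z (f z).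
Proof.
move=> mf; have [fz|fz] := pselect (f z = None); last first.
  by rewrite (finite_partE fz); exact: holo_germ_value (meromorphic_holo mf fz).
rewrite fz; have pole M : 0 < M -> \forall w \near z^', M < normc (finite_part f w).
  exact: meromorphic_pole.
have [||q hq qE] := @removable_singularity R (fun w => (finite_part f w)^-1) z 1.
- apply: filterS2 (meromorphic_regular z mf) (pole 1 ltr01) => w [_ df] fw1.
  by apply: derivableV df; rewrite -normc_gt0; apply: lt_trans fw1.
- by apply: filterS (pole 1 ltr01) => w /ltW fw1; rewrite normcV invf_le1// (lt_le_trans ltr01).
exists q; split; [exact: hq| |].
  apply: continuous_dnear_lim (holo_continuous hq) _.
  apply/(@cvgcP _ _ z^') => e e0; have einv0 : 0 < e^-1 by rewrite invr_gt0.
  apply: filterS2 qE (pole _ einv0) => w <- efw; rewrite subr0 normcV invf_plt ?posrE//.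
  exact: lt_trans efw.
apply: filterS2 qE (pole 1 ltr01) => w <- fw1; rewrite invrK invr_eq0 -normc_gt0.
by split=> //; apply: lt_trans fw1.
Qed.

Lemma meromorphic_mero f z : meromorphic f -> mero (finite_part f) z.
Proof.
move=> mf; case: (f z) (meromorphic_germ_value z mf) => [u|] [H [hH _ fH]].
  by apply: near_eq_mero (holo_mero hH); apply: filterS fH => w ->.
by apply: near_eq_mero (meroV (holo_mero hH)); apply: filterS fH => w [_ ->].
Qed.

Lemma meromorphic_extension h : (forall z, mero h z) -> exists2 F : C -> sphere R,
  meromorphic F & forall z, \forall w \near z^', F w = Some (h w).
Proof.
move=> mh; have /choice[F hF] : forall z, exists v, germ_value h z v.
  by move=> z; exact: mero_germ_value.
have FE z : \forall w \near z^', F w = Some (h w).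
  apply: filterS (germ_value_near_holo (hF z)) => w hw.
  exact: germ_value_unique (hF w) (holo_germ_value hw).
exists F => // z; have FEj := dnear_join (FE z).
have finE w : F w = Some (h w) -> finite_part F w = h w by rewrite /finite_part => ->.
split.
  apply: filterS3 (FE z) FEj (germ_value_near_holo (hF z)) => w -> Fw /holo_derivable dh.
  by split; [|apply: near_eq_derivable dh; apply: filterS Fw => y /finE].
case Fz : (F z) (hF z) => [u|] [H [hH Hz hE]].
  apply: near_eq_derivable (holo_derivable hH).
  apply: dnear_near; first by rewrite Hz /finite_part Fz.
  by apply: filterS2 hE (FE z) => w <- /finE.
move=> M M0; have ME : (complex.Re M)%:C = M by apply: RRe_real; exact: gtr0_real.
have m0 : 0 < complex.Re M by rewrite -ltr_of_real ME rmorph0.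
have /(@cvgcP _ _ (nbhs z))/(_ (complex.Re M)^-1) : {for z, continuous H} := holo_continuous hH.
rewrite invr_gt0 Hz => /(_ m0) /near_dnear small.
apply: filterS3 small hE (FE z) => w + [Hw hwE] /finE ->.
rewrite subr0 hwE -ME normrE ltr_of_real normcV -[X in _ -> X < _]invrK.
by rewrite ltf_pV2 ?posrE ?invr_gt0 ?normc_gt0.
Qed.

Lemma meromorphic_near_eq f g z : meromorphic f -> meromorphic g ->
  (\forall w \near z^', finite_part f w = finite_part g w) -> f z = g z.
Proof.
move=> mf mg fg; apply: germ_value_unique (meromorphic_germ_value z mg).
exact: near_eq_germ_value fg (meromorphic_germ_value z mf).
Qed.

(* The set of points near which [f = g] is open and closed. *)
Lemma identity_theorem f g z0 : meromorphic f -> meromorphic g ->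
  (\forall w \near z0^', finite_part f w = finite_part g w) -> forall z, f z = g z.
Proof.
move=> mf mg fg0 z1; pose d w := finite_part f w - finite_part g w.
pose S z := \forall w \near z^', d w = 0.
have md z : mero d z.
  have mNg := meroM (holo_mero (holo_cst (-1) z)) (meromorphic_mero z mg).
  apply: near_eq_mero (meroD (meromorphic_mero z mf) mNg).
  by apply: filterS filterT => w _; rewrite mulN1r.
have openS : open S.
  rewrite openE => z Sz; apply: dnear_near; first by [].
  by apply: filterS (dnear_join Sz) => w /near_dnear.
have openNS : open (~` S).
  rewrite openE => z NSz; apply: dnear_near; first by [].
  have [//|d0] := mero_eq0 (md z).
  apply: filterS (dnear_join d0) => w /near_dnear dw Sw.
  by have [v [/eqP]] := filter_ex (filterI dw Sw).
pose line t := z0 + t%:C * (z1 - z0).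
have cline : continuous line by move=> t; exact: curve_der_continuous (curve_der_line _ _ _).
have /connected_intervalP conn : is_interval [set: R] by [].
have : line @^-1` S = [set: R].
  apply: conn.
  - exists 0; rewrite /line /= rmorph0 mul0r addr0.
    by apply: filterS fg0 => w; rewrite /d => ->; rewrite subrr.
  - by exists (line @^-1` S); [apply: open_comp openS => t _; exact: cline|rewrite setTI].
  - exists (line @^-1` S); last by rewrite setTI.
    rewrite -openC -[~` _]/(line @^-1` (~` S)); apply: open_comp openNS => t _; exact: cline.
move=> /seteqP[_ /(_ 1 I)]; rewrite /line /= rmorph1 mul1r addrC subrK => Sz1.
by apply: meromorphic_near_eq; [| |apply: filterS Sz1 => w /eqP; rewrite subr_eq0 => /eqP].
Qed.

End MeromorphicFunctions.

(** * Laplacian *)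

Section SecondDerivative.
Context {R : realType}.
Implicit Types (f g phi : R -> R) (s t c : R).

Definition is_derive2 f t (d1 d2 : R) := exists f1 : R -> R,
  [/\ \forall s \near t, is_derive (s : R) 1 f (f1 s), f1 t = d1 & is_derive t 1 f1 d2].

Lemma is_derive2_near_eq f g t (d1 d2 : R) : (\forall s \near t, f s = g s) ->
  is_derive2 f t d1 d2 -> is_derive2 g t d1 d2.
Proof.
move=> /near_join fg [f1 [df f1t df1]]; exists f1; split=> //.
by apply: filterS2 fg df => s; exact: near_eq_is_derive.
Qed.

Lemma is_derive2_eq f t (d1 d2 e1 e2 : R) : is_derive2 f t d1 d2 -> d1 = e1 -> d2 = e2 ->
  is_derive2 f t e1 e2.
Proof. by move=> df <- <-. Qed.

Lemma is_derive2_cst c t : is_derive2 (fun=> c) t 0 0.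
Proof.
exists (fun=> 0); split=> //; first by apply: filterS filterT => s _; exact: is_derive_cst.
exact: is_derive_cst.
Qed.

Lemma is_derive2D f g t (d1 d2 e1 e2 : R) : is_derive2 f t d1 d2 -> is_derive2 g t e1 e2 ->
  is_derive2 (fun s => f s + g s) t (d1 + e1) (d2 + e2).
Proof.
move=> [f1 [df <- df1]] [g1 [dg <- dg1]]; exists (fun s => f1 s + g1 s); split=> //.
  by apply: filterS2 df dg => s; exact: is_deriveD.
exact: is_deriveD.
Qed.

Lemma is_derive2Z f t c (d1 d2 : R) : is_derive2 f t d1 d2 ->
  is_derive2 (fun s => c * f s) t (c * d1) (c * d2).
Proof.
move=> [f1 [df <- df1]]; exists (fun s => c * f1 s); split=> //.
  by apply: filterS df => s; exact: is_derive_scale.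
exact: is_derive_scale.
Qed.

Lemma is_derive2_comp phi f t (d1 d2 e1 e2 : R) :
  is_derive2 phi (f t) e1 e2 -> is_derive2 f t d1 d2 ->
  is_derive2 (phi \o f) t (e1 * d1) (e2 * d1 ^+ 2 + e1 * d2).
Proof.
move=> [p [dphi <- dp]] [f1 [df <- df1]].
have dft : is_derive t 1 f (f1 t) := nbhs_singleton df.
have cf : {for t, continuous f} by case: dft => /derivable_continuous.
exists (fun s => p (f s) * f1 s); split=> //.
  have near_dphi : \forall s \near t, is_derive (f s) 1 phi (p (f s)) by exact: cf dphi.
  by apply: filterS2 near_dphi df => s; exact: is_derive_comp.
apply: is_derive_eq (is_derive_mul (is_derive_comp dp dft) df1) _.
by rewrite expr2 mulrA.
Qed.

Lemma is_derive2_affine (a b : R) t : is_derive2 (fun s => a + b * s) t b 0.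
Proof.
exists (fun=> b); split=> //; last exact: is_derive_cst.
apply: filterS filterT => s _; have dbs := is_derive_scale b (is_derive_id s 1).
by apply: is_derive_eq (is_deriveD (is_derive_cst a s 1) dbs) _; rewrite mulr1 add0r.
Qed.

Lemma is_derive2_sqr t : is_derive2 (fun s => s ^+ 2) t (2 * t) 2.
Proof.
exists (fun s => 2 * s); split=> //.
  apply: filterS filterT => s _; apply: is_derive_eq (is_derive_exp 2 (is_derive_id s 1)) _.
  by rewrite mulr1 expr1.
by apply: is_derive_eq (is_derive_scale 2 (is_derive_id t 1)) _; rewrite mulr1.
Qed.

Lemma is_derive2_ln t : 0 < t -> is_derive2 (@ln R) t t^-1 (- t^-1 ^+ 2).
Proof.
move=> t0; exists (fun s => s^-1); split=> //.
  by near=> s; apply: is_derive1_ln; near: s; exact: lt_nbhsr.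
apply: is_derive_eq (is_derive_inv (f := id) (lt0r_neq0 t0) (is_derive_id t 1)) _.
by rewrite mulN1r exprVn.
Unshelve. all: by end_near.
Qed.

Lemma is_derive2_sqrt t : 0 < t ->
  is_derive2 (@Num.sqrt R) t (2 * Num.sqrt t)^-1 (- (4 * Num.sqrt t ^+ 3)^-1).
Proof.
move=> t0; have q0 : Num.sqrt t != 0 by rewrite gt_eqF// sqrtr_gt0.
exists (fun s => (2 * Num.sqrt s)^-1); split=> //.
  by near=> s; apply: is_derive1_sqrt; near: s; exact: lt_nbhsr.
have q20 : 2 * Num.sqrt t != 0 by rewrite mulf_neq0// pnatr_eq0.
apply: is_derive_eq (is_derive_inv (f := fun s => 2 * Num.sqrt s) q20
  (is_derive_scale 2 (is_derive1_sqrt t0))) _.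
by field.
Unshelve. all: by end_near.
Qed.

Lemma is_derive2_max f t (d1 d2 : R) : (\forall s \near t, f s <= f t) ->
  is_derive2 f t d1 d2 -> d2 <= 0.
Proof.
move=> fmax [f1 [df _ df1]]; rewrite leNgt; apply/negP => d20.
have /is_derive_caratheodory[slope [f1E cslope slopet]] := df1.
have slope0 : \forall s \near t, 0 < slope s.
  by apply: (@cvgr_gt _ _ (nbhs t) _ slope d2) => //; rewrite -slopet.
have /nbhs_ballP[e /= e0 near_t] :
  \forall s \near t, f s <= f t /\ is_derive s 1 f (f1 s) /\ 0 < slope s.
  by apply: filterS3 fmax df slope0.
have in_ball s : s \in `]t - e, t + e[%R -> ball t e s.
  by rewrite in_itv /= /ball /= ltr_distlC.
have f1t0 : f1 t = 0.
  have dft : is_derive t 1 f (f1 t) := nbhs_singleton df.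
  suff : is_derive t 1 f 0 by case: dft => _ <- [_ <-].
  apply: (@derive1_at_max R f (t - e) (t + e)); first by lra.
  - by move=> s /in_ball/near_t[_ [[]]].
  - by rewrite in_itv /=; lra.
  - by move=> s /in_ball/near_t[].
pose u := t + e / 2.
have tu_near s : s \in `[t, u]%R -> ball t e s.
  by rewrite in_itv /= /u /ball /= ltr_distlC => /andP[]; lra.
have [|||v tvu fuE] := @MVT R f f1 t u; first by rewrite /u; lra.
- by move=> s /subset_itv_oo_cc/tu_near/near_t[_ []].
- by apply: derivable_within_continuous => s /tu_near/near_t[_ [[]]].
have [_ [_ slopev]] := near_t v (tu_near v (subset_itv_oo_cc tvu)).
have fu : f u <= f t by have [] := near_t u; first by apply: tu_near; rewrite in_itv /= /u; lra.
move: tvu; rewrite in_itv /= => /andP[tv vu].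
have : 0 < f1 v * (u - t)
  by have := f1E v; rewrite f1t0 subr0 => ->; rewrite !mulr_gt0 ?subr_gt0// (lt_trans tv).
by rewrite -fuE; lra.
Qed.

End SecondDerivative.

Section Laplacian.
Context {R : realType}.
Local Notation C := (Cplx R).
Implicit Types (z w v : C) (f : C -> C) (V W : C -> R) (phi : R -> R) (L M t r : R).

Definition is_laplacian V z L := exists a1 a2 b1 b2 : R,
  [/\ is_derive2 (fun t => V (z + t%:C * 1)) 0 a1 a2,
      is_derive2 (fun t => V (z + t%:C * Complex 0 1)) 0 b1 b2 & L = a2 + b2].

Lemma is_laplacianD V W z L M : is_laplacian V z L -> is_laplacian W z M ->
  is_laplacian (fun w => V w + W w) z (L + M).
Proof.
move=> [a1 [a2 [b1 [b2 [Va Vb ->]]]]] [c1 [c2 [e1 [e2 [Wc We ->]]]]].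
exists (a1 + c1), (a2 + c2), (b1 + e1), (b2 + e2).
by split; [exact: is_derive2D|exact: is_derive2D|ring].
Qed.

Lemma is_laplacianZ V z L r : is_laplacian V z L -> is_laplacian (fun w => r * V w) z (r * L).
Proof.
move=> [a1 [a2 [b1 [b2 [Va Vb ->]]]]]; exists (r * a1), (r * a2), (r * b1), (r * b2).
by split; [exact: is_derive2Z|exact: is_derive2Z|ring].
Qed.

Lemma is_laplacian_cst (c : R) z : is_laplacian (fun=> c) z 0.
Proof.
by exists 0, 0, 0, 0; split; [exact: is_derive2_cst|exact: is_derive2_cst|rewrite addr0].
Qed.

Lemma is_laplacian_sum (I : eqType) (s : seq I) (V : I -> C -> R) (L : I -> R) z :
  (forall i, i \in s -> is_laplacian (V i) z (L i)) ->
  is_laplacian (fun w => \sum_(i <- s) V i w) z (\sum_(i <- s) L i).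
Proof.
elim: s => [|i s IH] VL.
  rewrite big_nil (_ : (fun w => _) = fun=> 0); first exact: is_laplacian_cst.
  by apply: funext => w; rewrite big_nil.
rewrite big_cons (_ : (fun w => _) = fun w => V i w + \sum_(j <- s) V j w).
  apply: is_laplacianD; first by apply: VL; rewrite mem_head.
  by apply: IH => j js; apply: VL; rewrite inE js orbT.
by apply: funext => w; rewrite big_cons.
Qed.

Lemma continuous_line z v t : {for t, continuous (fun s : R => z + s%:C * v)}.
Proof. exact: curve_der_continuous (curve_der_line z v t). Qed.

Lemma is_laplacian_near_eq V W z L : (\forall w \near z, V w = W w) ->
  is_laplacian V z L -> is_laplacian W z L.
Proof.
move=> VW [a1 [a2 [b1 [b2 [Va Vb ->]]]]]; exists a1, a2, b1, b2.
have along v : \forall t \near (0 : R), V (z + t%:C * v) = W (z + t%:C * v).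
  have cl : {for 0, continuous (fun t : R => z + t%:C * v)} by exact: continuous_line.
  by apply: (cl (fun w => V w = W w)); rewrite rmorph0 mul0r addr0.
by split; [exact: is_derive2_near_eq (along _) Va|exact: is_derive2_near_eq (along _) Vb|].
Qed.

Lemma is_laplacian_max V z L : (\forall w \near z, V w <= V z) -> is_laplacian V z L -> L <= 0.
Proof.
move=> Vmax [a1 [a2 [b1 [b2 [Va Vb ->]]]]].
have max_line v : \forall t \near (0 : R), V (z + t%:C * v) <= V (z + 0%:C * v).
  rewrite rmorph0 mul0r addr0.
  have cl : {for 0, continuous (fun t : R => z + t%:C * v)} by exact: continuous_line.
  by apply: (cl (fun w => V w <= V z)); rewrite rmorph0 mul0r addr0.
by have := is_derive2_max (max_line _) Va; have := is_derive2_max (max_line _) Vb; lra.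
Qed.

Lemma is_derive2_line f z v : holo f z ->
  is_derive2 (fun t => complex.Re (f (z + t%:C * v))) 0
    (complex.Re (derive1 f z * v)) (complex.Re (derive1 (derive1 f) z * v * v)) /\
  is_derive2 (fun t => complex.Im (f (z + t%:C * v))) 0
    (complex.Im (derive1 f z * v)) (complex.Im (derive1 (derive1 f) z * v * v)).
Proof.
move=> hf; pose line (t : R) := z + t%:C * v.
have line0 : line 0 = z by rewrite /line rmorph0 mul0r addr0.
have dline g (t : R) : derivable g (line t) 1 -> curve_der (g \o line) t (derive1 g (line t) * v).
  by move=> /derivable_is_derive dg; exact: curve_der_comp dg (curve_der_line z v t).
have near_df : \forall t \near (0 : R), derivable f (line t) 1.
  have cl : {for 0, continuous line} by exact: continuous_line.
  by apply: (cl (fun w => derivable f w 1)); rewrite line0.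
have d2 : curve_der (fun t => derive1 f (line t) * v) 0 (derive1 (derive1 f) z * v * v).
  have df' : derivable (derive1 f) (line 0) 1.
    by rewrite line0; exact: holo_derivable (holo_derive1 hf).
  have := curve_derZ v (dline (derive1 f) 0 df'); rewrite line0 mulrC.
  by congr curve_der; apply: funext => t; rewrite /= mulrC.
split.
  exists (fun t => complex.Re (derive1 f (line t) * v)).
  split; [|by rewrite line0|exact: curve_der_Re d2].
  by apply: filterS near_df => t /dline; exact: curve_der_Re.
exists (fun t => complex.Im (derive1 f (line t) * v)).
split; [|by rewrite line0|exact: curve_der_Im d2].
by apply: filterS near_df => t /dline; exact: curve_der_Im.
Qed.

Lemma is_derive2_sqr_normc f z v : holo f z ->
  is_derive2 (fun t => normc (f (z + t%:C * v)) ^+ 2) 0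
    (2 * complex.Re (derive1 f z * v * (f z)^*%C))
    (2 * (normc (derive1 f z * v) ^+ 2 + complex.Re (derive1 (derive1 f) z * v * v * (f z)^*%C))).
Proof.
move=> hf; have [dRe dIm] := is_derive2_line v hf.
have line0 : z + 0%:C * v = z by rewrite rmorph0 mul0r addr0.
have dsqr := is_derive2D (is_derive2_comp (is_derive2_sqr _) dRe)
  (is_derive2_comp (is_derive2_sqr _) dIm).
have sqrE (t : R) : normc (f (z + t%:C * v)) ^+ 2 =
    complex.Re (f (z + t%:C * v)) ^+ 2 + complex.Im (f (z + t%:C * v)) ^+ 2 := sqr_normcE _.
apply: is_derive2_eq (is_derive2_near_eq (filterS (fun t _ => esym (sqrE t)) filterT) dsqr) _ _.
  by rewrite line0; move: (derive1 f z * v) (f z) => [x y] [x' y'] /=; ring.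
rewrite line0 sqr_normcE.
by move: (derive1 f z * v) (derive1 (derive1 f) z * v * v) (f z) => [x y] [x' y'] [x'' y''] /=;
  ring.
Qed.

Lemma is_laplacian_sqr_normc phi f z (d1 d2 : R) : holo f z ->
  is_derive2 phi (normc (f z) ^+ 2) d1 d2 ->
  is_laplacian (fun w => phi (normc (f w) ^+ 2)) z
    (4 * normc (derive1 f z) ^+ 2 * (d1 + normc (f z) ^+ 2 * d2)).
Proof.
move=> hf dphi; have {}dphi v : is_derive2 phi (normc (f (z + 0%:C * v)) ^+ 2) d1 d2.
  by rewrite rmorph0 mul0r addr0.
have along v := is_derive2_comp (f := fun t => normc (f (z + t%:C * v)) ^+ 2) (dphi v)
  (is_derive2_sqr_normc v hf).
do 4!eexists; split; [exact: along|exact: along|].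
move: (derive1 f z) (derive1 (derive1 f) z) (f z) => f1 f2 f0 {along dphi}; rewrite !mulr1.
set i : C := Complex 0 1; have f1i : normc (f1 * i) ^+ 2 = normc f1 ^+ 2.
  by rewrite sqr_normcE [normc f1 ^+ 2]sqr_normcE; case: f1 => x y /=; ring.
have dot : complex.Re (f1 * f0^*%C) ^+ 2 + complex.Re (f1 * i * f0^*%C) ^+ 2 =
    normc f1 ^+ 2 * normc f0 ^+ 2.
  rewrite (sqr_normcE f1) (sqr_normcE f0).
  by case: f1 f0 {f1i} => [x y] [x' y'] /=; ring.
have f2ii : complex.Re (f2 * i * i * f0^*%C) = - complex.Re (f2 * f0^*%C).
  by case: f2 f0 {dot} => [x y] [x' y'] /=; ring.
rewrite f1i f2ii; transitivity (4 * d1 * normc f1 ^+ 2 + 4 * d2 * (normc f1 ^+ 2 * normc f0 ^+ 2)).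
  by ring.
by rewrite -dot; ring.
Qed.

Lemma is_laplacian_ln_normc f z : holo f z -> f z != 0 ->
  is_laplacian (fun w => ln (normc (f w))) z 0.
Proof.
move=> hf fz0; have n0 : 0 < normc (f z) ^+ 2 by rewrite exprn_gt0 ?normc_gt0.
have lnE w : 2^-1 * ln (normc (f w) ^+ 2) = ln (normc (f w)).
  have [->|w0] := eqVneq (normc (f w)) 0; first by rewrite expr0n /= ln0// mulr0.
  by rewrite lnXn ?lt_def ?w0 ?normc_ge0// -[ln _ *+ 2]mulr_natl mulKf// pnatr_eq0.
have := is_laplacian_sqr_normc hf (is_derive2Z 2^-1 (is_derive2_ln n0)).
rewrite [_ * (_ + _)](_ : _ = 0); last by field; rewrite -normc_eq0 in fz0.
by apply: is_laplacian_near_eq; apply: filterS filterT => w _.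
Qed.

Lemma is_laplacian_ln_1_normc f z : holo f z -> f z != 0 ->
  is_laplacian (fun w => ln (1 + normc (f w))) z
    (normc (derive1 f z) ^+ 2 / (normc (f z) * (1 + normc (f z)) ^+ 2)).
Proof.
move=> hf fz0; have n0 : 0 < normc (f z) by rewrite normc_gt0.
have sqrt_sqr w : Num.sqrt (normc (f w) ^+ 2) = normc (f w).
  by rewrite sqrtr_sqr ger0_norm ?normc_ge0.
have n20 : 0 < normc (f z) ^+ 2 by rewrite exprn_gt0.
have d1sqrt := is_derive2D (is_derive2_cst 1 _) (is_derive2_sqrt n20).
have pos : 0 < 1 + Num.sqrt (normc (f z) ^+ 2) by rewrite sqrt_sqr addr_gt0.
have dphi := is_derive2_comp (f := fun t => 1 + Num.sqrt t) (is_derive2_ln pos) d1sqrt.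
have := is_laplacian_sqr_normc hf dphi.
rewrite sqrt_sqr [_ * (_ + _)](_ : _ =
  normc (derive1 f z) ^+ 2 / (normc (f z) * (1 + normc (f z)) ^+ 2)).
  by apply: is_laplacian_near_eq; apply: filterS filterT => w _; rewrite /= sqrt_sqr.
by field; rewrite !gt_eqF ?addr_gt0.
Qed.

Lemma is_laplacian_ln_disc z r : normc z < r ->
  is_laplacian (fun w => ln (r ^+ 2 - normc w ^+ 2)) z
    (- (4 * r ^+ 2 / (r ^+ 2 - normc z ^+ 2) ^+ 2)).
Proof.
move=> zr; have X0 : 0 < r ^+ 2 + -1 * normc z ^+ 2 by rewrite mulN1r sqr_normc_lt.
have dphi := is_derive2_comp (f := fun t => r ^+ 2 + -1 * t) (is_derive2_ln X0)
  (is_derive2_affine (r ^+ 2) (-1) _).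
have := is_laplacian_sqr_normc (holo_id z) dphi.
rewrite [_ * (_ + _)](_ : _ = - (4 * r ^+ 2 / (r ^+ 2 - normc z ^+ 2) ^+ 2)).
  by apply: is_laplacian_near_eq; apply: filterS filterT => w _ /=; rewrite mulN1r.
rewrite (derive1_val (is_derive_id z 1)) normc1; move: X0; rewrite mulN1r => X0.
by field; rewrite gt_eqF.
Qed.

End Laplacian.

(** * Ahlfors' lemma *)

Lemma near_all_in (I : eqType) (T : Type) (F : set_system T) (s : seq I) (P : I -> T -> Prop) :
  Filter F -> (forall i, i \in s -> \forall x \near F, P i x) ->
  \forall x \near F, forall i, i \in s -> P i x.
Proof.
move=> FF; elim: s => [|i s IH] Ps; first by apply: filterS filterT.
have near_s : \forall x \near F, forall j, j \in s -> P j x.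
  by apply: IH => j js; apply: Ps; rewrite inE js orbT.
apply: filterS2 (Ps i (mem_head i s)) near_s => x Pi Psx j.
by rewrite inE => /predU1P[->|/Psx].
Qed.

Lemma seq_argmin (R : realDomainType) (I : eqType) (f : I -> R) (s : seq I) : s != [::] ->
  exists2 i, i \in s & forall j, j \in s -> f i <= f j.
Proof.
elim: s => // i [|j s] IH _; first by exists i; rewrite ?mem_head// => k; rewrite inE => /eqP->.
have [//|k ks kmin] := IH; have [ik|/ltW ki] := leP (f i) (f k).
  exists i; rewrite ?mem_head// => l; rewrite inE => /predU1P[->//|/kmin].
  exact: le_trans.
exists k; first by rewrite inE ks orbT.
by move=> l; rewrite inE => /predU1P[->//|/kmin].
Qed.

Section Curvature.
Context {R : realType}.
Local Notation C := (Cplx R).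
Implicit Types (w a b : C) (s : seq C) (d rho r : R) (q : nat).

Definition weight_factor q r : R := (1 + r) ^+ (q - 4) / r ^+ q.

(* With q = size s, [weight s] is the q-th power of the coefficient of |dw|^2 in the metric
   prod_(a <- s) ((1 + |w - a|)^((q - 4) / q) / |w - a|) |dw|^2. *)
Definition weight s w : R := \prod_(a <- s) weight_factor (size s) (normc (w - a)).

Definition curvature s w : R := \sum_(a <- s) (normc (w - a) * (1 + normc (w - a)) ^+ 2)^-1.

Lemma curvature_ge0 s w : 0 <= curvature s w.
Proof.
by apply: sumr_ge0 => a _; rewrite invr_ge0 mulr_ge0 ?sqr_ge0 ?normc_ge0.
Qed.

Lemma weight_factor_ge0 q r : 0 <= r -> 0 <= weight_factor q r.
Proof. by move=> r0; rewrite divr_ge0 ?exprn_ge0 ?addr_ge0. Qed.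

Lemma weight_ge0 s w : 0 <= weight s w.
Proof. by apply: prodr_ge0 => a _; rewrite weight_factor_ge0 ?normc_ge0. Qed.

Lemma weight_factor_gt0 q r : 0 < r -> 0 < weight_factor q r.
Proof. by move=> r0; rewrite divr_gt0 ?exprn_gt0 ?addr_gt0. Qed.

Lemma dist_notin_gt0 s w a : w \notin s -> a \in s -> 0 < normc (w - a).
Proof. by move=> ws sa; rewrite normc_gt0 subr_eq0; apply: contraNneq ws => ->. Qed.

Lemma weight_gt0 s w : w \notin s -> 0 < weight s w.
Proof.
move=> ws; rewrite /weight big_seq; apply: prodr_gt0 => a sa.
exact: weight_factor_gt0 (dist_notin_gt0 ws sa).
Qed.

Lemma separation s : exists2 d : R, 0 < d &
  forall a b, a \in s -> b \in s -> a != b -> 2 * d <= normc (a - b).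
Proof.
have : \forall d \near (0 : R)^'+, forall a, a \in s -> forall b, b \in s ->
    a != b -> 2 * d <= normc (a - b).
  apply: near_all_in => a _; apply: near_all_in => b _.
  have [->|ab] := eqVneq a b; first by apply: filterS filterT.
  have ab0 : 0 < normc (a - b) / 2 by rewrite divr_gt0// normc_gt0 subr_eq0.
  by apply: filterS (nbhs_right_lt ab0) => d dab _; lra.
move=> sep; have [d [d0 dsep]] := @filter_ex _ _ _ _ (filterI (nbhs_right_gt (0 : R)) sep).
by exists d => // a b sa sb; exact: dsep.
Qed.

Lemma le_weight_factor q d rho r : (3 < q)%N -> 0 < d -> 0 <= rho -> d <= r -> rho <= r ->
  weight_factor q r <= ((1 + d) / d) ^+ q / (1 + rho) ^+ 4.
Proof.
move=> q3 d0 rho0 dr rhor; have r0 : 0 < r := lt_le_trans d0 dr.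
rewrite /weight_factor (_ : _ / _ = ((1 + r) / r) ^+ q / (1 + r) ^+ 4); last first.
  rewrite expr_div_n -{3}(subnK q3) exprD; field.
  by rewrite !expf_neq0// gt_eqF// addr_gt0.
apply: ler_pM; rewrite ?exprn_ge0 ?invr_ge0 ?exprn_ge0 ?divr_ge0 ?(ltW r0)//; try lra.
  rewrite lerXn2r ?nnegrE ?divr_ge0 ?(ltW r0) ?(ltW d0)//; try lra.
  by rewrite ler_pdivrMr// mulrAC ler_pdivlMr//; nra.
by rewrite lef_pV2 ?posrE ?exprn_gt0 ?lerXn2r ?nnegrE//; lra.
Qed.

Lemma weight_le_nearest s d w a : uniq s -> (3 < size s)%N -> 0 < d -> a \in s ->
  (forall b, b \in s -> b != a -> 2 * d <= normc (b - a)) ->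
  (forall b, b \in s -> normc (w - a) <= normc (w - b)) ->
  weight s w <= weight_factor (size s) (normc (w - a)) *
    (((1 + d) / d) ^+ size s / (1 + normc (w - a)) ^+ 4) ^+ (size s).-1.
Proof.
move=> us q3 d0 sa sep amin; rewrite /weight (big_rem a)//=.
apply: ler_wpM2l; first by rewrite weight_factor_ge0 ?normc_ge0.
rewrite -(size_rem sa) -(iter_mulr_1 (size (rem a s))) -(count_predT (rem a s)).
rewrite -(big_const_seq _ _ _ xpredT) [leLHS]big_seq [leRHS]big_seq; apply: ler_prod => b.
rewrite mem_rem_uniq// inE => /andP[ba sb]; rewrite weight_factor_ge0 ?normc_ge0//=.
apply: le_weight_factor; [exact: q3|exact: d0|exact: normc_ge0| |exact: amin].
have := sep b sb ba; have := amin b sb; have := ler_distcD w b a.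
by rewrite (distcC b w); lra.
Qed.

Lemma curvature_bound s : uniq s -> (3 < size s)%N -> exists2 c : R, 0 < c &
  forall w, w \notin s -> c * weight s w <= curvature s w ^+ size s.
Proof.
move=> us q3; have [d d0 dsep] := separation s.
pose K := ((1 + d) / d) ^+ size s ^+ (size s).-1.
have K0 : 0 < K by rewrite !exprn_gt0// divr_gt0//; lra.
exists K^-1 => [|w ws]; first by rewrite invr_gt0.
have s0 : s != [::] by rewrite -size_eq0 -lt0n (leq_trans _ q3).
have [a sa amin] := seq_argmin (fun a => normc (w - a)) s0.
have := weight_le_nearest us q3 d0 sa (fun b sb => dsep b a sb sa) amin.
have rho0 := dist_notin_gt0 ws sa; set q := size s; set rho := normc (w - a) in rho0 *.
have curv_ge : (rho * (1 + rho) ^+ 2)^-1 <= curvature s w.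
  rewrite /curvature (big_rem a)//= lerDl sumr_ge0// => b _.
  by rewrite invr_ge0 mulr_ge0 ?sqr_ge0 ?normc_ge0.
have p0 : 0 < 1 + rho by lra.
rewrite ler_pdivrMl// => /le_trans; apply.
apply: (@le_trans _ _ (K * (rho * (1 + rho) ^+ 2)^-1 ^+ q)); last first.
  by rewrite ler_pM2l// lerXn2r ?nnegrE ?curvature_ge0// invr_ge0 mulr_ge0 ?sqr_ge0 ?ltW.
have -> : (rho * (1 + rho) ^+ 2)^-1 ^+ q = ((1 + rho) ^+ (2 * q))^-1 / rho ^+ q.
  by rewrite exprVn exprMn exprM invfM mulrC.
rewrite [X in _ * X]expr_div_n -/K mulrCA ler_pM2l// mulrAC ler_pM2r ?invr_gt0 ?exprn_gt0//.
rewrite ler_pdivrMr ?exprn_gt0// mulrC ler_pdivlMr ?exprn_gt0// -exprM -exprD.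
by apply: ler_weXn2l; [lra|rewrite -/q in q3; lia].
Qed.

End Curvature.

Section Density.
Context {R : realType}.
Local Notation C := (Cplx R).
Implicit Types (h P : C -> C) (z w : C) (s : seq C) (r c : R) (k q : nat).

Definition density h s z : R := normc (derive1 h z) ^+ (2 * size s) * weight s (h z).

Lemma density_ge0 h s z : 0 <= density h s z.
Proof. by rewrite mulr_ge0 ?exprn_ge0 ?normc_ge0 ?weight_ge0. Qed.

Lemma density_gt0 h s z : h z \notin s -> derive1 h z != 0 -> 0 < density h s z.
Proof. by move=> hs h'0; rewrite mulr_gt0 ?weight_gt0// exprn_gt0// normc_gt0. Qed.

Lemma near_notin s w : w \notin s -> \forall v \near w, v \notin s.
Proof.
move=> ws; have : \forall v \near w, forall a, a \in s -> v != a.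
  apply: (@near_all_in _ _ (nbhs w)) => a sa; have wa : w != a by apply: contraNneq ws => ->.
  exact: near_neq wa.
by apply: filterS => v vs; apply/negP => /vs/eqP.
Qed.

Lemma continuous_normcB (f : C -> C) a z : {for z, continuous f} ->
  {for z, continuous (fun w => normc (f w - a))}.
Proof.
move=> cf; have cfa := continuousB cf (@cst_continuous C C a z).
exact: (continuous_comp cfa (@continuous_normc R _)).
Qed.

Lemma continuous_weight_factor q a w : w != a ->
  {for w, continuous (fun v => weight_factor q (normc (v - a)))}.
Proof.
move=> wa; have c_dist : {for w, continuous (fun v => normc (v - a))}.
  by apply: continuous_normcB; exact: cvg_id.
have c_num : {for w, continuous (fun v => 1 + normc (v - a))}.
  exact (continuousD (@cst_continuous C R 1 w) c_dist).
apply: continuousM; first exact: continuousX.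
by apply: continuousV; [rewrite expf_neq0// normc_eq0 subr_eq0|exact: continuousX].
Qed.

Lemma continuous_weight s w : w \notin s -> {for w, continuous (weight s)}.
Proof.
move=> ws; apply: continuous_prod => a sa; apply: continuous_weight_factor.
by apply: contraNneq ws => ->.
Qed.

Lemma continuous_density h s z : holo h z -> h z \notin s -> {for z, continuous (density h s)}.
Proof.
move=> hh hz; apply: continuousM.
  apply: continuousX.
  exact (continuous_comp (holo_continuous (holo_derive1 hh)) (@continuous_normc R _)).
exact (continuous_comp (holo_continuous hh) (continuous_weight hz)).
Qed.

Lemma ln_prod (I : eqType) (t : seq I) (F : I -> R) : (forall i, i \in t -> 0 < F i) ->
  ln (\prod_(i <- t) F i) = \sum_(i <- t) ln (F i).
Proof.
elim: t => [|i t IH] F0; first by rewrite !big_nil ln1.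
have Ft0 : forall j, j \in t -> 0 < F j by move=> j jt; rewrite F0// inE jt orbT.
rewrite !big_cons lnM ?posrE ?F0 ?mem_head ?IH//.
by rewrite big_seq; exact: prodr_gt0.
Qed.

Lemma is_laplacian_ln_weight_factor h q a z : holo h z -> h z != a ->
  is_laplacian (fun w => ln (weight_factor q (normc (h w - a)))) z ((q - 4)%:R *
    (normc (derive1 h z) ^+ 2 * (normc (h z - a) * (1 + normc (h z - a)) ^+ 2)^-1)).
Proof.
move=> hh hza; have hd : holo (fun w => h w - a) z := holoB hh (holo_cst a z).
have d0 : h z - a != 0 by rewrite subr_eq0.
have near_ln : \forall w \near z, (q - 4)%:R * ln (1 + normc (h w - a)) +
    - q%:R * ln (normc (h w - a)) = ln (weight_factor q (normc (h w - a))).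
  apply: filterS (near_neq0 (holo_continuous hd) d0) => w; rewrite -normc_gt0 => r0.
  rewrite lnM ?posrE ?invr_gt0 ?exprn_gt0 ?addr_gt0// lnV ?posrE ?exprn_gt0//.
  by rewrite !lnXn ?addr_gt0// mulNr !mulr_natl.
apply: is_laplacian_near_eq near_ln _; rewrite -(derive1_subr a (holo_derivable hh)).
rewrite -[_%:R * _]addr0 -[X in _ + X](mulr0 (- q%:R)).
apply: is_laplacianD; apply: is_laplacianZ; first exact: (is_laplacian_ln_1_normc hd d0).
exact: (is_laplacian_ln_normc hd d0).
Qed.

Lemma is_laplacian_ln_density h s z : holo h z -> h z \notin s -> derive1 h z != 0 ->
  is_laplacian (fun w => ln (density h s w)) z
    ((size s - 4)%:R * (normc (derive1 h z) ^+ 2 * curvature s (h z))).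
Proof.
move=> hh hz h'z; have hh' := holo_derive1 hh.
have near_ln : \forall w \near z, (2 * size s)%:R * ln (normc (derive1 h w)) +
    \sum_(a <- s) ln (weight_factor (size s) (normc (h w - a))) = ln (density h s w).
  have ch := holo_continuous hh; have near_hs : \forall w \near z, h w \notin s.
    by move: (near_notin hz); exact: ch.
  apply: filterS2 near_hs (near_neq0 (holo_continuous hh') h'z) => w hws h'w.
  rewrite lnM ?posrE ?exprn_gt0 ?normc_gt0 ?weight_gt0// lnXn ?normc_gt0// mulr_natl.
  by rewrite ln_prod// => a /(dist_notin_gt0 hws)/weight_factor_gt0.
apply: is_laplacian_near_eq near_ln _.
rewrite -[_%:R * _]add0r -[X in X + _](mulr0 (2 * size s)%:R) /curvature !mulr_sumr.
apply: is_laplacianD (is_laplacianZ _ (is_laplacian_ln_normc hh' h'z)) _.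
apply: is_laplacian_sum => a sa; apply: is_laplacian_ln_weight_factor hh _.
by apply: contraNneq hz => ->.
Qed.

(* Up to a constant, the density relative to the Poincare metric of the disc of radius [r]. *)
Definition rel_density h s r z : R := density h s z * (r ^+ 2 - normc z ^+ 2) ^+ (2 * size s).

Lemma rel_density_gt0 h s r z : h z \notin s -> derive1 h z != 0 -> normc z < r ->
  0 < rel_density h s r z.
Proof.
by move=> hs h'z zr; rewrite mulr_gt0 ?density_gt0// exprn_gt0// sqr_normc_lt.
Qed.

Lemma rel_density_max_curvature h P s z r k : holo h z -> h z \notin s -> derive1 h z != 0 ->
  holo P z -> P z != 0 -> normc z < r -> (0 < k)%N ->
  (\forall w \near z, rel_density h s r w ^+ k * normc (P w) ^+ 2 <=
     rel_density h s r z ^+ k * normc (P z) ^+ 2) ->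
  (size s - 4)%:R * (normc (derive1 h z) ^+ 2 * curvature s (h z)) <=
    8 * (size s)%:R * r ^+ 2 / (r ^+ 2 - normc z ^+ 2) ^+ 2.
Proof.
move=> hh hz h'z hP Pz zr k0 umax; pose u w := rel_density h s r w ^+ k * normc (P w) ^+ 2.
pose V w := k%:R * (ln (density h s w) + (2 * size s)%:R * ln (r ^+ 2 - normc w ^+ 2)) +
  2 * ln (normc (P w)).
have uV w : h w \notin s -> derive1 h w != 0 -> normc w < r -> P w != 0 ->
    0 < u w /\ ln (u w) = V w.
  move=> hws h'w wr Pw; have u0 := rel_density_gt0 hws h'w wr.
  have P0 : 0 < normc (P w) by rewrite normc_gt0.
  have d0 := density_gt0 hws h'w; have X0 := sqr_normc_lt wr.
  split; first by rewrite mulr_gt0 ?exprn_gt0.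
  rewrite lnM ?posrE ?exprn_gt0// lnXn// lnXn// lnM ?posrE ?exprn_gt0// lnXn//.
  by rewrite /V !mulr_natl.
have [uz0 lnuz] := uV z hz h'z zr Pz.
have Vmax : \forall w \near z, V w <= V z.
  have ch := holo_continuous hh; have near_hs : \forall w \near z, h w \notin s.
    by move: (near_notin hz); exact: ch.
  have near_h' := near_neq0 (holo_continuous (holo_derive1 hh)) h'z.
  have zr0 : disc 0 r z by rewrite /disc /= subr0.
  have near_P := near_neq0 (holo_continuous hP) Pz.
  apply: filterS3 (filterI near_hs near_h') (near_disc zr0) (filterI near_P umax).
  move=> w [hws h'w]; rewrite /disc /= subr0 => wr [Pw uwz].
  by have [uw0 lnuw] := uV w hws h'w wr Pw; rewrite -lnuw -lnuz ler_ln ?posrE.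
have := is_laplacian_max Vmax (is_laplacianD (is_laplacianZ k%:R (is_laplacianD
  (is_laplacian_ln_density hh hz h'z) (is_laplacianZ (2 * size s)%:R (is_laplacian_ln_disc zr))))
  (is_laplacianZ 2 (is_laplacian_ln_normc hP Pz))).
rewrite mulr0 addr0 pmulr_rle0 ?ltr0n// mulrN subr_le0; congr (_ <= _).
by rewrite natrM; ring.
Qed.

Lemma rel_density_max h P s z r c k : (4 < size s)%N -> holo h z -> h z \notin s ->
  derive1 h z != 0 -> holo P z -> P z != 0 -> normc z < r -> (0 < k)%N ->
  c * weight s (h z) <= curvature s (h z) ^+ size s ->
  (\forall w \near z, rel_density h s r w ^+ k * normc (P w) ^+ 2 <=
     rel_density h s r z ^+ k * normc (P z) ^+ 2) ->
  c * rel_density h s r z <= (8 * (size s)%:R * r ^+ 2) ^+ size s.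
Proof.
move=> q4 hh hz h'z hP Pz zr k0 curv umax.
have := rel_density_max_curvature hh hz h'z hP Pz zr k0 umax.
have := sqr_normc_lt zr; rewrite /rel_density /density.
set X := r ^+ 2 - normc z ^+ 2; set q := size s; set D := normc (derive1 h z) => X0.
set S := curvature s (h z) => DS; have S0 : 0 <= S by exact: curvature_ge0.
have DS_le : D ^+ 2 * S * X ^+ 2 <= 8 * q%:R * r ^+ 2.
  rewrite -ler_pdivlMr ?exprn_gt0//; apply: le_trans DS.
  by apply: ler_peMl; [rewrite mulr_ge0 ?sqr_ge0|rewrite ler1n subn_gt0].
have DS0 : 0 <= D ^+ 2 * S * X ^+ 2 by apply: mulr_ge0; rewrite ?sqr_ge0// mulr_ge0 ?sqr_ge0.
apply: le_trans (_ : (D ^+ 2 * S * X ^+ 2) ^+ q <= _); last first.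
  by rewrite lerXn2r ?nnegrE// (le_trans DS0).
have -> : (D ^+ 2 * S * X ^+ 2) ^+ q = D ^+ (2 * q) * X ^+ (2 * q) * S ^+ q.
  by rewrite 2!exprMn -2!exprM mulrAC.
have -> : c * (D ^+ (2 * q) * weight s (h z) * X ^+ (2 * q)) =
  D ^+ (2 * q) * X ^+ (2 * q) * (c * weight s (h z)) by ring.
by apply: ler_wpM2l curv; rewrite mulr_ge0 ?exprn_ge0 ?normc_ge0 ?ltW.
Qed.

End Density.

Section MaximumOffExceptionalSet.
Context {R : realType}.
Local Notation C := (Cplx R).
Implicit Types (u V g : C -> R) (B K : set C) (P : {poly C}) (z w : C) (r M : R) (k : nat).

Lemma compact_isolated_finite B K : compact K -> (forall z, \forall w \near z^', ~ B w) ->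
  finite_set (K `&` B).
Proof.
rewrite compact_cover => cK isoB; pose U z := [set w : C | w != z -> ~ B w]°.
have nbhsU z : U z z by exact: isoB.
have [z _|z Kz|D _ KD] := cK C K U; first exact: open_interior.
  by exists z.
apply: (sub_finite_set _ (finite_fset D)) => w [/KD[z Dz /interior_subset wz] Bw].
by have [->//|/wz] := eqVneq w z.
Qed.

Lemma continuous_near_bounded V z : {for z, continuous V} -> exists M, \forall w \near z, V w <= M.
Proof.
move=> cV; exists (V z + 1).
have /(@cvgr_lt _ _ (nbhs z)) := cV; move=> /(_ (V z + 1)); rewrite ltrDl ltr01 => /(_ isT).
by apply: filterS => w /ltW.
Qed.

Lemma continuous_squeeze0 V g z : {for z, continuous g} -> g z = 0 -> V z = 0 ->
  (\forall w \near z^', 0 <= V w <= g w) -> {for z, continuous V}.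
Proof.
move=> cg gz Vz Vg; apply/(@cvgrPdist_lt _ _ _ (nbhs z)) => e e0.
have /(@cvgrPdist_lt _ _ _ (nbhs z))/(_ e e0) : {for z, continuous g} by [].
rewrite gz Vz; have {}Vg : \forall w \near z, 0 <= V w <= g w.
  by apply: dnear_near Vg; rewrite gz Vz lexx.
apply: filterS2 Vg => w /andP[V0 Vw].
by rewrite !sub0r !normrN !ger0_norm//; [exact: le_lt_trans|exact: le_trans Vw].
Qed.

Lemma continuous_sqr_normc_horner P z : {for z, continuous (fun w => normc P.[w] ^+ 2)}.
Proof.
apply: continuousX.
exact (continuous_comp (holo_continuous (holo_horner P (holo_id z))) (@continuous_normc R _)).
Qed.

Lemma continuous_weighted u B P z k : (~ B z -> {for z, continuous u}) ->
  (B z -> P.[z] = 0 /\ exists M, \forall w \near z^', u w <= M) -> (forall w, 0 <= u w) ->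
  {for z, continuous (fun w => u w ^+ k * normc P.[w] ^+ 2)}.
Proof.
move=> cu Bu u0; have cP := @continuous_sqr_normc_horner P z.
have [/Bu[Pz [M uM]]|Bz] := pselect (B z); last first.
  exact (continuousM (continuousX (n := k) (cu Bz)) cP).
have Pz0 : normc P.[z] ^+ 2 = 0 by rewrite Pz normc0 expr0n.
apply: (@continuous_squeeze0 _ (fun w => M ^+ k * normc P.[w] ^+ 2)).
- exact (continuousM (@cst_continuous C R (M ^+ k) z) cP).
- by rewrite Pz0 mulr0.
- by rewrite Pz0 mulr0.
apply: filterS uM => w uM; rewrite mulr_ge0 ?exprn_ge0 ?normc_ge0//=.
by rewrite ler_wpM2r ?sqr_ge0// lerXn2r ?nnegrE// (le_trans (u0 w)).
Qed.

(* The polynomial [P] vanishes on the exceptional set, which moves the maximum of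
   [u ^+ k * |P|^2] away from it; letting [k] grow removes the effect of [P]. *)
Lemma max_off_exceptional u B r M : (forall z, \forall w \near z^', ~ B w) ->
  (forall w, 0 <= u w) -> (forall w, normc w = r -> u w = 0) ->
  (forall z, ~ B z -> {for z, continuous u}) ->
  (forall z, B z -> exists M', \forall w \near z^', u w <= M') -> 0 <= M ->
  (forall P z k, (0 < k)%N -> P.[z] != 0 -> normc z < r -> ~ B z -> 0 < u z ->
    (\forall w \near z, u w ^+ k * normc P.[w] ^+ 2 <= u z ^+ k * normc P.[z] ^+ 2) -> u z <= M) ->
  forall w, normc w <= r -> ~ B w -> u w <= M.
Proof.
move=> isoB u0 ur cu Bu M0 max_le w wr Bw.
have r0 : 0 <= r := le_trans (normc_ge0 w) wr.
have in_cdisc v : cdisc 0 r v = (normc v <= r) :> Prop by rewrite /cdisc /= subr0.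
have /finite_seqP[s sE] := compact_isolated_finite (@compact_cdisc R 0 r) isoB.
pose P := \prod_(p <- s) ('X - p%:P).
have rootP v : normc v <= r -> (P.[v] == 0) = `[< B v >].
  move=> vr; rewrite -[_ == _]/(root P v) root_prod_XsubC.
  have : [set` s] v = (cdisc 0 r `&` B) v by rewrite sE.
  rewrite /setI /= in_cdisc => vs; apply/idP/asboolP; first by rewrite vs => -[].
  by move=> Bv; rewrite vs.
have [z0 _ maxP] := cdisc_EVT_max r0 (fun v (_ : cdisc 0 r v) => @continuous_sqr_normc_horner P v).
set D := normc P.[z0] ^+ 2 in maxP; rewrite leNgt; apply/negP => Mu.
have uw0 : 0 < u w := le_lt_trans M0 Mu.
have Pw0 : 0 < normc P.[w] ^+ 2 by rewrite exprn_gt0// normc_gt0 rootP// asboolF.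
suff : normc P.[w] ^+ 2 <= 0 by rewrite leNgt Pw0.
apply: (@le0_geometric _ _ D (M / u w)).
  by rewrite divr_ge0 ?(ltW uw0)//= ltr_pdivrMr// mul1r.
case=> [|k]; first by rewrite expr0 mulr1; apply: maxP; rewrite in_cdisc.
have [v|z] := cdisc_EVT_max r0 (V := fun v => u v ^+ k.+1 * normc P.[v] ^+ 2) (x := 0).
  rewrite in_cdisc => vr; apply: (@continuous_weighted u B) => //; first exact: cu.
  by move=> Bv; split; [apply/eqP; rewrite rootP// asboolT|exact: Bu].
rewrite in_cdisc => zr max_z; have := max_z w; rewrite in_cdisc => /(_ wr) Vwz.
have Vz0 : 0 < u z ^+ k.+1 * normc P.[z] ^+ 2.
  by apply: lt_le_trans Vwz; apply: mulr_gt0 => //; exact: exprn_gt0.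
have Pz : P.[z] != 0 by apply: contraTneq Vz0 => ->; rewrite normc0 expr0n mulr0 ltxx.
have uz : 0 < u z.
  by rewrite lt_def u0 andbT; apply: contraTneq Vz0 => ->; rewrite expr0n mul0r ltxx.
have zr' : normc z < r.
  by rewrite lt_neqAle zr andbT; apply: contraTneq uz => /ur->; rewrite ltxx.
have Bz : ~ B z by move: Pz; rewrite rootP// => /asboolPn.
have uzM : u z <= M.
  apply: (max_le P z k.+1) => //; have zr0 : disc 0 r z by rewrite /disc /= subr0.
  by apply: filterS (near_disc zr0) => v vr; apply: max_z; exact: ltW.
rewrite expr_div_n mulrA ler_pdivlMr ?exprn_gt0// mulrC (le_trans Vwz)// [leRHS]mulrC.
apply: ler_pM; rewrite ?exprn_ge0 ?normc_ge0//; first by rewrite lerXn2r ?nnegrE.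
by apply: maxP; rewrite in_cdisc.
Qed.

End MaximumOffExceptionalSet.

Section AhlforsSchwarz.
Context {R : realType}.
Local Notation C := (Cplx R).
Implicit Types (h : C -> C) (s : seq C) (B : set C) (z w : C) (r c : R).

Lemma rel_density_bound h s B c r z : (4 < size s)%N -> 0 < c ->
  (forall w, w \notin s -> c * weight s w <= curvature s w ^+ size s) ->
  (forall z, \forall w \near z^', ~ B w) ->
  (forall z, ~ B z -> holo h z /\ h z \notin s) ->
  (forall z, B z -> exists M, \forall w \near z^', density h s w <= M) ->
  normc z <= r -> ~ B z ->
  c * rel_density h s r z <= (8 * (size s)%:R * r ^+ 2) ^+ size s.
Proof.
move=> q4 c0 curv isoB hB dB zr Bz; rewrite mulrC -ler_pdivlMr//.
pose X w : R := (r ^+ 2 - normc w ^+ 2) ^+ (2 * size s).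
have cX w : {for w, continuous X}.
  have csqr := continuousX (n := 2) (@continuous_normc R w).
  by apply: continuousX; exact: (continuousB (@cst_continuous C R (r ^+ 2) w) csqr).
have X0 w : 0 <= X w by rewrite /X mulnC exprM sqr_ge0.
have q0 : (2 * size s == 0)%N = false by rewrite muln_eq0 /= gtn_eqF// (leq_trans _ q4).
apply: (@max_off_exceptional R (rel_density h s r) B r) => //.
- by move=> w; rewrite mulr_ge0 ?density_ge0 ?X0.
- by move=> w wr; rewrite /rel_density wr subrr expr0n q0 mulr0.
- by move=> w /hB[hw ws]; exact: (continuousM (continuous_density hw ws) (cX w)).
- move=> w /dB[M dM]; have [N XN] := continuous_near_bounded (cX w).
  exists (M * N); apply: filterS2 dM (near_dnear XN) => v dv Xv.
  by apply: ler_pM; rewrite ?density_ge0 ?X0.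
- by rewrite divr_ge0 ?(ltW c0)// exprn_ge0// mulr_ge0 ?sqr_ge0// mulr_ge0.
move=> P w k k0 Pw wr Bw uw umax; have [hw ws] := hB w Bw.
have h'w : derive1 h w != 0.
  apply: contraTneq uw => h'0.
  by rewrite /rel_density /density h'0 normc0 expr0n q0 !mul0r ltxx.
rewrite ler_pdivlMr// mulrC.
exact: rel_density_max q4 hw ws h'w (holo_horner P (holo_id w)) Pw wr k0 (curv _ ws) umax.
Qed.

Lemma ahlfors_derive1_eq0 h s B : uniq s -> (4 < size s)%N ->
  (forall z, \forall w \near z^', ~ B w) ->
  (forall z, ~ B z -> holo h z /\ h z \notin s) ->
  (forall z, B z -> exists M, \forall w \near z^', density h s w <= M) ->
  forall z, ~ B z -> derive1 h z = 0.
Proof.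
move=> us q4 isoB hB dB z Bz; have [hz hzs] := hB z Bz.
have [c c0 curv] := curvature_bound us (ltnW q4).
set q := size s in q4 curv; pose rho : R := 2 * normc z + 1.
have z0 : 0 <= normc z := normc_ge0 z; have rho0 : 0 < rho by rewrite /rho; lra.
suff dz : c * density h s z <= 0.
  by apply: contraTeq dz => h'z; rewrite -ltNge mulr_gt0// density_gt0.
apply: (@le0_geometric _ _ ((32 * q%:R / rho ^+ 2) ^+ q) (4^-1 ^+ q)) => [|n].
  by rewrite exprn_ge0//= exprn_ilt1// -?lt0n ?(leq_trans _ q4)//; lra.
pose r := rho * 2 ^+ n; have r0 : 0 < r by rewrite mulr_gt0 ?exprn_gt0.
have zr : 2 * normc z <= r.
  apply: (@le_trans _ _ rho); first by rewrite /rho; lra.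
  by rewrite ler_peMr ?(ltW rho0)// exprn_ege1// ler1n.
have X_ge : r ^+ 2 / 2 <= r ^+ 2 - normc z ^+ 2 by nra.
have r2 : 0 < r ^+ 2 / 2 by rewrite divr_gt0 ?exprn_gt0.
have zr1 : normc z <= r by lra.
have bound := rel_density_bound q4 c0 curv isoB hB dB zr1 Bz.
have le_bound : c * density h s z * (r ^+ 2 / 2) ^+ (2 * q) <= (8 * q%:R * r ^+ 2) ^+ q.
  apply: le_trans bound; rewrite /rel_density mulrA.
  apply: ler_wpM2l; first by rewrite mulr_ge0 ?density_ge0// ltW.
  by rewrite lerXn2r ?nnegrE ?(ltW r2)// (le_trans (ltW r2)).
have -> : (32 * q%:R / rho ^+ 2) ^+ q * 4^-1 ^+ q ^+ n =
    (8 * q%:R * r ^+ 2) ^+ q / (r ^+ 2 / 2) ^+ (2 * q).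
  rewrite exprAC -exprMn [_ ^+ (2 * q)]exprM -expr_div_n; congr (_ ^+ q).
  have -> : (4^-1 : R) ^+ n = (2 ^+ n ^+ 2)^-1.
    by rewrite exprVn exprAC; congr (_ ^+ n)^-1; ring.
  by rewrite /r; field; rewrite expf_neq0// gt_eqF.
by rewrite ler_pdivlMr// exprn_gt0.
Qed.

End AhlforsSchwarz.

(** * Totally ramified values *)

Section DensityNearSingularities.
Context {R : realType}.
Local Notation C := (Cplx R).
Implicit Types (h H : C -> C) (s : seq C) (a z w : C).

(* At a zero of [H - a] of order k >= 2, the quotient of the two sides is |w - z|^(k - 2) times
   a continuous function. *)
Lemma sqr_derive1_le_dist H a z : holo H z -> H z = a -> derive1 H z = 0 ->
  exists N : R, \forall w \near z, normc (derive1 H w) ^+ 2 <= N * normc (H w - a).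
Proof.
move=> hH Ha H'z; have hHa : holo (fun w => H w - a) z := holoB hH (holo_cst a z).
have derive_factor k g w : derivable g w 1 -> (\forall v \near w, H v - a = (v - z) ^+ k * g v) ->
    derive1 H w = k%:R * (w - z) ^+ k.-1 * g w + (w - z) ^+ k * derive1 g w.
  move=> /derivable_is_derive dg gE; apply: derive1_val.
  have dpow := is_derive_exp k (is_derive_subr z w).
  have dH := is_deriveD (is_derive_mul dpow dg) (is_derive_cst a w 1).
  apply: near_eq_is_derive (is_derive_eq dH _); last by rewrite mulr1 addr0.
  by apply: filterS gE => v Hv; rewrite fctE /= -Hv subrK.
have [/near_join H0|[k [g [hg gz gE]]]] := zero_order hHa.
  exists 0; apply: filterS H0 => w wH.
  rewrite (derive_factor 0 (fun=> 0) w).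
    by rewrite mulr0n !mul0r add0r derive1_cst mulr0 normc0 expr0n.
    exact: holo_derivable (holo_cst 0 w).
  by apply: filterS wH => v ->; rewrite mulr0.
case: k gE => [|[|k]] gE.
- by have := nbhs_singleton gE; rewrite Ha subrr mul1r => /esym/eqP; rewrite (negbTE gz).
- have := derive_factor _ _ _ (holo_derivable hg) gE.
  by rewrite H'z subrr mul0r expr0 !mul1r addr0 => /esym/eqP; rewrite (negbTE gz).
pose v w := k.+2%:R * g w + (w - z) * derive1 g w.
have hid : holo (fun w => w - z) z := holoB (holo_id z) (holo_cst z z).
have hv : holo v z := holoD (holoM (holo_cst _ z) hg) (holoM hid (holo_derive1 hg)).
have hQ : holo (fun w => (w - z) ^+ k * v w ^+ 2 * (g w)^-1) z.
  exact: holoM (holoM (holoX k hid) (holoX 2 hv)) (holoV gz hg).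
have [N QN] := continuous_near_bounded
  (continuous_comp (holo_continuous hQ) (@continuous_normc R _)).
exists N; apply: filterS3 (near_join gE) (filterI QN hg) (near_neq0 (holo_continuous hg) gz).
move=> w gEw [QNw dgw] gw; rewrite (derive_factor k.+2 g w)// (nbhs_singleton gEw).
rewrite -normcX (_ : _ ^+ 2 = (w - z) ^+ k * v w ^+ 2 * (g w)^-1 * ((w - z) ^+ k.+2 * g w)).
  by rewrite normcM ler_wpM2r ?normc_ge0.
by rewrite /v /= !exprS; field.
Qed.

Lemma density_bounded_ramified H s z : uniq s -> holo H z -> H z \in s -> derive1 H z = 0 ->
  exists M, \forall w \near z, density H s w <= M.
Proof.
move=> us hH sa H'z; set a := H z in sa *; have [N HN] := sqr_derive1_le_dist hH (erefl a) H'z.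
pose rest w := (1 + normc (H w - a)) ^+ (size s - 4) *
  \prod_(b <- rem a s) weight_factor (size s) (normc (H w - b)).
have cH := holo_continuous hH; have crest : {for z, continuous rest}.
  have c_num : {for z, continuous (fun w => 1 + normc (H w - a))}.
    exact (continuousD (@cst_continuous C R 1 z) (continuous_normcB (a := a) cH)).
  apply: continuousM (continuousX c_num) _; apply: continuous_prod => b.
  rewrite mem_rem_uniq// inE => /andP[ba _].
  have ab : H z != b by rewrite eq_sym.
  exact (continuous_comp cH (continuous_weight_factor (q := size s) ab)).
have [M restM] := continuous_near_bounded crest.
exists (`|N| ^+ size s * M); apply: filterS2 HN restM => w HNw restMw.
have -> : density H s w = (normc (derive1 H w) ^+ 2 / normc (H w - a)) ^+ size s * rest w.
  by rewrite /density /weight (big_rem a)//= {1}/weight_factor exprM expr_div_n /rest; ring.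
have rest0 : 0 <= rest w.
  rewrite mulr_ge0 ?exprn_ge0 ?addr_ge0 ?normc_ge0//.
  by apply: prodr_ge0 => b _; rewrite weight_factor_ge0 ?normc_ge0.
apply: ler_pM => //; first by rewrite exprn_ge0// divr_ge0 ?sqr_ge0 ?normc_ge0.
rewrite lerXn2r ?nnegrE ?divr_ge0 ?sqr_ge0 ?normc_ge0//.
have [->|Hw] := eqVneq (normc (H w - a)) 0; first by rewrite invr0 mulr0.
rewrite ler_pdivrMr ?lt_def ?Hw ?normc_ge0//; apply: le_trans HNw _.
by rewrite ler_wpM2r ?normc_ge0// ler_norm.
Qed.

(* Near a pole, h = 1/H turns the density into an expression that is continuous where H = 0:
   the powers of H coming from h' and from the q factors of the weight cancel. *)
Lemma density_bounded_pole h H s z : (3 < size s)%N -> holo H z -> H z = 0 ->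
  (\forall w \near z^', H w != 0 /\ h w = (H w)^-1) ->
  exists M, \forall w \near z^', density h s w <= M.
Proof.
set q := size s => q3 hH Hz hE; pose F a w := (normc (H w) + normc (1 - a * H w)) ^+ (q - 4) /
  normc (1 - a * H w) ^+ q.
have cH := holo_continuous hH.
have hD a : holo (fun w => 1 - a * H w) z := holoB (holo_cst 1 z) (holoM (holo_cst a z) hH).
have D0 a : 1 - a * H z != 0 by rewrite Hz mulr0 subr0 oner_eq0.
have cF a : {for z, continuous (F a)}.
  have cD := continuous_comp (holo_continuous (hD a)) (@continuous_normc R _).
  have cnum := continuousD (continuous_comp cH (@continuous_normc R _)) cD.
  apply: continuousM (continuousX cnum) _; apply: continuousV (continuousX cD).
  by rewrite expf_neq0// normc_eq0.
have c_density :
    {for z, continuous (fun w => normc (derive1 H w) ^+ (2 * q) * \prod_(a <- s) F a w)}.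
  have cH' := continuous_comp (holo_continuous (holo_derive1 hH)) (@continuous_normc R _).
  by apply: continuousM (continuousX cH') _; apply: continuous_prod => a _; exact: cF.
have [M FM] := continuous_near_bounded c_density; exists M.
apply: filterS3 (dnear_join hE) (near_dnear FM) (near_dnear hH) => w /[dup] /nbhs_singleton[Hw hw].
move=> near_hE FMw dH.
have dh : derive1 h w = - (derive1 H w / H w ^+ 2).
  apply: derive1_val; have := is_derive_inv Hw (derivable_is_derive dH); rewrite mulNr.
  by apply: near_eq_is_derive; apply: filterS near_hE => v [_ ->].
have H0 : 0 < normc (H w) by rewrite normc_gt0.
have factorE a : weight_factor q (normc (h w - a)) = F a w * normc (H w) ^+ 4.
  have -> : normc (h w - a) = normc (1 - a * H w) / normc (H w).
    by rewrite -normcV -normcM hw mulrBl mulfK// mul1r.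
  rewrite /weight_factor /F; move: (normc (1 - _)) (normc (H w)) H0 => D r r0.
  have -> : 1 + D / r = (r + D) / r by field; rewrite gt_eqF.
  rewrite !expr_div_n invf_div; have -> : r ^+ q = r ^+ (q - 4) * r ^+ 4 by rewrite -exprD subnK.
  move: (D ^+ q)^-1 => Dq.
  by field; rewrite expf_neq0// gt_eqF.
suff -> : density h s w = normc (derive1 H w) ^+ (2 * q) * \prod_(a <- s) F a w by [].
have weightE : weight s (h w) = \prod_(a <- s) (F a w * normc (H w) ^+ 4).
  by apply: eq_bigr => a _; exact: factorE.
rewrite /density dh normcN normcM normcV normcX weightE -/q.
rewrite big_split /= big_const_seq count_predT iter_mulr_1 -/q expr_div_n -!exprM.
have -> : (2 * (2 * q) = 4 * q)%N by lia.
by field; rewrite expf_neq0// gt_eqF.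
Qed.

End DensityNearSingularities.

Section TotallyRamified.
Context {R : realType}.
Local Notation C := (Cplx R).
Implicit Types (f : C -> sphere R) (s : seq C) (a z w : C).

Lemma meromorphic_density_bounded f s z : meromorphic f -> uniq s -> (3 < size s)%N ->
  (forall a, a \in s -> f z = Some a -> derive1 (finite_part f) z = 0) ->
  exists M, \forall w \near z^', density (finite_part f) s w <= M.
Proof.
move=> mf us q3 ram; have [fz|fz] := pselect (f z = None).
  have := meromorphic_germ_value z mf; rewrite fz => -[H [hH Hz fH]].
  exact: density_bounded_pole q3 hH Hz fH.
have hf := meromorphic_holo mf fz; have fzE := finite_partE fz.
suff [M dM] : exists M, \forall w \near z, density (finite_part f) s w <= M.
  by exists M; exact: near_dnear.
have [sa|sa] := boolP (finite_part f z \in s).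
  exact: density_bounded_ramified us hf sa (ram _ sa fzE).
exact: continuous_near_bounded (continuous_density hf sa).
Qed.

Lemma meromorphic_cst a : meromorphic (fun _ : C => Some a : sphere R).
Proof.
move=> z; have dcst w : derivable (finite_part (fun _ : C => Some a : sphere R)) w 1.
  exact: holo_derivable (holo_cst a w).
by split; [apply: filterS filterT => w _; split|].
Qed.

Lemma nonconstant_near_neq f a z : meromorphic f -> nonconstant f ->
  \forall w \near z^', finite_part f w != a.
Proof.
move=> mf ncf; have := mero_eq0 (meroD (meromorphic_mero z mf) (holo_mero (holo_cst (- a) z))).
case=> [fa|]; last by apply: filterS => w; rewrite subr_eq0.
case: ncf; exists (Some a); apply: (identity_theorem (z0 := z) mf (meromorphic_cst a)).
by apply: filterS fa => w /eqP; rewrite subr_eq0 => /eqP.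
Qed.

Lemma totally_ramified_constant f s : meromorphic f -> uniq s -> (4 < size s)%N ->
  (forall z a, a \in s -> f z = Some a -> derive1 (finite_part f) z = 0) ->
  exists v, forall z, f z = v.
Proof.
move=> mf us q4 ram; apply: contrapT => ncf.
pose B : set C := [set w | f w = None \/ finite_part f w \in s].
have isoB z : \forall w \near z^', ~ B w.
  have near_s : \forall w \near z^', forall a, a \in s -> finite_part f w != a.
    by apply: near_all_in => a _; exact: nonconstant_near_neq.
  by apply: filterS2 near_s (meromorphic_regular z mf) => w ws [fw _] [//|/ws/eqP].
have dB z : B z -> exists M, \forall w \near z^', density (finite_part f) s w <= M.
  by move=> _; apply: meromorphic_density_bounded => // [|a]; [exact: ltnW|exact: ram].
have hB z : ~ B z -> holo (finite_part f) z /\ finite_part f z \notin s.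
  move=> Bz; split; last by apply/negP => sz; apply: Bz; right.
  by apply: meromorphic_holo => // fz; apply: Bz; left.
have df0 := ahlfors_derive1_eq0 us q4 isoB hB dB.
have [z0 /nearcP[r r0 Bz0]] := filter_ex (dnear_join (isoB 0)).
have f_cst w : disc z0 r w -> finite_part f w = finite_part f z0.
  apply: derive0_disc_cst => v /Bz0 Bv; have [hv _] := hB v Bv.
  by have := derivable_is_derive (holo_derivable hv); rewrite df0.
have near_disc0 := near_dnear (near_disc (disc_center z0 r0)).
have [w [/f_cst/eqP]] := filter_ex (filterI near_disc0
  (nonconstant_near_neq (finite_part f z0) z0 mf ncf)).
by move=> /eqP ->; rewrite eqxx.
Qed.

End TotallyRamified.

(** * The discriminant *)

Section SimpleRoots.
Context {F : closedFieldType}.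
Implicit Types (p r : {poly F}) (c x : F) (m : nat).

Lemma simple_roots_uniq r : r != 0 -> (forall x, root r x -> ~~ root r^`() x) ->
  exists2 s, uniq s & size r = (size s).+1 /\ forall x, (x \in s) = root r x.
Proof.
move=> r0 simple; have [s rE] := closed_field_poly_normal r.
have lc0 : lead_coef r != 0 by rewrite lead_coef_eq0.
exists s; last first.
  split=> [|x]; first by rewrite rE size_scale// size_prod_XsubC.
  by rewrite rE rootZ// root_prod_XsubC.
rewrite -separable_prod_XsubC -(eqp_separable (eqp_scale _ lc0)) -rE.
by rewrite unlock; apply: Pdiv.ClosedField.root_coprimep => x /simple.
Qed.

Lemma many_simple_roots p c m : ~~ (('X - c%:P) ^+ m.+1 %| p) ->
  (forall x, root p x -> root p^`() x -> x = c) ->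
  exists s, [/\ uniq s, (size p <= size s + m.+1)%N &
    forall x, x \in s -> root p x /\ ~~ root p^`() x].
Proof.
move=> c_mult multiple; have p0 : p != 0 by apply: contraNneq c_mult => ->; exact: dvdp0.
have [k [r]] := multiplicity_XsubC p c; rewrite p0 /= => rc pE.
have r0 : r != 0 by apply: contraNneq p0 => r0; rewrite pE r0 mul0r.
have root_p x : root r x -> root p x by move=> rx; rewrite pE rootM rx.
have root_dp x : root r x -> root r^`() x -> root p^`() x.
  by move=> rx drx; rewrite pE derivM /root hornerD !hornerM (eqP rx) (eqP drx) !mul0r addr0.
have simple x : root r x -> ~~ root r^`() x.
  move=> rx; apply/negP => drx; have xc := multiple x (root_p x rx) (root_dp x rx drx).
  by rewrite xc (negbTE rc) in rx.
have [s us [sz_r sE]] := simple_roots_uniq r0 simple.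
have km : (k <= m)%N.
  by rewrite leqNgt; apply: contra c_mult => mk; rewrite pE dvdp_mull// dvdp_exp2l.
exists s; split=> [//||x].
  have Xc0 : ('X - c%:P) ^+ k != 0 by rewrite expf_neq0// polyXsubC_eq0.
  by rewrite pE size_mul// sz_r size_exp_XsubC; move: (size s) km => n; lia.
rewrite sE => rx; split; first exact: root_p.
by apply/negP => /(multiple x (root_p x rx)) xc; rewrite xc (negbTE rc) in rx.
Qed.

End SimpleRoots.

Section EulerOperator.
Context {F : fieldType}.
Implicit Types (p q : {poly F}) (c : F) (n m : nat).

Definition euler p : {poly F} := 'X * p^`().

Lemma eulerD p q : euler (p + q) = euler p + euler q.
Proof. by rewrite /euler derivD mulrDr. Qed.

Lemma eulerZ c p : euler (c *: p) = c *: euler p.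
Proof. by rewrite /euler derivZ scalerAr. Qed.

Lemma eulerXn n : euler 'X^n = n%:R *: 'X^n.
Proof.
rewrite /euler derivXn; case: n => [|n]; first by rewrite mulr0 scale0r.
by rewrite mulrnAr -exprS scaler_nat.
Qed.

Lemma dvdp_euler p c m : ('X - c%:P) ^+ m.+1 %| p -> ('X - c%:P) ^+ m %| euler p.
Proof.
move=> /dvdpP[q ->]; rewrite /euler dvdp_mull// derivM deriv_exp derivXsubC mul1r /= dvdp_add//.
  by rewrite exprS mulrA dvdp_mull.
by rewrite -mulr_natr mulrCA dvdp_mulIl.
Qed.

Lemma root_iter_euler p c m : ('X - c%:P) ^+ m.+1 %| p -> root (iter m euler p) c.
Proof.
elim: m p => [|m IH] p; first by rewrite expr1 dvdp_XsubCl.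
by move=> /dvdp_euler/IH; rewrite -iterSr.
Qed.

End EulerOperator.

Section Discriminant.
Context {F : numClosedFieldType}.
Implicit Types (A a b w : F) (k : nat).

(* The discriminant in [y] of [(h^(k+2) - A) y^2 + a (h^(k+1) - A) y + b (h^k - A)], as a
   polynomial in [h]. *)
Definition discr k a b A : {poly F} :=
  a ^+ 2 *: ('X^(k.+1) - A%:P) ^+ 2 - (4 * b) *: (('X^(k.+2) - A%:P) * ('X^(k) - A%:P)).

(* With N = k + 1, this is -N^2 / (4 b) times [discr k a b A] when [a ^+ 2 = 4 (1 - 1 / N^2) b]. *)
Definition special_discr k A : {poly F} :=
  'X^(k.+1 + k.+1) + (A ^+ 2) *: 'X^(0) + (- (A * k.+1%:R ^+ 2)) *: 'X^(k.+2)
  + (- (A * k.+1%:R ^+ 2)) *: 'X^(k) + (2 * A * (k.+1%:R ^+ 2 - 1)) *: 'X^(k.+1).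

Lemma horner_special_discr k A w : (special_discr k A).[w] =
  (w ^+ k * w) ^+ 2 + A ^+ 2 - A * k.+1%:R ^+ 2 * (w ^+ k * w ^+ 2 + w ^+ k)
  + 2 * A * (k.+1%:R ^+ 2 - 1) * (w ^+ k * w).
Proof.
rewrite /special_discr !(hornerD, hornerZ, hornerXn) exprD !(exprSr w).
by move: (w ^+ k) => u; ring.
Qed.

Lemma horner_euler_special_discr k A w : (euler (special_discr k A)).[w] =
  let N := k.+1%:R in
  2 * N * (w ^+ k * w) ^+ 2 - A * N ^+ 2 * ((N + 1) * (w ^+ k * w ^+ 2) + (N - 1) * w ^+ k)
  + 2 * A * (N ^+ 2 - 1) * N * (w ^+ k * w).
Proof.
rewrite /special_discr !(eulerD, eulerZ, eulerXn) !(hornerD, hornerZ, hornerXn) exprD !(exprSr w).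
rewrite natrD -[k.+2%:R]natr1 -[k.+1%:R]natr1 /=.
by move: (w ^+ k) => u; ring.
Qed.

Lemma special_discr_multiple_root k A w : (0 < k)%N -> A != 0 ->
  root (special_discr k A) w -> root (special_discr k A)^`() w -> w = 1.
Proof.
move=> k0 A0 /eqP p0 /eqP dp0; have w0 : w != 0.
  apply: contraNneq A0 => w0; have := p0; rewrite horner_special_discr w0 !expr0n gtn_eqF//=.
  rewrite !(mulr0n, mul0r, mulr0, addr0, subr0, add0r) expr0n /= add0r.
  by move=> /eqP; rewrite expf_eq0.
have : (euler (special_discr k A)).[w] = 0 by rewrite hornerM dp0 mulr0.
have : w ^+ k != 0 by rewrite expf_neq0.
have N0 : k.+1%:R != 0 :> F by rewrite pnatr_eq0.
have N1 : k.+1%:R ^+ 2 - 1 != 0 :> F.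
  by rewrite -natrX subr_eq0 pnatr_eq1 -(exp1n 2) eqn_exp2r// eqSS gtn_eqF.
move: p0; rewrite horner_special_discr horner_euler_special_discr /=.
move: N0 N1; set N : F := k.+1%:R; move: (w ^+ k) => u N0 N1 p0 u0 euler0.
have sumE : u ^+ 2 * w ^+ 2 + A ^+ 2 = A * u * (N ^+ 2 * (w ^+ 2 + 1) - 2 * (N ^+ 2 - 1) * w).
  by apply/eqP; rewrite -subr_eq0 -[X in _ == X]p0; apply/eqP; ring.
have diffE : u ^+ 2 * w ^+ 2 - A ^+ 2 = A * N * u * (w ^+ 2 - 1).
  apply: (mulfI N0); apply/eqP; rewrite -subr_eq0; apply/eqP.
  by transitivity (0 - N * 0 : F); [rewrite -{1}euler0 -p0; ring|rewrite mulr0 subr0].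
have : (A * u) ^+ 2 * (N ^+ 2 * (N ^+ 2 - 1)) * (w - 1) ^+ 4 = 0.
  transitivity ((u ^+ 2 * w ^+ 2 + A ^+ 2) ^+ 2 - (u ^+ 2 * w ^+ 2 - A ^+ 2) ^+ 2
    - 4 * (A ^+ 2 * u ^+ 2 * w ^+ 2)); last by ring.
  by rewrite sumE diffE; ring.
move/eqP; rewrite mulf_eq0 expf_eq0 /= subr_eq0 => /orP[|/eqP//].
by rewrite !mulf_eq0 (negbTE A0) (negbTE u0) (negbTE N0) (negbTE N1).
Qed.

Lemma special_discr_multiplicity1 k A : (0 < k)%N -> ~~ (('X - 1%:P) ^+ 5 %| special_discr k A).
Proof.
move=> k0; apply/negP => div5.
have A1 : A = 1.
  have : root (special_discr k A) 1.
    by rewrite -dvdp_XsubCl; apply: dvdp_trans div5; rewrite exprS dvdp_mulIl.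
  rewrite /root horner_special_discr !expr1n => /eqP p0; apply/esym/eqP.
  by rewrite -subr_eq0 -sqrf_eq0 -[X in _ == X]p0; apply/eqP; ring.
have := root_iter_euler div5; rewrite /special_discr A1 /= !(eulerD, eulerZ, eulerXn) /root.
rewrite !(hornerD, hornerZ, hornerXn) !expr1n natrD -[k.+2%:R]natr1 -[k.+1%:R]natr1.
rewrite [X in X == 0](_ : _ = 2 * k.+1%:R ^+ 2 * (k%:R * (k%:R + 2))); last first.
  by rewrite -[k.+1%:R]natr1; ring.
by rewrite !mulf_eq0 -natrD !pnatr_eq0 addn2 /= gtn_eqF.
Qed.

Lemma discr_special k a b A : a ^+ 2 = 4 * (1 - 1 / k.+1%:R ^+ 2) * b ->
  discr k a b A = (- (4 * b / k.+1%:R ^+ 2)) *: special_discr k A.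
Proof.
move=> ab; have N0 : k.+1%:R != 0 :> F by rewrite pnatr_eq0.
rewrite /discr /special_discr ab; set N := k.+1%:R in N0 *.
pose beta := b / N ^+ 2; have -> : b = beta * N ^+ 2 by rewrite /beta mulfVK ?expf_neq0.
have -> : 4 * (1 - 1 / N ^+ 2) * (beta * N ^+ 2) = 4 * (N ^+ 2 - 1) * beta by field.
have -> : 4 * (beta * N ^+ 2) / N ^+ 2 = 4 * beta by field.
rewrite exprD !(exprSr 'X) expr0 -!mul_polyC; move: ('X^k) => u.
by ring.
Qed.

Lemma size_special_discr k A : (0 < k)%N -> size (special_discr k A) = (k.+1 + k.+1).+1.
Proof.
move=> k0; rewrite /special_discr -!addrA size_polyDl size_polyXn// ltnS.
have size_term c n : (n <= k.+2)%N -> (size (c *: 'X^n : {poly F}) <= k.+1 + k.+1)%N.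
  by move=> nk; rewrite (leq_trans (size_scale_leq _ _))// size_polyXn; lia.
have size_add (p q : {poly F}) m : (size p <= m)%N -> (size q <= m)%N -> (size (p + q)%R <= m)%N.
  by move=> pm qm; rewrite (leq_trans (size_polyD _ _))// geq_max pm.
rewrite 3?size_add// ?size_term//; lia.
Qed.

Lemma discr_simple_roots k a b A : (3 < k)%N -> A != 0 -> b != 0 ->
  a ^+ 2 = 4 * (1 - 1 / k.+1%:R ^+ 2) * b ->
  exists s, [/\ uniq s, (4 < size s)%N &
    forall x, x \in s -> root (discr k a b A) x /\ ~~ root (discr k a b A)^`() x].
Proof.
move=> k3 A0 b0 ab; have k0 : (0 < k)%N by lia.
have c0 : - (4 * b / k.+1%:R ^+ 2) != 0.
  by rewrite oppr_eq0 !mulf_neq0 ?invr_neq0 ?expf_neq0// pnatr_eq0.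
have [s [us sz_s simple]] := many_simple_roots (special_discr_multiplicity1 A k0)
  (fun w => @special_discr_multiple_root k A w k0 A0).
exists s; split=> [//||x xs].
  by move: sz_s; rewrite size_special_discr//; move: (size s) => m; lia.
by rewrite (discr_special A ab) derivZ !rootZ//; exact: simple.
Qed.

End Discriminant.

Section Trinomial.
Context {F : numClosedFieldType}.
Implicit Types (a b h y A : F) (k : nat).

Definition trinomial k c2 c1 c0 : {poly F} := c2 *: 'X^(k.+2) + c1 *: 'X^(k.+1) + c0 *: 'X^k.

Definition ratio_trinomial k a b A h : {poly F} :=
  trinomial k (h ^+ k.+2 - A) (a * (h ^+ k.+1 - A)) (b * (h ^+ k - A)).

Lemma horner_trinomial k c2 c1 c0 y :
  (trinomial k c2 c1 c0).[y] = (c2 * y ^+ 2 + c1 * y + c0) * y ^+ k.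
Proof. by rewrite /trinomial !(hornerD, hornerZ, hornerXn) !exprS; ring. Qed.

Lemma horner_ratio_trinomial k a b A h y : (ratio_trinomial k a b A h).[y] =
  (trinomial k 1 a b).[h * y] - A * (trinomial k 1 a b).[y].
Proof. by rewrite !horner_trinomial !exprMn !exprS; ring. Qed.

Lemma trinomial_eq0 k c2 c1 c0 : trinomial k c2 c1 c0 = 0 -> c2 = 0 /\ c1 = 0.
Proof.
move=> t0; have coef i : (trinomial k c2 c1 c0)`_i = 0 by rewrite t0 coef0.
have [kS kSS Sk] : [/\ (k.+1 == k) = false, (k.+2 == k) = false & (k == k.+1) = false].
  by split; lia.
move: (coef k.+2) (coef k.+1); rewrite !coefD !coefZ !coefXn !eqxx !eqSS kS kSS Sk.
by rewrite !(mulr0, mulr1, addr0, add0r).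
Qed.

Lemma ratio_trinomial_eq0 k a b A h : a != 0 -> A != 0 -> ratio_trinomial k a b A h = 0 -> h = 1.
Proof.
move=> a0 A0 /trinomial_eq0[/eqP]; rewrite subr_eq0 exprS => /eqP hA /eqP.
rewrite mulf_eq0 (negbTE a0) subr_eq0 => /eqP hA1; apply: (mulIf A0).
by rewrite mul1r -{1}hA1 hA.
Qed.

Lemma sqr_discr k a b A h y : y != 0 -> root (ratio_trinomial k a b A h) y ->
  (2 * y * (h ^+ k.+2 - A) + a * (h ^+ k.+1 - A)) ^+ 2 = (discr k a b A).[h].
Proof.
move=> y0; rewrite /root horner_trinomial mulf_eq0 [_ ^+ k == 0](negbTE (expf_neq0 _ y0)) orbF.
move=> /eqP quad0; rewrite /discr hornerD hornerN !hornerZ horner_exp hornerM.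
rewrite !(hornerD, hornerN, hornerXn, hornerC).
transitivity (a ^+ 2 * (h ^+ k.+1 - A) ^+ 2 - 4 * b * ((h ^+ k.+2 - A) * (h ^+ k - A))
  + 4 * (h ^+ k.+2 - A) * 0); last by rewrite mulr0 addr0.
by rewrite -quad0; ring.
Qed.

End Trinomial.

Section StrongUniqueness.
Context {R : realType}.
Local Notation C := (Cplx R).
Implicit Types (z w a b A : C) (f g : C -> sphere R) (G H y : C -> C) (P Q : {poly C}) (k : nat).

(* Near [z] the function [y] is bounded, hence extends to [Y] with [Y ^+ 2 = Q \o H] and [Y z = 0];
   differentiating gives [Q'(H z) H'(z) = 0]. *)
Lemma sqr_simple_root_ramified H y Q z : holo H z -> mero y z ->
  (\forall w \near z^', y w ^+ 2 = Q.[H w]) -> root Q (H z) -> ~~ root Q^`() (H z) ->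
  derive1 H z = 0.
Proof.
move=> hH my yQ Q0 Q1; have cQ : {for z, continuous (fun w => normc Q.[H w])}.
  exact (continuous_comp (holo_continuous (holo_horner Q hH)) (@continuous_normc R _)).
have [M QM] := continuous_near_bounded cQ.
have y_bound : \forall w \near z^', normc (y w) <= M + 1.
  apply: filterS2 yQ (near_dnear QM) => w <-; rewrite normcX => yM.
  by have := normc_ge0 (y w); nra.
have dy : \forall w \near z^', derivable y w 1.
  have [v hv] := mero_germ_value my.
  by apply: filterS (germ_value_near_holo hv) => w; exact: holo_derivable.
have [Y hY yY] := removable_singularity dy y_bound.
have Y2 : \forall w \near z^', Y w ^+ 2 = Q.[H w] by apply: filterS2 yY yQ => w ->.
have Y2z : Y z ^+ 2 = Q.[H z].
  exact: continuous_dnear_eq (holo_continuous (holoX 2 hY)) (holo_continuous (holo_horner Q hH)) Y2.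
have Yz : Y z = 0 by apply/eqP; rewrite -sqrf_eq0 Y2z.
have dY2 := is_derive_exp 2 (derivable_is_derive (holo_derivable hY)).
have dQH := is_derive_comp (is_derive_horner Q (H z)) (derivable_is_derive (holo_derivable hH)).
have := derive1_val (near_eq_is_derive (dnear_near Y2z Y2) dY2).
rewrite (derive1_val dQH) Yz expr1 mulr0 mul0r => /eqP.
by rewrite mulf_eq0 => /orP[/(negP Q1)//|/eqP].
Qed.

Lemma discr_root_ramified k a b A G H z : mero G z -> holo H z ->
  (\forall w \near z^', G w != 0 /\ root (ratio_trinomial k a b A (H w)) (G w)) ->
  root (discr k a b A) (H z) -> ~~ root (discr k a b A)^`() (H z) -> derive1 H z = 0.
Proof.
move=> mG hH ratio_root; pose y w := 2 * G w * (H w ^+ k.+2 - A) + a * (H w ^+ k.+1 - A).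
apply: (@sqr_simple_root_ramified H y) => //; last first.
  by apply: filterS ratio_root => w [Gw /(sqr_discr Gw)].
have mcst c : mero (fun=> c) z := holo_mero (holo_cst c z).
have mpow i := meroD (meroX i (holo_mero hH)) (mcst (- A)).
exact: meroD (meroM (meroM (mcst 2) mG) (mpow k.+2)) (meroM (mcst a) (mpow k.+1)).
Qed.

Lemma nonconstant_poly_eq0 g Q z : meromorphic g -> nonconstant g ->
  (\forall w \near z^', root Q (finite_part g w)) -> Q = 0.
Proof.
move=> mg ncg rootQ; apply/eqP; apply: contraT => Q0.
have [s QE] := closed_field_poly_normal Q.
have near_s : \forall w \near z^', forall a, a \in s -> finite_part g w != a.
  by apply: near_all_in => a _; exact: nonconstant_near_neq.
have [w [ws]] := filter_ex (filterI near_s rootQ).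
rewrite QE rootZ ?lead_coef_eq0// root_prod_XsubC => /ws.
by rewrite eqxx.
Qed.

Lemma sphere_horner_scale P f g A w : f w <> None -> g w <> None ->
  sphere_horner P (f w) = omap (fun u => A * u) (sphere_horner P (g w)) ->
  P.[finite_part f w] = A * P.[finite_part g w].
Proof.
by move=> /finite_partE fw /finite_partE gw; rewrite {1}fw {1}gw /= => -[].
Qed.

Lemma ratio_trinomial_root k a b A f g w : f w <> None -> g w <> None -> finite_part g w != 0 ->
  sphere_horner (trinomial k 1 a b) (f w) =
    omap (fun u => A * u) (sphere_horner (trinomial k 1 a b) (g w)) ->
  root (ratio_trinomial k a b A (finite_part f w / finite_part g w)) (finite_part g w).
Proof.
move=> fw gw g0 /(sphere_horner_scale fw gw) PE.
by rewrite /root horner_ratio_trinomial divfK// PE subrr.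
Qed.

Lemma strong_uniqueness_trinomial k a b : (3 < k)%N -> a != 0 -> b != 0 ->
  a ^+ 2 = 4 * (1 - 1 / k.+1%:R ^+ 2) * b -> strong_uniqueness_poly (trinomial k 1 a b).
Proof.
move=> k3 a0 b0 ab f g A mf mg ncf ncg A0 PE.
pose F := finite_part f; pose G := finite_part g; pose h w := F w / G w.
have mF z : mero F z := meromorphic_mero z mf.
have mG z : mero G z := meromorphic_mero z mg.
have mh z : mero h z := meroM (mF z) (meroV (mG z)).
have ratio_root z : \forall w \near z^', G w != 0 /\ root (ratio_trinomial k a b A (h w)) (G w).
  apply: filterS3 (meromorphic_regular z mf) (meromorphic_regular z mg)
    (nonconstant_near_neq 0 z mg ncg).
  by move=> w [fw _] [gw _] Gw; split=> //; exact: ratio_trinomial_root.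
have [H mH HE] := meromorphic_extension mh.
have finE z : \forall w \near z^', finite_part H w = h w.
  by apply: filterS (HE z) => w; rewrite /finite_part => ->.
have [s [us s4 simple]] := discr_simple_roots k3 A0 b0 ab.
have ram z x : x \in s -> H z = Some x -> derive1 (finite_part H) z = 0.
  move=> /simple[root_x simple_x] Hz; have HzE : finite_part H z = x by rewrite /finite_part Hz.
  apply: (discr_root_ramified (A := A) (mG z)); rewrite ?HzE; [| |exact: root_x|exact: simple_x].
    by apply: meromorphic_holo => //; rewrite Hz.
  by apply: filterS2 (finE z) (ratio_root z) => w ->.
have [v Hv] := totally_ramified_constant mH us s4 ram.
have Hh : \forall w \near 0^', h w = odflt 0 v.
  by apply: filterS (HE 0) => w; rewrite Hv => ->.
have ratio0 : ratio_trinomial k a b A (odflt 0 v) = 0.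
  apply: (nonconstant_poly_eq0 (z := 0) mg ncg).
  by apply: filterS2 Hh (ratio_root 0) => w <- [].
apply: (identity_theorem (z0 := 0) mf mg); apply: filterS2 Hh (ratio_root 0) => w hw [Gw _].
rewrite -[LHS](divfK Gw) -/(F w) -/(G w) -/(h w) hw.
by rewrite (ratio_trinomial_eq0 a0 A0 ratio0) mul1r.
Qed.

End StrongUniqueness.

Theorem theorem6p2p3 (R : realType) (n : nat) (a b : Cplx R)
  (hn : (6 <= n)%N)
  (hab : a * b != 0)
  (hlambda : a ^+ 2 = 4%:R * (1 - 1 / (n%:R - 1) ^+ 2) * b) :
  strong_uniqueness_poly ('X^n + a *: 'X^(n - 1) + b *: 'X^(n - 2)).
Proof.
move: hab; rewrite mulf_eq0 negb_or => /andP[a0 b0].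
case: n hn hlambda => [|[|k]] // k4 hlambda; rewrite subSS subn0 !subSS subn0.
have ab : a ^+ 2 = 4 * (1 - 1 / k.+1%:R ^+ 2) * b by rewrite hlambda -[k.+2%:R]natr1 addrK.
have := strong_uniqueness_trinomial k4 a0 b0 ab.
by rewrite /trinomial scale1r.
Qed.
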